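(* Let $0<p<\infty$. The space $\mathcal T^{(p)}$ has an uncountable family $(\mathcal X_j)_{j\in J}$ of non-equivalent conditional (i.e. not unconditional) almost greedy bases; more precisely, for $i\ne j$ in $J$, no perturbation of $\mathcal X_i$ is equivalent to a permutation of $\mathcal X_j$.
   Context: $\mathbb N=\{1,2,\dots\}$; scalars are $\mathbb F=\mathbb R$ or $\mathbb C$. Tsirelson's space $\mathcal T$ is the completion of $c_{00}$ (finitely supported scalar sequences indexed by $\mathbb N$) under the unique norm satisfying $\|x\|=\max\{\|x\|_\infty,\ \tfrac12\sup\sum_{i=1}^k\|E_ix\|\}$, the supremum being over all $k\in\mathbb N$ and all finite nonempty $E_1<\dots<E_k$ in $\mathbb N$ with $k\le\min E_1$ ($E_i<E_{i+1}$ means $\max E_i<\min E_{i+1}$; $Ex$ is the restriction of $x$ to $E$). The unit vectors form a normalized $1$-unconditional basis of $\mathcal T$, so $\mathcal T$ is regarded as a space of sequences. For $0<p<\infty$, $\mathcal T^{(p)}$ is the space of scalar sequences $f=(a_n)_{n=1}^\infty$ with $|f|^p=(|a_n|^p)_{n=1}^\infty\in\mathcal T$, with quasi-norm $\|f\|=\||f|^p\|_{\mathcal T}^{1/p}$. A basis of a (quasi-)Banach space $X$ is a norm-bounded sequence $\mathcal X=(x_n)_{n=1}^\infty$ with dense linear span for which there is a norm-bounded sequence $(x_n^* )_{n=1}^\infty$ in $X^*$ biorthogonal to it. Given $f\in X$, let $\rho\colon\mathbb N\to\mathbb N$ be the greedy ordering of $f$: the injective map with $\{n: x_n^*(f)\ne0\}\subseteq\rho(\mathbb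 N)$ such that for $j<k$ either $|x^*_{\rho(j)}(f)|>|x^*_{\rho(k)}(f)|$, or these are equal and $\rho(j)<\rho(k)$. Put $\mathcal G_m(f)=\sum_{j=1}^m x^*_{\rho(j)}(f)x_{\rho(j)}$. The basis is almost greedy if there is $C\ge1$ with $\|f-\mathcal G_m(f)\|\le C\inf\{\|f-\sum_{n\in A}x_n^*(f)x_n\|: |A|=m\}$ for all $f\in X$, $m\in\mathbb N$. Two bases $(x_n)$, $(y_n)$ are equivalent if $x_n\mapsto y_n$ extends to a linear isomorphism between their closed spans. A permutation of $(x_n)$ is $(x_{\pi(n)})_{n=1}^\infty$ with $\pi$ a bijection of $\mathbb N$. A perturbation of $(x_n)$ is $(a_nx_n)_{n=1}^\infty$ with $(a_n)$ a sequence of scalars such that $0<\inf_n|a_n|\le\sup_n|a_n|<\infty$. *)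

(* Defs.v *)
From HB Require Import structures.
From mathcomp Require Import all_boot all_order all_algebra.
From mathcomp Require Import finmap complex.
From mathcomp Require Import all_classical all_reals all_analysis.

Set Implicit Arguments.
Unset Strict Implicit.
Unset Printing Implicit Defensive.

Import Order.TTheory GRing.Theory Num.Theory.
Import numFieldNormedType.Exports.

Local Open Scope classical_set_scope.
Local Open Scope ring_scope.

(* The norm of the numFieldType R[i] takes its values in R[i], hence the
   explicit modulus with values in R. *)
Record scalarField (R : realType) := ScalarField {
  scalar :> numFieldType;
  modulus : scalar -> R;
  of_real : R -> scalar
}.
Arguments ScalarField {R} scalar modulus of_real.

Definition real_scalars (R : realType) : scalarField R :=
  ScalarField R (fun x : R => `|x|) (fun x : R => x).

Definition complex_scalars (R : realType) : scalarField R :=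
  ScalarField R[i] (@Normc.normc R) (fun x : R => real_complex R x).

(* Indices start at 0 in Rocq and at 1 in the mathematics: the index n : nat
   stands for the natural number n.+1. *)
Notation sequences F := (nat -> F^o).

Section Tsirelson.
Variables (R : realType) (F : scalarField R).
Implicit Types (x f : sequences F) (N : sequences F -> R) (E : nat -> set nat).

Definition c00 : set (sequences F) :=
  [set x | finite_set [set n | x n != 0]].

Definition restr (A : set nat) x : sequences F :=
  fun n => if n \in A then x n else 0.

Definition supnorm x : R := sup (range (fun n => modulus (x n))).

Definition norm_on_c00 N : Prop :=
  [/\ forall x, c00 x -> N x = 0 -> x = 0,
      forall (a : F) x, c00 x -> N (a *: x) = modulus a * N x &
      forall x y, c00 x -> c00 y -> N (x + y) <= N x + N y].

(* Only E 0, ..., E k.-1 matter, and they are the sets E_1 < ... < E_k.  With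
   the shift of indices, k <= min E_1 reads: k <= n.+1 for every n in E 0. *)
Definition admissible (k : nat) E : Prop :=
  [/\ (0 < k)%N,
      forall i, (i < k)%N -> finite_set (E i) /\ E i !=set0,
      forall i m n, (i.+1 < k)%N -> E i m -> E i.+1 n -> (m < n)%N &
      forall n, E 0%N n -> (k <= n.+1)%N].

Definition admissible_sums N x : set R :=
  [set r | exists k E, admissible k E /\ r = \sum_(i < k) N (restr (E i) x)].

Definition is_tsirelson_norm N : Prop :=
  norm_on_c00 N /\
  forall x, c00 x ->
    N x = Num.max (supnorm x) (2^-1 * sup (admissible_sums N x)).

(* This norm is determined on c00; its values elsewhere are irrelevant. *)
Definition tsirelson_norm : sequences F -> R :=
  xget (fun=> 0) [set N | is_tsirelson_norm N].

Definition truncate (n : nat) x : sequences F := restr `I_n x.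

(* As the unit vectors form a basis of the completion of c00, a vector of the
   completion is a sequence whose truncations are Cauchy, and its norm is the
   limit of the norms of the truncations. *)
Definition tsirelson : set (sequences F) :=
  [set x | forall e : R, 0 < e -> exists M, forall m n,
     (M <= m)%N -> (M <= n)%N ->
     tsirelson_norm (truncate m x - truncate n x) < e].

Definition tsirelson_cnorm x : R :=
  lim ((fun n => tsirelson_norm (truncate n x)) @ \oo).

Definition abs_power (p : R) f : sequences F :=
  fun n => of_real F (modulus (f n) `^ p).

Definition tsirelson_p (p : R) : set (sequences F) :=
  [set f | tsirelson (abs_power p f)].

Definition tsirelson_p_qnorm (p : R) f : R :=
  tsirelson_cnorm (abs_power p f) `^ p^-1.

End Tsirelson.

Section GreedyOrdering.
Variables (R : realType) (F : scalarField R).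
Implicit Types (c : nat -> F) (rho : nat -> nat).

Definition is_greedy_ordering c rho : Prop :=
  [/\ injective rho,
      [set n | c n != 0] `<=` range rho &
      forall j k, (j < k)%N ->
        modulus (c (rho k)) < modulus (c (rho j)) \/
        modulus (c (rho j)) = modulus (c (rho k)) /\ (rho j < rho k)%N].

(* Such an ordering exists when c tends to 0, as do the coefficients of a vector
   with respect to a basis.  Two such orderings can differ only at indices n with
   c n = 0, so the greedy sums do not depend on the choice. *)
Definition greedy_ordering c : nat -> nat :=
  xget (id : nat -> nat) [set rho | is_greedy_ordering c rho].

End GreedyOrdering.

(* The quasi-Banach space is the subspace X of V with the quasi-norm q. *)
Section Bases.
Variables (R : realType) (F : scalarField R) (V : lmodType F).
Variables (X : set V) (q : V -> R).
Implicit Types (x y : nat -> V) (xs : nat -> V -> F) (f g : V).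

Definition lin_span x : set V :=
  [set g | exists (n : nat) (a : nat -> F), g = \sum_(i < n) a i *: x i].

Definition closed_span x : set V :=
  [set f | X f /\
    forall e : R, 0 < e -> exists2 g, lin_span x g & q (f - g) < e].

Definition linear_functional (phi : V -> F) : Prop :=
  forall (a : F) f g, X f -> X g -> phi (a *: f + g) = a * phi f + phi g.

(* Boundedness of xs in the dual: the functionals are continuous, with a common
   bound on their norms. *)
Definition dual_bounded xs : Prop :=
  (forall n, linear_functional (xs n)) /\
  exists C : R, forall n f, X f -> modulus (xs n f) <= C * q f.

Definition biorthogonal x xs : Prop :=
  forall m n, xs m (x n) = (m == n)%:R.

Definition is_basis x xs : Prop :=
  [/\ forall n, X (x n),
      exists C : R, forall n, q (x n) <= C,
      X `<=` closed_span x,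
      dual_bounded xs &
      biorthogonal x xs].

Definition greedy_sum x xs (m : nat) f : V :=
  let rho := greedy_ordering (fun n => xs n f) in
  \sum_(j < m) xs (rho j) f *: x (rho j).

Definition sigma_error x xs (m : nat) f : R :=
  inf [set r | exists A : {fset nat},
    #|` A| = m /\ r = q (f - \sum_(n <- A) xs n f *: x n)].

Definition almost_greedy x xs : Prop :=
  exists2 C : R, 1 <= C & forall f m, X f -> (0 < m)%N ->
    q (f - greedy_sum x xs m f) <= C * sigma_error x xs m f.

Definition unconditional x xs : Prop :=
  forall f (pi : nat -> nat), X f -> bijective pi ->
    (fun n => q (f - \sum_(j < n) xs (pi j) f *: x (pi j))) @ \oo --> (0 : R).

(* The two-sided estimate makes T injective and bicontinuous. *)
Definition equivalent x y : Prop :=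
  exists (T : V -> V) (C : R),
    [/\ forall (a : F) f g, closed_span x f -> closed_span x g ->
          T (a *: f + g) = a *: T f + T g,
        T @` closed_span x = closed_span y,
        0 < C,
        forall f, closed_span x f -> q f <= C * q (T f) /\ q (T f) <= C * q f &
        forall n, T (x n) = y n].

Definition perturbation (a : nat -> F) x : nat -> V := fun n => a n *: x n.

Definition perturbation_scalars (a : nat -> F) : Prop :=
  0 < inf (range (fun n => modulus (a n))) /\
  has_ubound (range (fun n => modulus (a n))).

Definition permutation (pi : nat -> nat) x : nat -> V := fun n => x (pi n).

End Bases.

(* Main.v *)
(** On each dyadic block of coordinates the unit vectors of Tsirelson's space are
    equivalent to those of l_1, uniformly.  Moreover the norm of T^(p) depends,
    up to a constant, only on the l_p-masses of the dyadic blocks: the leaves of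
    a norming tree can be spread evenly over their blocks.  Hence, in a sparse
    sequence of blocks, the unit vectors may be replaced by finite systems of
    l_p^N which are uniformly quasi-greedy and democratic but badly conditional,
    and the result is a conditional almost greedy basis.

    For p <= 1 the systems are Lindenstrauss trees with large branching number.
    For p > 1 each consists of two copies of l_p^N, the second one perturbed by
    an operator which takes averages of the first one over the levels of a
    partition and moves them along a sparse graph on the levels.  In both cases
    the projections on at most m coordinates are uniformly bounded as soon as
    the branching number is large in terms of m.

    The growth in m of the norms of the coordinate projections on at most m
    coordinates is invariant, up to constants, under permutations, perturbations
    and equivalence.  With sizes increasing fast enough, this growth recognizes
    up to finitely many members the set of blocks which have been modified, and
    there are uncountably many sets of natural numbers with pairwise infinite
    differences. *)
Require Import Defs.
From HB Require Import structures.
From mathcomp Require Import all_boot all_order all_algebra.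
From mathcomp Require Import finmap complex zify.
From mathcomp Require Import all_classical all_reals all_analysis.
From mathcomp Require Import ring lra.

Import Order.TTheory GRing.Theory Num.Theory.
Import numFieldNormedType.Exports.

Local Open Scope classical_set_scope.
Local Open Scope ring_scope.

(** A basis is controlled by four estimates on each block, with one threshold t for all blocks,
    since a greedy set cuts all of them at the same height. The obstacle is a block that is
    arbitrarily conditional and yet good with a fixed constant. The tree argument uses the
    subadditivity of the p-th power, hence p <= 1. For p > 1, a threshold t separates small levels,
    which have too few coordinates to matter at height t, from large ones, where the entries
    produced by the perturbation are small compared with t. Edges within one side are harmless, and
    only those crossing the cut count. With edges n --> n + 2 ^ e, e < L, the crossing ones cost L +
    L ^ (p - 1), while all edges together produce L ^ p. Scaling by the larger of L and L ^ (p - 1)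
    leaves L ^ min(1, p - 1), which is unbounded. In both constructions the branching number depends
    on m alone; the depth, or the degree L, is chosen afterwards according to the required norm K.
    Hence a new block can be made worse than anything the earlier ones allow. *)

Section Norming.
Variable R : realType.
Implicit Types (phi psi w v : nat -> R) (E : nat -> pred nat) (k n : nat).

(** * Norming functionals of Tsirelson's space *)

Definition successive k E : Prop :=
  (forall i j m n, (i < j < k)%N -> E i m -> E j n -> (m < n)%N) /\
  (forall i n, (i < k)%N -> E i n -> (k <= n.+1)%N).

Inductive norming : (nat -> R) -> Prop :=
| norming_unit n : norming (fun m => (m == n)%:R)
| norming_node k E (psi : nat -> nat -> R) : successive k E ->
    (forall i, norming (psi i)) ->
    norming (fun n => 2^-1 * \sum_(i < k) (E i n)%:R * psi i n).

Lemma successive_pick {k E} n (a : nat -> R) : successive k E ->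
  (exists2 i, (i < k)%N && E i n & \sum_(i < k) (E i n)%:R * a i = a i) \/
  (forall i, (i < k)%N -> ~~ E i n) /\ \sum_(i < k) (E i n)%:R * a i = 0.
Proof.
move=> [hE _]; case: (pselect (exists i, (i < k)%N && E i n)) => [[i ikn]|no].
  left; exists i => //; move/andP: ikn => [ik ein].
  rewrite (bigD1 (Ordinal ik)) //= ein mul1r big1 ?addr0// => j /eqP ji.
  case ejn: (E j n); last by rewrite mul0r.
  have: (i != j) by apply/eqP => ij; apply: ji; apply/val_inj.
  rewrite neq_ltn => /orP[ij|ij].
    by have := hE i j n n; rewrite ij ltn_ord ltnn => /(_ isT ein ejn).
  by have := hE j i n n; rewrite ij ik ltnn => /(_ isT ejn ein).
right.
have no' i : (i < k)%N -> ~~ E i n.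
  by move=> ik; apply/negP => ein; apply: no; exists i; rewrite ik.
by split=> //; rewrite big1// => i _; rewrite (negbTE (no' _ (ltn_ord i))) mul0r.
Qed.

Lemma norming_bounds {phi} : norming phi -> forall n, 0 <= phi n <= 1.
Proof.
elim=> [m n|k E psi hE _ IH n].
  by case: eqP; rewrite ?lexx ?ler01.
case: (successive_pick n (fun i => psi i n) hE) => [[i _ ->]|[_ ->]].
  by have := IH i n; lra.
by lra.
Qed.

Lemma norming_ge0 {phi} : norming phi -> forall n, 0 <= phi n.
Proof. by move=> /norming_bounds h n; case/andP: (h n). Qed.

Lemma norming_le1 {phi} : norming phi -> forall n, phi n <= 1.
Proof. by move=> /norming_bounds h n; case/andP: (h n). Qed.

Lemma norming0 : norming (fun=> 0).
Proof.
rewrite (_ : (fun=> 0) = fun n => 2^-1 * \sum_(i < 0)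
    (xpred0 n)%:R * (fun m => (m == 0%N)%:R) n); last first.
  by apply/funext => n; rewrite big_ord0 mulr0.
apply: (@norming_node 0 (fun=> xpred0) (fun=> fun m => (m == 0%N)%:R)).
  by split=> // i j m n; rewrite ltn0 andbF.
by move=> _; exact: norming_unit.
Qed.

Lemma norming_half (s : seq nat) : sorted ltn s ->
  (forall n, n \in s -> (size s <= n.+1)%N) ->
  norming (fun n => 2^-1 * (n \in s)%:R).
Proof.
move=> ss hs.
rewrite (_ : (fun _ => _) = fun n => 2^-1 * \sum_(i < size s)
    ((pred1 (nth 0%N s i)) n)%:R * (fun m => (m == nth 0%N s i)%:R) n); last first.
  apply/funext => n; congr (_ * _); case: (boolP (n \in s)) => /= ns.
    rewrite (bigD1 (Ordinal (etrans (index_mem _ _) ns)))//= nth_index// eqxx mul1r.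
    rewrite big1 ?addr0// => i /eqP ni; case: eqP => [e|]; last by rewrite mul0r.
    case: ni; apply/val_inj => /=; rewrite e index_uniq//.
    exact: sorted_uniq ltn_trans ltnn _ ss.
  rewrite big1// => i _; case: eqP => [e|]; last by rewrite mul0r.
  by move: ns; rewrite e mem_nth.
apply: (@norming_node (size s) (fun i => pred1 (nth 0%N s i))
  (fun i m => (m == nth 0%N s i)%:R)); last by move=> i; exact: norming_unit.
split=> [i j m n /andP[ij jk] /eqP-> /eqP->|i n ik /eqP->].
  by apply: (sorted_ltn_nth ltn_trans) => //; rewrite inE// (ltn_trans ij).
by apply: hs; rewrite mem_nth.
Qed.

(** * Dyadic blocks *)

Definition base k : nat := (2 ^ k).-1.
Definition blk n : nat := trunc_log 2 n.+1.

#[local] Arguments base : simpl never.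
#[local] Arguments blk : simpl never.

Lemma expn2_gt0 k : (0 < 2 ^ k)%N. Proof. by rewrite expn_gt0. Qed.

Lemma baseS k : base k.+1 = (base k + 2 ^ k)%N.
Proof. by rewrite /base expnS; have := expn2_gt0 k; lia. Qed.

Lemma blk_eq k n : (blk n == k) = (base k <= n < base k.+1)%N.
Proof.
have h := trunc_log_bounds (isT : (1 < 2)%N) (ltn0Sn n).
apply/eqP/idP => [<-|]; rewrite /base.
  by move: h; rewrite /blk; lia.
move=> h'; apply: trunc_log_eq => //.
by have := expn2_gt0 k; have := expn2_gt0 k.+1; lia.
Qed.

Lemma blk_base k j : (j < 2 ^ k)%N -> blk (base k + j) = k.
Proof. by move=> jk; apply/eqP; rewrite blk_eq baseS; lia. Qed.

Lemma blk_bounds n : (base (blk n) <= n < base (blk n) + 2 ^ blk n)%N.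
Proof. by rewrite -baseS -blk_eq. Qed.

Lemma leq_blk m n : (m <= n)%N -> (blk m <= blk n)%N.
Proof. by move=> mn; apply: leq_trunc_log. Qed.

Lemma leq_base k : (k <= base k)%N.
Proof. by rewrite /base -ltnS prednK ?expn2_gt0// ltn_expl. Qed.

Lemma sum_blocks (g : nat -> R) K :
  \sum_(n < base K) g n = \sum_(k < K) \sum_(j < 2 ^ k) g (base k + j)%N.
Proof.
elim: K => [|K IH]; first by rewrite [RHS]big_ord0 /base expn0 /= big_ord0.
by rewrite big_ord_recr /= -IH baseS big_split_ord.
Qed.

(** Numbered from 1, block k consists of the 2 ^ k integers from 2 ^ k on, so its singletons are
    just admissible: on a block the norm is at least half the l_1 norm. *)
Lemma norming_half_block k : norming (fun n => 2^-1 * (blk n == k)%:R).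
Proof.
rewrite (_ : (fun _ => _) = fun n => 2^-1 * (n \in iota (base k) (2 ^ k))%:R).
  apply: norming_half; first exact: iota_ltn_sorted.
  by move=> n; rewrite mem_iota size_iota /base; have := expn2_gt0 k; lia.
by apply/funext => n; rewrite mem_iota blk_eq baseS.
Qed.

(* Each leaf of a norming tree is spread over its dyadic block.  The number of
   branches m of a node is smaller than 2 ^ f.+1 if f is its first block.  Since
   the next block of Q has number at least f.+2, twice as many branches are
   admissible there: for each branch, its first block and its remainder. *)
Lemma norming_spread phi : norming phi ->
  forall r : nat -> nat, (forall k, blk (r k) = k) ->
  forall Q : pred nat, (forall k l, Q k -> Q l -> (k < l)%N -> (k.+1 < l)%N) ->
  exists f psi, [/\ norming psi,
    forall k, Q k -> (k < f)%N -> phi (r k) = 0 &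
    forall n, Q (blk n) -> (f < blk n)%N -> phi (r (blk n)) <= 2 * psi n].
Proof.
elim=> [m|k E psi hE hpsi IH] r hr Q sQ.
  exists (blk m), (fun=> 0); split; first exact: norming0.
    by move=> k _ km; case: eqP => // e; move: km; rewrite -e hr ltnn.
  move=> n _ mn; case: eqP => [e|_]; last by rewrite mulr0.
  by move: mn; rewrite -e hr ltnn.
pose Qi i : pred nat := [pred l | Q l && E i (r l)].
have sQi i a b : Qi i a -> Qi i b -> (a < b)%N -> (a.+1 < b)%N.
  by move=> /andP[qa _] /andP[qb _]; exact: sQ.
have /choice[fp hfp] : forall i, exists fp : nat * (nat -> R), [/\ norming fp.2,
    forall l, Qi i l -> (l < fp.1)%N -> psi i (r l) = 0 &
    forall n, Qi i (blk n) -> (fp.1 < blk n)%N -> psi i (r (blk n)) <= 2 * fp.2 n].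
  by move=> i; case: (IH i r hr _ (sQi i)) => f [p h]; exists (f, p).
case: (pselect (exists l, Q l && [exists i : 'I_k, E i (r l)])) => [ex|no]; last first.
  exists 0%N, (fun=> 0); split => [|//|n qn _]; first exact: norming0.
  case: (successive_pick (r (blk n)) (fun i => psi i (r (blk n))) hE) => [[i /andP[ik ei] _]|[_ ->]].
    case: no; exists (blk n); rewrite qn; apply/existsP; exists (Ordinal ik).
    exact: ei.
  by rewrite !mulr0.
(* The exceptional block of the new functional is the first block of [Q] met by a branch; a number
   in it bounds k. *)
case: (ex_minnP ex) => f /andP[qf /existsP[i0 ef]] fmin {ex}.
have kf : (k < 2 ^ f.+1)%N.
  have k1 := (hE.2 _ _ (ltn_ord i0) ef).
  have := blk_bounds (r f); rewrite hr -baseS {2}/base; have := expn2_gt0 f.+1.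
  have : (2 ^ f.+1 = 2 * 2 ^ f)%N by rewrite expnS.
  by have := expn2_gt0 f; lia.
(* The even index 2i carries the exceptional block of branch i, about which the induction hypothesis
   says nothing, and the odd index 2i + 1 its later blocks. On the exceptional block half the
   indicator suffices, as [psi i] is at most 1. *)
pose E' j : pred nat := [pred n | [&& Qi j./2 (blk n), (f < blk n)%N &
   if odd j then ((fp j./2).1 < blk n)%N else (blk n == (fp j./2).1)]].
pose psi' j : nat -> R := if odd j then (fp j./2).2 else
  fun n => 2^-1 * (blk n == (fp j./2).1)%:R.
have hpsi' j : norming (psi' j).
  rewrite /psi'; case: (odd j); last exact: norming_half_block.
  by case: (hfp j./2).
have hE' : successive k.*2 E'.
  split=> [i j m n /andP[ij jk]|i n ik] /=.
    move=> /and3P[/andP[qm em] _ hm] /and3P[/andP[qn en] _ hn].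
    have : (i./2 <= j./2)%N by apply: half_leq; lia.
    rewrite leq_eqVlt => /orP[/eqP e|lt].
      move: hm hn; have -> : odd i = false by lia.
      have -> : odd j by lia.
      rewrite e => /eqP <-.
      by rewrite ltnNge => /negP h; rewrite ltnNge; apply/negP => /leq_blk.
    have rr : (r (blk m) < r (blk n))%N.
      apply: hE.1 em en; apply/andP; split=> //; lia.
    rewrite ltnNge; apply/negP => /leq_blk nm.
    have := leq_blk _ _ (ltnW rr); rewrite !hr => mn.
    by move: rr; rewrite (_ : blk m = blk n) ?ltnn//; apply/eqP; rewrite eqn_leq mn nm.
  move=> /and3P[/andP[qn _] fn _].
  have := sQ _ _ qf qn fn => f2n.
  have := blk_bounds n; rewrite /base => /andP[h _].
  have : (2 ^ f.+2 <= 2 ^ blk n)%N by rewrite leq_exp2l.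
  have : (2 ^ f.+2 = 2 * 2 ^ f.+1)%N by rewrite expnS.
  by have := expn2_gt0 (blk n); lia.
exists f, (fun n => 2^-1 * \sum_(j < k.*2) (E' j n)%:R * psi' j n); split.
- exact: norming_node.
- move=> l ql lf.
  case: (successive_pick (r l) (fun i => psi i (r l)) hE) => [[i /andP[ik ei] _]|[_ ->]].
    have /fmin : Q l && [exists i : 'I_k, E i (r l)].
      by rewrite ql; apply/existsP; exists (Ordinal ik).
    by rewrite leqNgt lf.
  by rewrite mulr0.
- move=> n qn fn; rewrite mulrA divff// mul1r.
  have ge j : (j < k.*2)%N -> E' j n ->
      psi' j n <= \sum_(j < k.*2) (E' j n)%:R * psi' j n.
    move=> jk ej; rewrite (bigD1 (Ordinal jk))//= ej mul1r lerDl sumr_ge0// => i _.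
    by rewrite mulr_ge0// norming_ge0.
  case: (successive_pick (r (blk n)) (fun i => psi i (r (blk n))) hE)
     => [[i /andP[ik ei] ->]|[_ ->]]; last first.
    rewrite mulr0 sumr_ge0// => j _; by rewrite mulr_ge0// norming_ge0.
  have qi : Qi i (blk n) by apply/andP.
  case: (hfp i) => np hlt hgt.
  have [lt|gt|eq] := ltngtP (blk n) (fp i).1.
  + rewrite hlt// mulr0 sumr_ge0// => j _; by rewrite mulr_ge0// norming_ge0.
  + have e1 : E' i.*2.+1 n.
      have [h2 ho] : i.*2.+1./2 = i /\ odd i.*2.+1 by split; lia.
      by apply/and3P; rewrite h2 ho; split.
    have jk : (i.*2.+1 < k.*2)%N by lia.
    apply: le_trans (ge _ jk e1).
    rewrite /psi' /= odd_double uphalf_double /=.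
    have := hgt _ qi gt; lra.
  + have e1 : E' i.*2 n.
      by apply/and3P; rewrite doubleK odd_double; split=> //; rewrite eq.
    have jk : (i.*2 < k.*2)%N by lia.
    apply: le_trans (ge _ jk e1).
    rewrite /psi' /= odd_double doubleK eq eqxx /=.
    have := norming_le1 (hpsi i) (r (blk n)); rewrite eq; lra.
Qed.

(** * Domination of block masses *)

Definition norm_le w (c : R) : Prop :=
  forall phi, norming phi -> forall B, \sum_(n < B) phi n * w n <= c.

Definition block_sum w k : R := \sum_(j < 2 ^ k) w (base k + j)%N.

Lemma block_sum_le w c : (forall n, 0 <= w n) -> norm_le w c ->
  forall k, block_sum w k <= 2 * c.
Proof.
move=> w0 wc k; have := wc _ (norming_half_block k) (base k.+1).
rewrite (sum_blocks (fun n => 2^-1 * (blk n == k)%:R * w n)) big_ord_recr /= => h.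
suff : 2^-1 * block_sum w k <= c by lra.
apply: le_trans h; rewrite -[leLHS]add0r lerD//.
  by apply: sumr_ge0 => i _; apply: sumr_ge0 => j _; rewrite !mulr_ge0.
rewrite mulr_sumr; apply: ler_sum => j _.
by rewrite blk_base// eqxx mulr1.
Qed.

(** On each block phi is at most its maximum, taken at [r k], and [norming_spread] spreads this
    value over the block. Since it needs gaps between blocks, even and odd blocks are treated apart;
    each class costs 2c for the exceptional block and 2c for the others, whence 8. *)
Lemma norm_le_lattice w v c : (forall n, 0 <= w n) -> (forall n, 0 <= v n) ->
  (forall k, block_sum v k <= block_sum w k) -> norm_le w c -> norm_le v (8 * c).
Proof.
move=> w0 v0 vw wc phi nphi B.
have phi0 := norming_ge0 nphi.
have /choice[r hr] : forall k, exists m, blk m = k /\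
    forall n, blk n = k -> phi n <= phi m.
  move=> k; pose i0 : 'I_(2 ^ k) := Ordinal (expn2_gt0 k).
  case: (arg_maxP (fun i : 'I_(2 ^ k) => phi (base k + i)%N) (isT : xpredT i0)) => i _ hi.
  exists (base k + i)%N; split; first exact: blk_base.
  move=> n bn; have := blk_bounds n; rewrite bn => /andP[h1 h2].
  have h : (n - base k < 2 ^ k)%N by lia.
  by have := hi (Ordinal h) isT; rewrite /= subnKC.
have bw0 k : 0 <= block_sum w k by apply: sumr_ge0.
have key (Q : pred nat) : (forall k l, Q k -> Q l -> (k < l)%N -> (k.+1 < l)%N) ->
    \sum_(k < B | Q k) phi (r k) * block_sum w k <= 4 * c.
  move=> sQ; have hr1 k := (hr k).1.
  case: (norming_spread _ nphi r hr1 Q sQ) => f [psi [npsi h1 h2]].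
  have psi0 := norming_ge0 npsi.
  apply: (@le_trans _ _ (\sum_(k < B) ((k == f :> nat)%:R * block_sum w f +
      2 * \sum_(j < 2 ^ k) psi (base k + j)%N * w (base k + j)%N))).
    rewrite big_mkcond; apply: ler_sum => k _.
    have s0 : 0 <= \sum_(j < 2 ^ k) psi (base k + j)%N * w (base k + j)%N.
      by apply: sumr_ge0 => j _; rewrite mulr_ge0.
    case: ifP => qk; last by rewrite addr_ge0// mulr_ge0.
    have [kf|fk|->] := ltngtP (k : nat) f.
    - by rewrite h1// mul0r mul0r add0r mulr_ge0.
    - rewrite mul0r add0r /block_sum !mulr_sumr; apply: ler_sum => j _.
      by rewrite mulrA ler_wpM2r//; have := h2 (base k + j)%N; rewrite blk_base//; apply.
    - rewrite mul1r; apply: (@le_trans _ _ (block_sum w f)).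
        by rewrite ler_piMl// norming_le1.
      by rewrite lerDl mulr_ge0// sumr_ge0// => j _; rewrite mulr_ge0.
  rewrite big_split /= -mulr_sumr -(sum_blocks (fun n => psi n * w n)).
  have := wc _ npsi (base B).
  suff : \sum_(k < B) (k == f :> nat)%:R * block_sum w f <= block_sum w f.
    by have := block_sum_le _ _ w0 wc f; lra.
  have [fB|Bf] := ltnP f B.
    rewrite (bigD1 (Ordinal fB))//= eqxx mul1r big1 ?addr0// => i /eqP ni.
    by case: eqP => [e|_]; rewrite ?mul0r//; case: ni; apply/val_inj.
  rewrite big1// => i _; case: eqP => [e|_]; last by rewrite mul0r.
  by have := ltn_ord i; lia.
have ke := key (fun k => ~~ odd k); have ko := key odd.
apply: (@le_trans _ _ (\sum_(n < base B) phi n * v n)).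
  rewrite -(subnKC (leq_base B)) big_split_ord /= lerDl sumr_ge0// => i _.
  by rewrite mulr_ge0.
rewrite (sum_blocks (fun n => phi n * v n)).
apply: (@le_trans _ _ (\sum_(k < B) phi (r k) * block_sum w k)).
  apply: ler_sum => k _; apply: (@le_trans _ _ (phi (r k) * block_sum v k)).
    rewrite mulr_sumr; apply: ler_sum => j _; rewrite ler_wpM2r//.
    by apply: (hr k).2; rewrite blk_base.
  by rewrite ler_wpM2l.
rewrite (bigID (fun k : 'I_B => odd k)) /=.
suff [] : \sum_(k < B | odd k) phi (r k) * block_sum w k <= 4 * c /\
  \sum_(k < B | ~~ odd k) phi (r k) * block_sum w k <= 4 * c by lra.
by split; [apply: ko|apply: ke] => k l; lia.
Qed.

End Norming.

(** * The norm given by the norming functionals *)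

Section TsirelsonNorm.
Variable R : realType.
Implicit Types (phi psi w v : nat -> R) (c d a : R) (E : nat -> pred nat) (k n : nat).

(** Without an upper bound this supremum carries no information, hence the recurring hypothesis
    [norm_le R w c]. *)
Definition tnorm (w : nat -> R) : R :=
  sup [set r | exists phi B, norming R phi /\ r = \sum_(n < B) phi n * w n].

Lemma tnorm_ub {w c} : norm_le R w c -> norm_le R w (tnorm w).
Proof.
move=> wc phi nphi B; apply: ub_le_sup; last by exists phi, B.
by exists c => _ [psi [C [npsi ->]]]; exact: wc.
Qed.

Lemma tnorm_le {w c} : norm_le R w c -> tnorm w <= c.
Proof.
move=> wc; apply: ge_sup; last by move=> _ [psi [C [npsi ->]]]; exact: wc.
by exists 0, (fun=> 0), 0%N; split; [exact: norming0|rewrite big_ord0].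
Qed.

Lemma norm_le_ge0 {w c} : norm_le R w c -> 0 <= c.
Proof. by move=> /(_ _ (norming0 R) 0%N); rewrite big_ord0. Qed.

Lemma tnorm_ge0 w c : norm_le R w c -> 0 <= tnorm w.
Proof. by move=> /tnorm_ub /norm_le_ge0. Qed.

Lemma norm_le_coord {w c} : (forall n, 0 <= w n) -> norm_le R w c ->
  forall n, w n <= c.
Proof.
move=> w0 wc n; have := wc _ (norming_unit R n) n.+1.
rewrite big_ord_recr /= eqxx mul1r; apply: le_trans; rewrite lerDr sumr_ge0//.
by move=> i _; rewrite mulr_ge0.
Qed.

Lemma norm_le_mono w v c : (forall n, w n <= v n) -> norm_le R v c ->
  norm_le R w c.
Proof.
move=> wv vc phi nphi B; apply: le_trans (vc _ nphi B).
by apply: ler_sum => i _; rewrite ler_wpM2l// (norming_ge0 R).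
Qed.

Lemma tnorm_mono w v c : (forall n, w n <= v n) -> norm_le R v c ->
  tnorm w <= tnorm v.
Proof. by move=> wv /tnorm_ub h; apply: tnorm_le; exact: norm_le_mono wv h. Qed.

Lemma norm_leD w v c d : norm_le R w c -> norm_le R v d ->
  norm_le R (fun n => w n + v n) (c + d).
Proof.
move=> wc vd phi nphi B; under eq_bigr do rewrite mulrDr.
by rewrite big_split lerD// ?wc// vd.
Qed.

Lemma norm_leZ w c a : 0 <= a -> norm_le R w c -> norm_le R (fun n => a * w n) (a * c).
Proof.
move=> a0 wc phi nphi B; under eq_bigr do rewrite mulrCA.
by rewrite -mulr_sumr ler_wpM2l// wc.
Qed.

Lemma norm_le_sum w c : (forall n, 0 <= w n) ->
  (forall B, \sum_(n < B) w n <= c) -> norm_le R w c.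
Proof.
move=> w0 wc phi nphi B; apply: le_trans (wc B); apply: ler_sum => i _.
by rewrite ler_piMl// (norming_le1 R).
Qed.

(** Functionals that are optimal up to [d] on the pieces are the branches of one node, and the
    factor 2 undoes its 1/2. *)
Lemma tnorm_successive w c k E : (forall n, 0 <= w n) -> norm_le R w c ->
  successive k E -> \sum_(i < k) tnorm (fun n => (E i n)%:R * w n) <= 2 * c.
Proof.
move=> w0 wc hE; set v := fun i n => (E i n)%:R * w n.
have vb i : norm_le R (v i) c.
  by apply: norm_le_mono wc => n; rewrite /v ler_piMl// lern1 leq_b1.
apply/ler_addgt0Pr => e e0; pose d := e / k.+1%:R.
have d0 : 0 < d by rewrite divr_gt0.
have /choice[h hh] : forall i, exists h : (nat -> R) * nat, norming R h.1 /\
    tnorm (v i) - d < \sum_(n < h.2) h.1 n * v i n.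
  move=> i; have : has_sup [set r | exists phi B, norming R phi /\
      r = \sum_(n < B) phi n * v i n].
    split; first by exists 0, (fun=> 0), 0%N; split; [exact: norming0|rewrite big_ord0].
    by exists c => _ [psi [C [npsi ->]]]; exact: vb.
  move=> /(sup_adherent d0)[_ [phi [B [nphi ->]]] lt].
  by exists (phi, B).
pose B := \max_(i < k) (h i).2.
have := wc _ (norming_node R k E (fun i => (h i).1) hE (fun i => (hh i).1)) B.
under eq_bigr do rewrite -mulrA mulr_suml.
rewrite -mulr_sumr exchange_big /= => le.
have : \sum_(i < k) (tnorm (v i) - d) <=
    \sum_(i < k) \sum_(n < B) (E i n)%:R * (h i).1 n * w n.
  apply: ler_sum => i _; apply: (le_trans (ltW (hh i).2)).
  have hB : ((h i).2 <= B)%N by apply: (leq_bigmax i).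
  rewrite -(subnKC hB) big_split_ord /= -[leLHS]addr0 lerD//.
    by apply: ler_sum => n _; rewrite /v mulrA [X in X * _ <= _]mulrC.
  by apply: sumr_ge0 => n _; rewrite !mulr_ge0// (norming_ge0 R (hh i).1).
rewrite big_split /= sumr_const card_ord -[X in _ + X]mulr_natr mulNr.
have : d * k%:R <= e.
  by rewrite /d mulrAC ler_pdivrMr// ler_pM2l// ler_nat.
by move: le; lra.
Qed.

End TsirelsonNorm.

(** * Real and complex scalars *)

Record valued {R : realType} (F : scalarField R) : Prop := Valued {
  modulus_ge0 : forall x : F, 0 <= modulus x;
  modulus0_eq0 : forall x : F, modulus x = 0 -> x = 0;
  modulus_nat : forall n : nat, modulus (n%:R : F) = n%:R;
  modulusM : forall x y : F, modulus (x * y) = modulus x * modulus y;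
  modulusD : forall x y : F, modulus (x + y) <= modulus x + modulus y;
  modulus_of_real : forall r : R, 0 <= r -> modulus (of_real F r) = r }.

Arguments modulus_ge0 {R F} _.
Arguments modulus0_eq0 {R F} _.
Arguments modulus_nat {R F} _.
Arguments modulusM {R F} _.
Arguments modulusD {R F} _.
Arguments modulus_of_real {R F} _.

Lemma valued_real (R : realType) : valued (real_scalars R).
Proof.
split => /= [x|x /normr0_eq0//|n|x y|x y|r r0]; first exact: normr_ge0.
- by rewrite normr_nat.
- exact: normrM.
- exact: ler_normD.
- by rewrite ger0_norm.
Qed.

Lemma valued_complex (R : realType) : valued (complex_scalars R).
Proof.
split => /= [x|x|n|x y|x y|r r0].
- by case: x => a b /=; exact: sqrtr_ge0.
- exact: (@Normc.eq0_normc R).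
- by rewrite (@normcMn R) Normc.normc1.
- exact: (@Normc.normcM R).
- exact: (@le_normcD R x y).
- by rewrite /= expr0n /= addr0 sqrtr_sqr ger0_norm.
Qed.

(** * Identification of the Tsirelson norm *)

Section TsirelsonIdentification.
Variables (R : realType) (F : scalarField R).
Hypothesis hF : valued F.
Implicit Types (x y : sequences F) (N : sequences F -> R) (A : set nat).

Definition absseq x : nat -> R := fun n => modulus (x n).
Definition unit_vec (m : nat) : sequences F := fun n => (n == m)%:R.

Lemma seqDE x y n : (x + y) n = (x n : F) + (y n : F). Proof. by []. Qed.
Lemma seqNE x n : (- x) n = - (x n : F). Proof. by []. Qed.
Lemma seqZE (a : F) x n : (a *: x) n = a * (x n : F). Proof. by []. Qed.
Lemma seq0E n : (0 : sequences F) n = (0 : F). Proof. by []. Qed.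

Lemma absseq_ge0 x n : 0 <= absseq x n. Proof. exact: modulus_ge0. Qed.

Lemma modulus0 : modulus (0 : F) = 0.
Proof. exact: (modulus_nat hF 0). Qed.

Lemma modulus1 : modulus (1 : F) = 1.
Proof. exact: (modulus_nat hF 1). Qed.

Lemma modulusN (a : F) : modulus (- a) = modulus a.
Proof.
have m1 : modulus (-1 : F) = 1.
  have : modulus (-1 : F) * modulus (-1 : F) = 1.
    by rewrite -(modulusM hF) mulrNN mulr1 modulus1.
  by have := modulus_ge0 hF (-1); nra.
by rewrite -mulN1r (modulusM hF) m1 mul1r.
Qed.

Lemma c00P x : c00 x <-> exists B, forall n, (B <= n)%N -> x n = 0.
Proof.
split=> [|[B hB]].
  move=> /finite_fsetP[S hS]; exists (\max_(i <- S) i.+1)%N => n hn.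
  apply/eqP; apply: contraTT hn => xn; rewrite -ltnNge.
  have : n \in S by have : [set` S] n by rewrite -hS.
  by move=> nS; rewrite (big_rem _ nS)/= leq_maxl.
apply: (@sub_finite_set _ _ `I_B); last exact: finite_II.
by move=> n /= /eqP xn; rewrite ltnNge; apply/negP => /hB.
Qed.

Lemma restr_c00 A x : c00 x -> c00 (restr A x).
Proof.
by move=> /c00P[B hB]; apply/c00P; exists B => n /hB; rewrite /restr => ->; case: ifP.
Qed.

Lemma restr_pred (P : pred nat) x n :
  restr [set n | P n] x n = if P n then x n else 0.
Proof. by rewrite /restr; congr (if _ then _ else _); apply/idP/idP; rewrite inE. Qed.

Lemma absseq_restr (P : pred nat) x n :
  absseq (restr [set n | P n] x) n = (P n)%:R * absseq x n.
Proof. by rewrite /absseq restr_pred; case: (P n); rewrite ?mul1r// mul0r modulus0. Qed.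

Lemma c00_norm_le x : c00 x -> exists c, norm_le R (absseq x) c.
Proof.
move=> /c00P[B hB]; exists (\sum_(n < B) absseq x n); apply: norm_le_sum.
  exact: absseq_ge0.
move=> B'; have [le|lt] := leqP B' B.
  rewrite -(subnKC le) big_split_ord /= lerDl sumr_ge0// => i _; exact: absseq_ge0.
rewrite -(subnKC (ltnW lt)) big_split_ord /= gerDl big1// => i _.
by rewrite /absseq hB ?modulus0// leq_addr.
Qed.

Section Generic.
Variables (N : sequences F -> R).
Hypothesis hN : norm_on_c00 N.

Lemma c000 : c00 (0 : sequences F).
Proof. by apply/c00P; exists 0%N. Qed.

Lemma gnorm0 : N 0 = 0.
Proof.
case: hN => _ h _; have := h 0 0 c000.
by rewrite scale0r modulus0 mul0r.
Qed.

Lemma gnorm_ge0 x : c00 x -> 0 <= N x.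
Proof.
case: hN => _ hZ hD cx.
have cNx : c00 (- x).
  by move/c00P: cx => [B hB]; apply/c00P; exists B => n /hB h; rewrite seqNE h; exact: (@oppr0 F).
have := hD _ _ cx cNx; rewrite subrr gnorm0 -[X in N x + N X]scaleN1r hZ//.
by rewrite modulusN modulus1; lra.
Qed.

Lemma c00_unit m : c00 (unit_vec m).
Proof.
apply/c00P; exists m.+1 => n nm; rewrite /unit_vec; case: eqP => // e.
by move: nm; rewrite e ltnn.
Qed.

(** A weighted l_1 bound valid for any norm on c_00. It makes the suprema in the implicit equation
    finite before the norm is identified. *)
Lemma gnorm_restr_le A x B : (forall n, (B <= n)%N -> x n = 0) ->
  N (restr A x) <= \sum_(n < B) ((n : nat) \in A)%:R * (absseq x n * N (unit_vec n)).
Proof.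
case: hN => _ hZ hD; elim: B x => [|B IH] x hB.
  rewrite big_ord0 (_ : restr A x = 0) ?gnorm0//.
  by apply/funext => n; rewrite /restr hB//; case: ifP.
pose y : sequences F := fun n => if (n < B)%N then x n else 0.
have yB n : (B <= n)%N -> y n = 0 by rewrite /y ltnNge => ->.
have -> : restr A x = restr A y + (if B \in A then x B else 0) *: unit_vec B.
  apply/funext => n; rewrite seqDE seqZE /restr /y /unit_vec.
  have [nB|nB|->] := ltngtP n B.
  - by rewrite mulr0 addr0.
  - by rewrite mulr0 addr0 hB// if_same.
  - by rewrite if_same add0r mulr1.
have cy : c00 (restr A y) by apply: restr_c00; apply/c00P; exists B.
have cz (a : F) : c00 (a *: unit_vec B).
  apply/c00P; exists B.+1 => n nB; rewrite seqZE /unit_vec.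
  by case: eqP nB => [->|_]; rewrite ?ltnn ?mulr0.
apply: (le_trans (hD _ _ cy (cz _))); rewrite big_ord_recr /= lerD//.
  apply: (le_trans (IH y yB)); apply: ler_sum => i _.
  by rewrite /absseq /y ltn_ord.
rewrite hZ; last exact: c00_unit.
by case: (B \in A); rewrite ?mul1r// modulus0 !mul0r.
Qed.

(** The order of consecutive sets propagates because the sets in between are nonempty, and the bound
    on the minimum of the first set then passes to all later ones. *)
Lemma admissible_successive k E : admissible k E -> successive k (fun i n => n \in E i).
Proof.
move=> [k0 fE sE mE].
have lt i d m n : (i + d.+1 < k)%N -> E i m -> E (i + d.+1)%N n -> (m < n)%N.
  elim: d n => [|d IH] n ik em; first by rewrite addn1; apply: sE em; rewrite addn1 in ik.
  rewrite addnS => en; have [|_ [l el]] := fE (i + d.+1)%N; first by lia.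
  apply: (@ltn_trans l); first by apply: IH el => //; lia.
  by apply: sE el en; lia.
split=> [i j m n /andP[ij jk]|i n ik]; rewrite !inE.
  by move=> em en; apply: (lt i (j - i.+1)%N) em _; rewrite addnS -addSn subnKC//.
case: i ik => [|i] ik en; first exact: mE.
have [|_ [l el]] := fE 0%N; first by lia.
by have := mE _ el; have := lt 0%N i l n ik el en; lia.
Qed.

Lemma admissible_sums_ub x : c00 x -> has_ubound (admissible_sums N x).
Proof.
move=> /c00P[B hB]; exists (\sum_(n < B) absseq x n * N (unit_vec n)).
move=> _ [k [E [/admissible_successive hE ->]]].
apply: le_trans; first by apply: ler_sum => i _; exact: (gnorm_restr_le (E i) x B hB).
rewrite exchange_big /=; apply: ler_sum => n _.
have p0 : 0 <= absseq x n * N (unit_vec n).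
  by rewrite mulr_ge0 ?absseq_ge0// gnorm_ge0//; exact: c00_unit.
by case: (successive_pick R n (fun=> absseq x n * N (unit_vec n)) hE) => [[i _ ->]|[_ ->]].
Qed.

Lemma admissible_sums_sup_ge0 x : c00 x -> 0 <= sup (admissible_sums N x).
Proof.
move=> cx; apply: (@le_trans _ _ (\sum_(i < 1) N (restr [set 0%N] x))).
  by rewrite big_ord1 gnorm_ge0//; exact: restr_c00.
apply: ub_le_sup; first exact: admissible_sums_ub.
exists 1%N, (fun=> [set 0%N]); split=> //; split=> //.
by move=> i _; split; [exact: finite_set1|exists 0%N].
Qed.

(** The sets that miss [0, B), where x lives, are dropped and the others are cut to it. They become
    finite and nonempty, and lowering their number preserves the bound on the minima. *)
Lemma successive_sum_le k (E : nat -> pred nat) x : successive k E -> c00 x ->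
  \sum_(i < k) N (restr [set n | E i n] x) <= sup (admissible_sums N x).
Proof.
move=> hE cx; have [B hB] := (c00P x).1 cx.
pose s := [seq i <- iota 0 k | has (E i) (iota 0 B)].
have -> : \sum_(i < k) N (restr [set n | E i n] x) =
    \sum_(j < size s) N (restr [set n | E (nth 0%N s j) n && (n < B)%N] x).
  pose f i := N (restr [set n | E i n] x).
  transitivity (\sum_(i <- s) f i).
    rewrite /s big_filter -(big_mkord xpredT f) /index_iota subn0.
    rewrite (bigID (fun i => has (E i) (iota 0 B)))/= [X in _ + X]big1 ?addr0//.
    move=> i ni; rewrite /f (_ : restr _ _ = 0) ?gnorm0//.
    apply/funext => n; rewrite /restr; case: ifP => //; rewrite inE /= => ein.
    apply: hB; rewrite leqNgt; apply: contra ni => nB.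
    by apply/hasP; exists n; rewrite ?mem_iota.
  rewrite (big_nth 0%N) big_mkord; apply: eq_bigr => j _; congr N.
  apply/funext => n; rewrite !restr_pred; have [nB|Bn] := ltnP n B.
    by rewrite andbT.
  by rewrite andbF hB// if_same.
case s0 : (size s) => [|l].
  by rewrite big_ord0; exact: admissible_sums_sup_ge0.
rewrite -s0; apply: ub_le_sup; first exact: admissible_sums_ub.
exists (size s), (fun j => [set n | E (nth 0%N s j) n && (n < B)%N]); split=> //.
have ms j : (j < size s)%N -> nth 0%N s j \in s by move=> js; apply: mem_nth.
have ik j : (j < size s)%N -> (nth 0%N s j < k)%N.
  by move=> /ms; rewrite mem_filter mem_iota => /andP[_].
split.
- by rewrite s0.
- move=> j js; split.
    apply: (@sub_finite_set _ _ `I_B); last exact: finite_II.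
    by move=> n /= /andP[].
  have := ms _ js; rewrite mem_filter => /andP[/hasP[n]]; rewrite mem_iota => /andP[_ nB] en _.
  by exists n; rewrite /= en.
- move=> j m n js /= /andP[em _] /andP[en _].
  apply: (hE.1 _ _ _ _ _ em en); rewrite ik// andbT.
  apply: (sorted_ltn_nth ltn_trans) => //.
    by apply: sorted_filter; [exact: ltn_trans|exact: iota_ltn_sorted].
  by rewrite inE; apply: ltnW.
- move=> n /= /andP[en _]; apply: leq_trans (hE.2 _ _ (ik _ _) en); last by rewrite s0.
  rewrite size_filter; apply: leq_trans (count_size _ _) _.
  by rewrite size_iota.
Qed.

End Generic.

Lemma supnorm_ub x : c00 x -> has_ubound (range (fun n => modulus (x n))).
Proof.
move=> /c00_norm_le[c hc]; exists c => _ [n _ <-].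
exact: (norm_le_coord R (absseq_ge0 x) hc).
Qed.

Lemma supnorm_ge x n : c00 x -> modulus (x n) <= supnorm x.
Proof. by move=> cx; apply: ub_le_sup; [exact: supnorm_ub|exists n]. Qed.

Lemma node_pairing k (E : nat -> pred nat) (psi : nat -> nat -> R) x B :
  \sum_(n < B) (2^-1 * \sum_(i < k) (E i n)%:R * psi i n) * absseq x n =
  2^-1 * \sum_(i < k) \sum_(n < B) psi i n * absseq (restr [set n | E i n] x) n.
Proof.
under eq_bigr do rewrite -mulrA mulr_suml.
rewrite -mulr_sumr exchange_big /=; congr (_ * _).
apply: eq_bigr => i _; apply: eq_bigr => n _.
by rewrite absseq_restr mulrCA mulrA.
Qed.

Lemma unit_pairing m B (w : nat -> R) : 0 <= w m -> \sum_(n < B) (n == m :> nat)%:R * w n <= w m.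
Proof.
move=> w0; have [mB|Bm] := ltnP m B.
  rewrite (bigD1 (Ordinal mB))//= eqxx mul1r big1 ?addr0// => i /eqP ni.
  by case: eqP => [e|_]; rewrite ?mul0r//; case: ni; apply/val_inj.
rewrite big1// => i _; case: eqP => [e|_]; rewrite ?mul0r//.
by have := ltn_ord i; lia.
Qed.

Lemma tsirelson_norm_lower N : is_tsirelson_norm N -> forall x, c00 x ->
  norm_le R (absseq x) (N x).
Proof.
move=> [hN eqN] x cx phi nphi B; elim: nphi x cx B => [m|k E psi hE _ IH] x cx B.
  apply: le_trans (unit_pairing _ _ _ (absseq_ge0 x m)) _.
  by rewrite eqN// le_max supnorm_ge.
rewrite node_pairing eqN// le_max; apply/orP; right; rewrite ler_wpM2l//.
apply: le_trans (successive_sum_le N hN k E x hE cx).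
by apply: ler_sum => i _; apply: IH; exact: restr_c00.
Qed.

(** Induction on the size of the support. In an admissible sum either every piece has smaller
    support, or one piece is all of x and the sum equals N x. The second case contributes only N x /
    2 to the implicit equation, which the left side absorbs. *)
Lemma tsirelson_norm_upper N : is_tsirelson_norm N -> forall x, c00 x ->
  N x <= tnorm R (absseq x).
Proof.
move=> [hN eqN] x cx; have [B hB] := (c00P x).1 cx.
have [m] := ubnP (count (fun n => x n != 0) (iota 0 B)).
elim: m x cx hB => // m IH x cx hB hm.
have [c hc] := c00_norm_le x cx.
have ub := tnorm_ub R hc.
have suff1 : N x <= Num.max (tnorm R (absseq x)) (2^-1 * N x).
  rewrite {1}eqN// ge_max; apply/andP; split.
    rewrite le_max; apply/orP; left; apply: ge_sup.
      by exists (modulus (x 0%N)), 0%N.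
    by move=> _ [n _ <-]; exact: (norm_le_coord R (absseq_ge0 x) ub).
  suff : sup (admissible_sums N x) <= Num.max (2 * tnorm R (absseq x)) (N x).
    rewrite !le_max => /orP[h|h]; apply/orP.
      by left; rewrite -ler_pdivlMl// invrK.
    by right; rewrite ler_wpM2l.
  apply: ge_sup.
    exists (\sum_(i < 1) N (restr [set 0%N] x)), 1%N, (fun=> [set 0%N]).
    split=> //; split=> //.
    by move=> i _; split; [exact: finite_set1|exists 0%N].
  move=> _ [k [E [/admissible_successive hE ->]]].
  have toset i : restr (E i) x = restr [set n | n \in E i] x.
    by apply/funext => n; rewrite restr_pred.
  case: (pselect (exists2 i, (i < k)%N & forall n, x n != 0 -> n \in E i)) => [[i ik hi]|no].
    rewrite le_max; apply/orP; right; rewrite (bigD1 (Ordinal ik))//= big1.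
      rewrite addr0 (_ : restr (E i) x = x)//; apply/funext => n; rewrite /restr.
      by case: ifP => // /negP nE; apply/esym/eqP; apply/negPn; apply/negP => /hi.
    move=> j /eqP ji; rewrite (_ : restr (E j) x = 0) ?gnorm0//.
    apply/funext => n; rewrite /restr; case: ifP => // nj.
    apply/eqP; apply/negPn; apply/negP => /hi ni.
    case: (successive_pick R n (fun l => (l != i)%:R) hE) => [[l /andP[lk nl]]|[/(_ i ik)]]; last by rewrite ni.
    rewrite (bigD1 (Ordinal ik))//= ni eqxx mulr0 add0r.
    have ji' : Ordinal (ltn_ord j) != Ordinal ik by apply/eqP => /(congr1 val) e; apply: ji; apply/val_inj.
    have : (i != j) by apply/eqP => e; apply: ji; apply/val_inj.
    rewrite neq_ltn => /orP[ij|ij].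
      have := hE.1 i j n n; rewrite ij ltn_ord ltnn => /(_ isT ni nj) //.
    by have := hE.1 j i n n; rewrite ij ik ltnn => /(_ isT nj ni).
  rewrite le_max; apply/orP; left.
  apply: le_trans (tnorm_successive R (absseq x) _ k _ (absseq_ge0 x) ub hE).
  apply: ler_sum => i _.
  have -> : (fun n => (n \in E i)%:R * absseq x n) = absseq (restr (E i) x).
    by apply/funext => n; rewrite toset absseq_restr.
  apply: IH; first exact: restr_c00.
    by move=> n /hB; rewrite /restr => ->; case: ifP.
  have [n [xn nE]] : exists n, x n != 0 /\ n \notin E i.
    apply: contrapT => h; apply: no; exists i => // n xn.
    by apply/negPn/negP => nE; apply: h; exists n.
  rewrite -ltnS; apply: leq_trans hm; rewrite ltnS.
  have nB : n \in iota 0 B.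
    by rewrite mem_iota /= add0n ltnNge; apply/negP => /hB e; move: xn; rewrite e eqxx.
  have : (forall l, restr (E i) x l != 0 -> x l != 0).
    by move=> l; rewrite /restr; case: ifP; rewrite ?eqxx.
  have : ~~ (restr (E i) x n != 0) by rewrite /restr (negbTE nE) eqxx.
  move: (restr (E i) x) => y yn yx.
  rewrite !(permP (perm_to_rem nB)) /=.
  by rewrite (negbTE yn) xn add0n add1n ltnS; apply: sub_count => l; exact: yx.
move: suff1; rewrite le_max => /orP[//|h].
have := tnorm_ge0 R _ _ ub; lra.
Qed.

Lemma tsirelson_norm_exists : is_tsirelson_norm (fun x : sequences F => tnorm R (absseq x)).
Proof.
have nN : norm_on_c00 (fun x : sequences F => tnorm R (absseq x)).
  split.
  - move=> x /c00_norm_le[c hc] x0; apply/funext => n.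
    apply: (modulus0_eq0 hF); apply: le_anti; rewrite absseq_ge0 andbT -x0.
    exact: (norm_le_coord R (absseq_ge0 x) (tnorm_ub R hc)).
  - move=> a x /c00_norm_le[c hc].
    have e (b : F) y : absseq (b *: y) = fun n => modulus b * absseq y n.
      by apply/funext => n; rewrite /absseq seqZE (modulusM hF).
    have [->|a0] := eqVneq a 0.
      rewrite modulus0 mul0r; apply: le_anti; apply/andP; split.
        apply: tnorm_le => phi _ B; rewrite big1// => i _.
        by rewrite scale0r /absseq seq0E modulus0 mulr0.
      apply: (tnorm_ge0 R _ 0) => phi _ B; rewrite big1// => i _.
      by rewrite scale0r /absseq seq0E modulus0 mulr0.
    have ma : 0 < modulus a.
      rewrite lt_neqAle (modulus_ge0 hF) andbT eq_sym; apply: contra a0 => /eqP.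
      by move/(modulus0_eq0 hF) => ->.
    have h1 := norm_leZ R _ _ _ (ltW ma) (tnorm_ub R hc).
    apply: le_anti; apply/andP; split; first by apply: tnorm_le; rewrite e.
    rewrite -ler_pdivlMl//; apply: tnorm_le.
    rewrite -e in h1.
    have iv : 0 <= (modulus a)^-1 by rewrite invr_ge0 ltW.
    have := norm_leZ R _ _ _ iv (tnorm_ub R h1).
    rewrite (_ : (fun n => _) = absseq x)//; apply/funext => n.
    by rewrite e mulKf// gt_eqF.
  - move=> x y /c00_norm_le[c hc] /c00_norm_le[d hd].
    apply: tnorm_le; apply: norm_le_mono (norm_leD R _ _ _ _ (tnorm_ub R hc) (tnorm_ub R hd)).
    by move=> n; exact: (modulusD hF).
split=> // x cx; have [c hc] := c00_norm_le x cx; have ub := tnorm_ub R hc.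
apply: le_anti; apply/andP; split.
  apply: tnorm_le => phi [m B|k E psi hE npsi B].
    apply: le_trans (unit_pairing _ _ _ (absseq_ge0 x m)) _.
    by rewrite le_max supnorm_ge.
  rewrite node_pairing le_max; apply/orP; right; rewrite ler_wpM2l//.
  apply: le_trans (successive_sum_le _ nN k E x hE cx).
  apply: ler_sum => i _.
  have [d hd] := c00_norm_le _ (restr_c00 [set n | E i n] x cx).
  exact: (tnorm_ub R hd).
rewrite ge_max; apply/andP; split.
  apply: ge_sup; first by exists (modulus (x 0%N)), 0%N.
  by move=> _ [n _ <-]; exact: (norm_le_coord R (absseq_ge0 x) ub).
suff : sup (admissible_sums (fun x : sequences F => tnorm R (absseq x)) x)
   <= 2 * tnorm R (absseq x) by lra.
apply: ge_sup.
  exists (\sum_(i < 1) tnorm R (absseq (restr [set 0%N] x))), 1%N, (fun=> [set 0%N]).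
  split=> //; split=> //.
  by move=> i _; split; [exact: finite_set1|exists 0%N].
move=> _ [k [E [/admissible_successive hE ->]]].
apply: le_trans (tnorm_successive R (absseq x) _ k _ (absseq_ge0 x) ub hE).
apply: ler_sum => i _; rewrite (_ : absseq _ = fun n => (n \in E i)%:R * absseq x n)//.
apply/funext => n; rewrite -absseq_restr; congr (absseq (restr _ x) n).
by apply/seteqP; split=> l /=; rewrite inE.
Qed.

(** As [tsirelson_norm] is chosen by [xget], a solution must be exhibited before the bounds for
    arbitrary solutions apply to it. *)
Lemma tsirelson_normE x : c00 x -> tsirelson_norm x = tnorm R (absseq x).
Proof.
move=> cx; have h : is_tsirelson_norm (@tsirelson_norm R F).
  by apply: (@xgetPex _ (fun=> 0) [set N | is_tsirelson_norm N]); eexists; exact: tsirelson_norm_exists.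
apply: le_anti; rewrite (tsirelson_norm_upper _ h)//=.
by apply: tnorm_le; exact: tsirelson_norm_lower.
Qed.

End TsirelsonIdentification.

(** * Auxiliary sums and inequalities *)

Lemma sum_mem (R : realType) (s : seq nat) B (g : nat -> R) : uniq s ->
  (forall n, n \in s -> (n < B)%N) ->
  \sum_(n < B) ((n : nat) \in s)%:R * g n = \sum_(n <- s) g n.
Proof.
move=> us sB; rewrite -(big_mkord xpredT (fun n => (n \in s)%:R * g n)).
have -> : \sum_(n <- s) g n = \sum_(n <- [seq n <- index_iota 0 B | n \in s]) g n.
  apply: perm_big; apply: uniq_perm => //.
    by rewrite filter_uniq// iota_uniq.
  move=> n; rewrite mem_filter mem_index_iota /=.
  by case: (boolP (n \in s)) => // /sB ->.
rewrite big_filter [RHS]big_mkcond /=; apply: eq_bigr => n _.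
by case: ifP; rewrite ?mul1r ?mul0r.
Qed.

(** This quasi-triangle inequality holds for every p > 0, since x + y is at most twice the larger
    summand. *)
Lemma powR_addle (R : realType) (p x y : R) : 0 < p -> 0 <= x -> 0 <= y ->
  (x + y) `^ p <= 2 `^ p * (x `^ p + y `^ p).
Proof.
move=> p0; wlog xy : x y / x <= y => [h|] x0 y0.
  have [|/ltW] := leP x y => xy; first exact: h.
  by rewrite addrC [x `^ p + _]addrC; exact: h.
apply: (@le_trans _ _ ((2 * y) `^ p)).
  by rewrite ge0_ler_powR ?nnegrE ?addr_ge0 ?mulr_ge0 ?(ltW p0)//; lra.
by rewrite powRM// ler_wpM2l ?powR_ge0// lerDr powR_ge0.
Qed.

Lemma half_bounds m : (m <= 2 * (m - m./2))%N /\ (m - m./2 <= m./2.+1)%N.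
Proof. by split; lia. Qed.

Lemma sorted_ltn_leq (t : seq nat) i : sorted ltn t -> (i < size t)%N ->
  (i <= nth 0%N t i)%N.
Proof.
move=> st; elim: i => // i IH it; apply: leq_ltn_trans (IH (ltnW it)) _.
by apply: (sorted_ltn_nth ltn_trans) => //; rewrite inE// ltnW.
Qed.

Lemma leq_base_blk l n : (base l <= n)%N = (l <= blk n)%N.
Proof.
have mono a b : (a <= b)%N -> (base a <= base b)%N.
  move=> ab; rewrite /base -ltnS !prednK ?expn2_gt0// leq_exp2l//.
have := blk_bounds n; rewrite -baseS => /andP[h1 h2].
apply/idP/idP => [h|/mono h]; last exact: leq_trans h1.
rewrite leqNgt; apply/negP => /mono h3.
by have := leq_ltn_trans h h2; rewrite ltnNge h3.
Qed.

(** * Democracy of the unit vectors and small tails *)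

Section Democracy.
Variable R : realType.
Implicit Types (w v : nat -> R).

(** The upper half of s is admissible, as it has at most one element more than lie below it in s.
    Half of its indicator is therefore norming, and the two halvings give the factor 4. *)
Lemma norm_le_democratic (s : seq nat) (a c : R) : uniq s -> 0 <= a ->
  norm_le R (fun n => (n \in s)%:R * a) c -> a * (size s)%:R <= 4 * c.
Proof.
move=> us a0 hc; pose t := sort leq s; pose t' := drop (size t)./2 t.
have st : sorted ltn t by rewrite ltn_sorted_uniq_leq sort_uniq us sort_sorted//; exact: leq_total.
have st' : sorted ltn t' by apply: drop_sorted.
have hn : norming R (fun n => 2^-1 * (n \in t')%:R).
  apply: norming_half => // n nt'; rewrite size_drop.
  have it : (index n t' < size t')%N by rewrite index_mem.
  have := sorted_ltn_leq t ((size t)./2 + index n t')%N st.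
  rewrite -nth_drop nth_index//.
  move: it; rewrite size_drop => it h.
  have h1 : ((size t)./2 + index n t' < size t)%N by rewrite -ltn_subRL.
  apply: leq_trans (half_bounds (size t)).2 _; rewrite ltnS.
  exact: leq_trans (leq_addr _ _) (h h1).
pose B := (\max_(n <- t') n.+1)%N.
have tB n : n \in t' -> (n < B)%N.
  by move=> nt; rewrite /B (big_rem _ nt)/= leq_max leqnn.
have := hc _ hn B.
rewrite (eq_bigr (fun n : 'I_B => ((n : nat) \in t')%:R * (2^-1 * a))); last first.
  move=> n _; case: (boolP (_ \in t')) => nt; last by rewrite mulr0 !mul0r.
  by rewrite -(mem_sort leq) (mem_drop nt) !mul1r mulr1.
rewrite (sum_mem _ _ _ (fun=> 2^-1 * a)) //; last exact: (sorted_uniq ltn_trans ltnn).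
rewrite big_const_seq count_predT iter_addr_0 size_drop -[(_ * a) *+ _]mulr_natr size_sort.
have : ((size s)%:R : R) <= 2 * (size s - (size s)./2)%:R.
  by rewrite -natrM ler_nat; have [] := half_bounds (size s).
move: ((size s)%:R) => x; move: ((size s - _)%:R) => y xy h; nra.
Qed.

(** Membership in the completion, expressed by functionals. *)
Definition small_tail w : Prop :=
  forall e : R, 0 < e -> exists M, norm_le R (fun n => (M <= n)%:R * w n) e.

Lemma small_tail_bounded w : (forall n, 0 <= w n) -> small_tail w ->
  exists c, norm_le R w c.
Proof.
move=> w0 /(_ 1 ltr01)[M hM].
have h1 : norm_le R (fun n => (n < M)%:R * w n) (\sum_(n < M) w n).
  apply: norm_le_sum => [n|B]; first by rewrite mulr_ge0.
  apply: (@le_trans _ _ (\sum_(n < (B + M)) (n < M)%:R * w n)).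
    by rewrite big_split_ord /= lerDl sumr_ge0// => i _; rewrite mulr_ge0.
  rewrite addnC big_split_ord /= [X in _ + X]big1 ?addr0.
    by apply: ler_sum => i _; rewrite ltn_ord mul1r.
  by move=> i _; rewrite ltnNge leq_addr mul0r.
exists (\sum_(n < M) w n + 1).
apply: norm_le_mono (norm_leD _ _ _ _ _ h1 hM) => n.
by have [nM|Mn] := ltnP n M; rewrite ?mul1r ?mul0r ?addr0 ?add0r.
Qed.

Lemma block_sum_tail w l k :
  block_sum R (fun n => (base l <= n)%:R * w n) k = (l <= k)%:R * block_sum R w k.
Proof.
rewrite /block_sum mulr_sumr; apply: eq_bigr => j _; congr (_%:R * _). by rewrite leq_base_blk blk_base.
Qed.

End Democracy.

(** * The space T^(p) *)

Section Space.
Variables (R : realType) (F : scalarField R) (p : R).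
Hypotheses (hF : valued F) (p0 : 0 < p).
Implicit Types (f g x : sequences F).

Lemma absseq_truncateB x m n : (n <= m)%N ->
  absseq R F (truncate m x - truncate n x) =1
  (fun i => (n <= i < m)%:R * absseq R F x i).
Proof.
move=> nm i; rewrite /absseq seqDE seqNE /truncate !(restr_pred R F (fun i => i < _)%N).
have [im|mi] := ltnP i m; have [lt|ge] := ltnP i n => /=.
- by rewrite subrr modulus0// mul0r.
- by rewrite (@subr0 F) mul1r.
- by lia.
- by rewrite (@subrr F) modulus0// mul0r.
Qed.

Lemma truncate_c00 m x : c00 (truncate m x).
Proof.
apply/c00P; exists m => n mn; rewrite /truncate (restr_pred R F (fun i => i < _)%N).
by rewrite ltnNge mn.
Qed.

Lemma absseq_truncate x m : absseq R F (truncate m x) =1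
  (fun i => (i < m)%:R * absseq R F x i).
Proof. by move=> i; rewrite /truncate (absseq_restr R F hF (fun i => i < _)%N). Qed.

Lemma tsirelsonP x : tsirelson x <-> small_tail R (absseq R F x).
Proof.
have cB m n : c00 (truncate m x - truncate n x).
  have /c00P[a ha] := truncate_c00 m x; have /c00P[b hb] := truncate_c00 n x.
  apply/c00P; exists (maxn a b) => i; rewrite geq_max => /andP[ai bi].
  by rewrite seqDE seqNE ha// hb//; exact: (@subrr F 0).
split=> [hx e e0|hx e e0].
  have [M hM] := hx e e0; exists M => phi nphi B; have [BM|MB] := leqP B M.
    rewrite big1 ?(ltW e0)// => i _.
    by rewrite leqNgt (leq_trans (ltn_ord i) BM) mul0r mulr0.
  have := hM B M (ltnW MB) (leqnn M); rewrite (tsirelson_normE _ _ hF)// => /ltW; apply: le_trans.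
  have [c hc] := c00_norm_le _ _ hF _ (cB B M).
  apply: le_trans (tnorm_ub _ hc _ nphi B); apply: ler_sum => i _.
  by rewrite absseq_truncateB ?(ltnW MB)// ltn_ord andbT.
have [|M hM] := hx (e / 2); first by rewrite divr_gt0.
exists M => m n; wlog nm : m n / (n <= m)%N => [h Mm Mn|Mm Mn].
  have [|/ltnW] := leqP n m => nm; first exact: h.
  have := h n m nm Mn Mm; rewrite !(tsirelson_normE _ _ hF)//; congr (_ < _).
  congr (tnorm _ _); apply/funext => i; rewrite /absseq -opprB.
  exact: modulusN.
rewrite (tsirelson_normE _ _ hF)//; apply: (@le_lt_trans _ _ (e / 2)); last by lra.
apply: tnorm_le; apply: norm_le_mono hM => i; rewrite absseq_truncateB//.
rewrite ler_wpM2r ?absseq_ge0// ler_nat; case: (leqP n i) => //= ni.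
by rewrite (leq_trans Mn ni) leq_b1.
Qed.

Lemma tsirelson_cnormE x c : norm_le R (absseq R F x) c ->
  tsirelson_cnorm x = tnorm R (absseq R F x).
Proof.
move=> hc; have hc' := tnorm_ub _ hc; pose u n := tsirelson_norm (truncate n x).
have uE n : u n = tnorm R (absseq R F (truncate n x)).
  by rewrite /u (tsirelson_normE _ _ hF)//; exact: truncate_c00.
have le n : norm_le R (absseq R F (truncate n x)) (tnorm R (absseq R F x)).
  apply: norm_le_mono hc' => i; rewrite absseq_truncate.
  by rewrite ler_piMl ?absseq_ge0// lern1 leq_b1.
have ub : has_ubound (range u).
  by exists (tnorm R (absseq R F x)) => _ [n _ <-]; rewrite uE; exact: tnorm_le.
have nd : nondecreasing_seq u.
  move=> m n mn; rewrite !uE; apply: tnorm_mono (le n) => i.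
  rewrite !absseq_truncate ler_wpM2r ?absseq_ge0// ler_nat.
  by case: (ltnP i m) => // im; rewrite (leq_trans im mn).
rewrite /tsirelson_cnorm (cvg_lim _ (nondecreasing_cvgn nd ub))//.
apply: le_anti; apply/andP; split.
  by apply: ge_sup; [exists (u 0%N), 0%N|move=> _ [n _ <-]; rewrite uE; exact: tnorm_le].
apply: tnorm_le => phi nphi B.
apply: (@le_trans _ _ (u B)); last by apply: ub_le_sup => //; exists B.
rewrite uE; apply: le_trans (tnorm_ub _ (le B) _ nphi B); apply: ler_sum => i _.
by rewrite absseq_truncate ltn_ord mul1r.
Qed.

Definition pmass f : nat -> R := fun n => modulus (f n) `^ p.

Lemma pmass_ge0 f n : 0 <= pmass f n. Proof. exact: powR_ge0. Qed.

Lemma absseq_abs_power f : absseq R F (abs_power p f) = pmass f.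
Proof. by apply/funext => n; rewrite /absseq (modulus_of_real hF)// powR_ge0. Qed.

Lemma tsirelson_pP f : tsirelson_p p f <-> small_tail R (pmass f).
Proof. by rewrite /tsirelson_p /= -absseq_abs_power; exact: tsirelsonP. Qed.

Lemma tsirelson_p_bounded f : tsirelson_p p f -> exists c, norm_le R (pmass f) c.
Proof. by move=> /tsirelson_pP; apply: small_tail_bounded; exact: pmass_ge0. Qed.

Lemma qnormE f c : norm_le R (pmass f) c ->
  tsirelson_p_qnorm p f = tnorm R (pmass f) `^ p^-1.
Proof. by move=> h; rewrite /tsirelson_p_qnorm (@tsirelson_cnormE _ c) absseq_abs_power. Qed.

Lemma qnorm_ge0 f : 0 <= tsirelson_p_qnorm p f. Proof. exact: powR_ge0. Qed.

Lemma qnorm_le f c : norm_le R (pmass f) c -> tsirelson_p_qnorm p f <= c `^ p^-1.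
Proof.
move=> h; rewrite (qnormE _ _ h); apply: ge0_ler_powR.
- by rewrite invr_ge0 ltW.
- by rewrite nnegrE (tnorm_ge0 _ _ _ h).
- by rewrite nnegrE (norm_le_ge0 _ h).
- exact: tnorm_le.
Qed.

Lemma qnorm_ub f c : norm_le R (pmass f) c ->
  norm_le R (pmass f) (tsirelson_p_qnorm p f `^ p).
Proof.
move=> h; rewrite (qnormE _ _ h) -powRrM mulVf ?gt_eqF// powRr1 ?(tnorm_ge0 _ _ _ h)//.
exact: tnorm_ub h.
Qed.

Lemma powRK c : 0 <= c -> (c `^ p) `^ p^-1 = c.
Proof. by move=> c0; rewrite -powRrM divff ?gt_eqF// powRr1. Qed.

Lemma powRVK c : 0 <= c -> (c `^ p^-1) `^ p = c.
Proof. by move=> c0; rewrite -powRrM mulVf ?gt_eqF// powRr1. Qed.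

Lemma pmassD f g n : pmass (f + g) n <= 2 `^ p * (pmass f n + pmass g n).
Proof.
apply: le_trans (powR_addle _ _ _ _ p0 (modulus_ge0 hF _) (modulus_ge0 hF _)).
by rewrite ge0_ler_powR ?nnegrE ?addr_ge0 ?(modulus_ge0 hF)// ?(ltW p0)//; exact: (modulusD hF).
Qed.

Lemma pmassN f : pmass (- f) = pmass f.
Proof. by apply/funext => n; rewrite /pmass seqNE modulusN. Qed.

Lemma pmass0 (f : sequences F) n : f n = 0 -> pmass f n = 0.
Proof. by move=> fn; rewrite /pmass fn modulus0// powR0// gt_eqF. Qed.

Lemma norm_le_pmassD f g c d : norm_le R (pmass f) c -> norm_le R (pmass g) d ->
  norm_le R (pmass (f + g)) (2 `^ p * (c + d)).
Proof.
move=> hc hd.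
apply: norm_le_mono (norm_leZ _ _ _ _ (powR_ge0 2 p) (norm_leD _ _ _ _ _ hc hd)).
exact: pmassD.
Qed.

(** This reduces estimates in T^(p) to estimates of l_p-masses on single blocks. *)
Lemma norm_le_dominated f g H c : 0 <= H ->
  (forall k, block_sum R (pmass g) k <= H * block_sum R (pmass f) k) ->
  norm_le R (pmass f) c -> norm_le R (pmass g) (8 * (H * c)).
Proof.
move=> H0 gf hc; apply: (@norm_le_lattice _ (fun n => H * pmass f n)).
- by move=> n; rewrite mulr_ge0// pmass_ge0.
- exact: pmass_ge0.
- by move=> k; rewrite /block_sum -mulr_sumr; exact: gf.
- exact: norm_leZ.
Qed.

Lemma c00_tsirelson_p f : c00 f -> tsirelson_p p f.
Proof.
move=> /c00P[B hB]; apply/tsirelson_pP => e e0; exists B.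
apply: norm_le_sum => [n|C]; first by rewrite mulr_ge0// pmass_ge0.
rewrite big1 ?ltW// => n _; case: (leqP B n) => Bn; last by rewrite mul0r.
by rewrite pmass0 ?mulr0// hB.
Qed.

End Space.

(** * Good, small and bad blocks *)

Section Blocks.
Variables (R : realType) (F : scalarField R) (p : R) (I : finType).
Implicit Types (b : I -> F) (G A : pred I) (u : (I -> F) -> I -> F).

Definition fmass (f : I -> F) : R := \sum_i modulus (f i) `^ p.

Definition cut_to G b : I -> F := fun i => if G i then b i else 0.

(** The estimates concern p-th powers, which add up over coordinates. The threshold is explicit so
    that all blocks can share it, and [G] only has to be separated by [t], whatever happens at ties.
    In [block_lower] the vector is not restricted to [G]: the estimate thus also bounds single
    coefficients and makes u injective. *)
Record good_block (C : R) u : Prop := GoodBlock {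
  block_linear : forall (a : F) b b', u (fun i => a * b i + b' i) =
    fun i => a * u b i + u b' i;
  block_quasi_greedy : forall b t G, (forall i, G i -> t <= modulus (b i)) ->
    (forall i, ~~ G i -> modulus (b i) <= t) -> fmass (u (cut_to G b)) <= C * fmass (u b);
  block_lower : forall b t G, 0 <= t -> (forall i, G i -> t <= modulus (b i)) ->
    t `^ p * #|G|%:R <= C * fmass (u b);
  block_upper : forall b t G, (forall i, G i -> modulus (b i) <= t) ->
    fmass (u (cut_to G b)) <= C * (t `^ p * #|G|%:R) }.

Definition small_block (C : R) (m : nat) u : Prop :=
  forall b A, (#|A| <= m)%N -> fmass (u (cut_to A b)) <= C * fmass (u b).

Definition bad_block (K : R) A u : Prop :=
  exists2 b, fmass (u b) <= 1 & K <= fmass (u (cut_to A b)).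

Lemma fmass_ge0 f : 0 <= fmass f.
Proof. by apply: sumr_ge0 => i _; exact: powR_ge0. Qed.

End Blocks.

(** * Lindenstrauss trees for p <= 1 *)

Lemma powR_subadd (R : realType) (p x y : R) : 0 < p -> p <= 1 -> 0 <= x -> 0 <= y ->
  (x + y) `^ p <= x `^ p + y `^ p.
Proof.
move=> p0 p1 x0 y0; have [->|xy0] := eqVneq (x + y) 0.
  by rewrite powR0 ?gt_eqF// addr_ge0 ?powR_ge0.
have s0 : 0 < x + y by rewrite lt_neqAle eq_sym xy0 addr_ge0.
have key z : 0 <= z -> z <= x + y -> (x + y) `^ p * (z / (x + y)) <= z `^ p.
  move=> z0 zs; have [->|zn] := eqVneq z 0; first by rewrite mul0r mulr0 powR_ge0.
  have -> : z `^ p = (x + y) `^ p * (z / (x + y)) `^ p.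
    by rewrite -powRM ?divr_ge0// ?ltW// mulrC divfK.
  rewrite ler_wpM2l ?powR_ge0//; apply: ger1_powR => //.
  apply/andP; split; last by rewrite ler_pdivrMr ?mul1r.
  by rewrite divr_gt0// lt_neqAle z0 eq_sym zn.
have := key x x0; rewrite lerDl => /(_ y0).
have := key y y0; rewrite lerDr => /(_ x0).
move=> h1 h2; apply: le_trans (lerD h2 h1).
by rewrite -mulrDr -mulrDl divff// mulr1.
Qed.

Lemma sum_divn (R : realType) (M D : nat) (h : nat -> R) : (0 < M)%N ->
  \sum_(m < M * D) h (m %/ M)%N = M%:R * \sum_(n < D) h n.
Proof.
move=> M0; elim: D => [|D IH]; first by rewrite muln0 !big_ord0 mulr0.
rewrite mulnS addnC big_split_ord /= IH big_ord_recr /= mulrDr; congr (_ + _).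
rewrite (eq_bigr (fun=> h D)); last first.
  by move=> i _; rewrite mulnC divnMDl// divn_small ?addn0.
by rewrite sumr_const card_ord mulr_natl.
Qed.

Fixpoint tree_depth_rec (M fuel n : nat) : nat :=
  if fuel is fuel'.+1 then
    if n is n'.+1 then (tree_depth_rec M fuel' (n' %/ M)).+1 else 0%N
  else 0%N.

Definition tree_depth M n := tree_depth_rec M n n.

Lemma tree_depthS M n : tree_depth M n.+1 = (tree_depth M (n %/ M)).+1.
Proof.
have fuelE : forall a b m, (m <= a)%N -> (m <= b)%N ->
    tree_depth_rec M a m = tree_depth_rec M b m.
  elim=> [|a IH] [|b] [|m]//= ma mb; congr _.+1.
  by apply: IH; apply: leq_trans (leq_div _ _) _.
by rewrite /tree_depth /=; congr _.+1; apply: fuelE => //; exact: leq_div.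
Qed.

(* The nodes of the tree are numbered so that the children of n are
   M n + 1, ..., M n + M.  The vectors e_n - c (sum of e_m, m child of n) with
   |c| ^ p = 1 / M are those of the Lindenstrauss basis if p = 1 and M = 2. *)
Section Tree.
Variables (R : realType) (F : scalarField R) (p : R).
Hypotheses (hF : valued F) (p0 : 0 < p) (p1 : p <= 1).
Variables (M D : nat).
Hypothesis M2 : (2 <= M)%N.
Local Notation I := 'I_D.+1.
Implicit Types (b : I -> F) (G A : pred I).

Let c : F := of_real F (M%:R `^ (- p^-1)).

Definition tree_parent (i : I) : I := inord (i.-1 %/ M).
Local Notation par := tree_parent.

Definition tree_op b : I -> F :=
  fun i => if i == ord0 then b i else b i - c * b (par i).
Local Notation u := tree_op.

Let M0 : (0 : R) < M%:R. Proof. by rewrite ltr0n; lia. Qed.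

Let cE : modulus c = M%:R `^ (- p^-1).
Proof. by rewrite (modulus_of_real hF) ?powR_ge0. Qed.

Let cp : modulus c `^ p = M%:R^-1.
Proof.
by rewrite cE -powRrM mulNr mulVf ?gt_eqF// powRN powRr1 ?ltW.
Qed.

Let c_half : modulus c <= 2^-1.
Proof.
rewrite cE powRN lef_pV2 ?posrE ?powR_gt0//.
apply: (@le_trans _ _ (M%:R : R)); first by rewrite ler_nat.
by apply: le1r_powR; rewrite ?ler1n ?invf_ge1//; lia.
Qed.

Lemma tree_parent_val i : par i = (i.-1 %/ M)%N :> nat.
Proof.
rewrite /par inordK//; apply: leq_ltn_trans (leq_div _ _) _.
by apply: leq_ltn_trans (leq_pred _) _.
Qed.

(** A node has at most M children; some of them may be missing because the tree stops at D, hence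
    the inequality. *)
Lemma tree_children_sum (g : I -> R) : (forall i, 0 <= g i) ->
  \sum_(i | i != ord0) M%:R^-1 * g (par i) <= \sum_i g i.
Proof.
move=> g0; rewrite -mulr_sumr mulrC ler_pdivrMr// mulrC.
pose h n := g (inord n).
have -> : \sum_i g i = \sum_(n < D.+1) h n.
  by apply: eq_bigr => i _; rewrite /h inord_val.
rewrite -sum_divn ?(ltnW M2)//.
rewrite big_mkcond big_ord_recl /= add0r.
have le : (D <= M * D.+1)%N by apply: leq_trans (leqnSn D) _; rewrite leq_pmull// ltnW.
rewrite -(subnKC le) big_split_ord /= -[leLHS]addr0 lerD//.
by apply: sumr_ge0 => i _; exact: g0.
Qed.

Let ubD b b' (a : F) : u (fun i => a * b i + b' i) = fun i => a * u b i + u b' i.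
Proof.
apply/funext => i; rewrite /u; case: ifP => // _.
by rewrite mulrDr opprD addrACA mulrBr mulrCA.
Qed.

Section Estimates.
Variables (b : I -> F).
Let beta i := modulus (b i) `^ p.
Let sigma i := modulus (u b i) `^ p.
Let tau := fmass R F p I (u b).
Let beta0 i : 0 <= beta i. Proof. exact: powR_ge0. Qed.
Let sigma0 i : 0 <= sigma i. Proof. exact: powR_ge0. Qed.
Let tau0 : 0 <= tau. Proof. exact: fmass_ge0. Qed.
Let sigma_tau i : sigma i <= tau.
Proof. by rewrite /tau /fmass (bigD1 i)//= lerDl sumr_ge0// => j _; exact: powR_ge0. Qed.

Let root i : i = ord0 -> sigma i = beta i.
Proof. by move=> ->; rewrite /sigma /u eqxx. Qed.

Let cbp (x : F) : modulus (c * x) `^ p = M%:R^-1 * modulus x `^ p.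
Proof. by rewrite (modulusM hF) powRM ?(modulus_ge0 hF)// cp. Qed.

Let beta_le i : i != ord0 -> beta i <= sigma i + M%:R^-1 * beta (par i).
Proof.
move=> i0; rewrite /sigma /u (negbTE i0) -cbp.
apply: le_trans (powR_subadd _ _ _ _ p0 p1 (modulus_ge0 hF _) (modulus_ge0 hF _)).
rewrite ge0_ler_powR ?nnegrE ?addr_ge0 ?(modulus_ge0 hF) ?(ltW p0)//.
by apply: le_trans (modulusD hF _ _); rewrite subrK.
Qed.

(** As |c| <= 1/2, the modulus of b i is at most that of u b i plus half of itself; moreover 2 ^ p
    <= 2. *)
Let beta_le2 i : i != ord0 -> modulus (b (par i)) <= modulus (b i) -> beta i <= 2 * sigma i.
Proof.
move=> i0 le; rewrite /sigma /u (negbTE i0); set x := b i - _.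
have h : modulus (b i) <= 2 * modulus x.
  have : modulus (b i) <= modulus x + modulus (c * b (par i)).
    by apply: le_trans (modulusD hF _ _); rewrite subrK.
  rewrite (modulusM hF); have := modulus_ge0 hF (b (par i)); have := c_half.
  have := modulus_ge0 hF c; move: (modulus c) (modulus (b (par i))) le => y z le; nra.
apply: (@le_trans _ _ ((2 * modulus x) `^ p)).
  by rewrite ge0_ler_powR ?nnegrE ?mulr_ge0 ?(modulus_ge0 hF) ?(ltW p0).
rewrite powRM ?(modulus_ge0 hF)// ler_wpM2r ?powR_ge0//.
by apply: ler1_powR => //; lra.
Qed.

Let inner G i := [&& i != ord0, G i & G (par i)].
Let boundary G i := [&& i != ord0, ~~ G i & G (par i)].

(** A node of G whose parent is also in G contributes at most sigma i after the inner term is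
    subtracted. One whose parent is outside is at least as large as the parent, and is controlled by
    its own entry. *)
Let mass_balance G : (forall i, i != ord0 -> G i -> ~~ G (par i) -> modulus (b (par i)) <= modulus (b i)) ->
  \sum_(i | G i) beta i - \sum_(i | inner G i) M%:R^-1 * beta (par i) <= 2 * tau.
Proof.
move=> hG; rewrite big_mkcond [X in _ - X]big_mkcond -sumrB /tau /fmass mulr_sumr.
apply: ler_sum => i _; rewrite -/(sigma i) /inner; have s0 := sigma0 i.
case: (boolP (G i)) => Gi; last by rewrite !andbF subr0 mulr_ge0.
have [i0|i0] := eqVneq i ord0; first by rewrite /= -root//; lra.
case: (boolP (G (par i))) => Gp /=; first by have := beta_le i i0; lra.
by rewrite subr0; apply: beta_le2 => //; exact: hG.
Qed.

Let split_children G (g : I -> R) : (forall i, G i -> 0 <= g i) ->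
  \sum_(i | boundary G i) M%:R^-1 * g (par i) + \sum_(i | inner G i) M%:R^-1 * g (par i) <=
  \sum_(i | G i) g i.
Proof.
move=> g0; rewrite [leRHS]big_mkcond /=.
apply: le_trans (tree_children_sum _ _); last by move=> i; case: ifP => // /g0.
rewrite [X in X + _]big_mkcond [X in _ + X]big_mkcond [leRHS]big_mkcond -big_split /=.
apply: ler_sum => i _; rewrite /boundary /inner; by case: (i != ord0); case: (G i); case: (G (par i)) => /=; rewrite ?addr0 ?add0r ?mulr0.
Qed.

(** Cutting to G creates uncontrolled entries only at nodes outside G with a parent in G. By
    [split_children] their mass is at most that of G minus the inner mass, which [mass_balance]
    bounds by 2 tau. *)
Lemma tree_quasi_greedy t G : (forall i, G i -> t <= modulus (b i)) ->
  (forall i, ~~ G i -> modulus (b i) <= t) ->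
  fmass R F p I (u (cut_to R F I G b)) <= 4 * tau.
Proof.
move=> hG hnG.
have mb := mass_balance G (fun i _ Gi Gp => le_trans (hnG _ Gp) (hG _ Gi)).
have sc := split_children G beta (fun i _ => beta0 i).
suff : fmass R F p I (u (cut_to R F I G b)) <=
    2 * tau + \sum_(i | boundary G i) M%:R^-1 * beta (par i) by lra.
rewrite /tau /fmass mulr_sumr [X in _ + X]big_mkcond -big_split /=.
apply: ler_sum => i _; rewrite -/(sigma i) /boundary {1}/u /cut_to.
have s0 := sigma0 i; have [i0|i0] := eqVneq i ord0.
  rewrite /= addr0; case: (G i); first by rewrite -/(beta i) -root//; lra.
  by rewrite (modulus0 R F hF) powR0 ?gt_eqF// mulr_ge0.
case: (boolP (G i)) => Gi; case: (boolP (G (par i))) => Gp /=.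
- by rewrite addr0 {1}/sigma /u (negbTE i0) in s0 *; rewrite /sigma /u (negbTE i0); lra.
- by rewrite mulr0 subr0 addr0; apply: beta_le2 => //; exact: le_trans (hnG _ Gp) (hG _ Gi).
- by rewrite sub0r (modulusN R F hF) cbp lerDr mulr_ge0.
- by rewrite mulr0 subr0 (modulus0 R F hF) powR0 ?gt_eqF// addr0 mulr_ge0.
Qed.

(** For the full level set G', [split_children] applied to beta - t ^ p shows that replacing beta by
    the constant t ^ p only lowers the difference in [mass_balance]. For the constant it is at least
    t ^ p |G'| / 2, as M >= 2. *)
Lemma tree_lower t G : 0 <= t -> (forall i, G i -> t <= modulus (b i)) ->
  t `^ p * #|G|%:R <= 4 * tau.
Proof.
move=> t0 hG; pose G' : pred I := fun i => t <= modulus (b i).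
have G'C i : ~~ G' i -> modulus (b i) <= t by rewrite /G' -ltNge => /ltW.
have GG' : (#|G| <= #|G'|)%N by apply: subset_leq_card; apply/fintype.subsetP => i; exact: hG.
apply: (@le_trans _ _ (t `^ p * #|G'|%:R)); first by rewrite ler_wpM2l ?powR_ge0// ler_nat.
have mb := mass_balance G' (fun i _ Gi Gp => le_trans (G'C _ Gp) Gi).
have bt i : G' i -> 0 <= beta i - t `^ p.
  move=> Gi; rewrite subr_ge0 ge0_ler_powR ?nnegrE ?(modulus_ge0 hF) ?(ltW p0)//.
have sc := split_children G' (fun i => beta i - t `^ p) bt.
have sc1 := split_children G' (fun=> 1) (fun _ _ => ler01).
have b1 : 0 <= \sum_(i | boundary G' i) M%:R^-1 * (beta (par i) - t `^ p).
  by apply: sumr_ge0 => i /and3P[_ _ Gp]; rewrite mulr_ge0 ?invr_ge0 ?(ltW M0)// bt.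
have b2 : 0 <= \sum_(i | boundary G' i) (M%:R^-1 * 1 : R).
  by apply: sumr_ge0 => i _; rewrite mulr1 invr_ge0 (ltW M0).
have e1 : \sum_(i | inner G' i) M%:R^-1 * (beta (par i) - t `^ p) =
    \sum_(i | inner G' i) M%:R^-1 * beta (par i) - t `^ p * \sum_(i | inner G' i) (M%:R^-1 * 1).
  by rewrite mulr_sumr -sumrB; apply: eq_bigr => i _; rewrite mulrBr mulr1 [t `^ p * _]mulrC.
have e2 : \sum_(i | G' i) (beta i - t `^ p) = \sum_(i | G' i) beta i - t `^ p * #|G'|%:R.
  by rewrite sumrB sumr_const mulr_natr.
have e3 : \sum_(i | inner G' i) (M%:R^-1 * 1 : R) <= 2^-1 * #|G'|%:R.
  apply: (@le_trans _ _ (M%:R^-1 * #|G'|%:R)).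
    rewrite -mulr_sumr ler_wpM2l ?invr_ge0 ?(ltW M0)// sumr_const ler_nat.
    by apply: subset_leq_card; apply/fintype.subsetP => i /and3P[].
  by rewrite ler_wpM2r// lef_pV2 ?posrE// ler_nat.
have T0 := powR_ge0 t p.
move: sc; rewrite e1 e2 => sc.
have : t `^ p * \sum_(i | inner G' i) (M%:R^-1 * 1) <= t `^ p * (2^-1 * #|G'|%:R).
  by rewrite ler_wpM2l.
by move: (t `^ p * \sum_(i | _) _) sc => x sc; lra.
Qed.

Lemma tree_cut_le G :
  fmass R F p I (u (cut_to R F I G b)) <= 2 * \sum_(i | G i) beta i.
Proof.
have sc := split_children G beta (fun i _ => beta0 i).
suff : fmass R F p I (u (cut_to R F I G b)) <= \sum_(i | G i) beta i +
   (\sum_(i | boundary G i) M%:R^-1 * beta (par i) + \sum_(i | inner G i) M%:R^-1 * beta (par i)) by lra.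
rewrite /fmass [X in _ <= X + _]big_mkcond [X in _ + (X + _)]big_mkcond
  [X in _ + (_ + X)]big_mkcond -!big_split /=.
apply: ler_sum => i _; rewrite /boundary /inner /u /cut_to.
have [i0|i0] /= := eqVneq i ord0.
  by rewrite !addr0; case: (G i) => //; rewrite (modulus0 R F hF) powR0 ?gt_eqF.
case: (boolP (G i)) => Gi; case: (boolP (G (par i))) => Gp /=; rewrite ?addr0 ?add0r.
- rewrite -cbp; apply: le_trans (powR_subadd _ _ _ _ p0 p1 (modulus_ge0 hF _) (modulus_ge0 hF _)).
  rewrite ge0_ler_powR ?nnegrE ?addr_ge0 ?(modulus_ge0 hF) ?(ltW p0)//.
  by apply: le_trans (modulusD hF _ _) _; rewrite (modulusN R F hF).
- by rewrite mulr0 subr0.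
- by rewrite (modulusN R F hF) cbp.
- by rewrite mulr0 oppr0 (modulus0 R F hF) powR0 ?gt_eqF.
Qed.

Lemma tree_upper t G : (forall i, G i -> modulus (b i) <= t) ->
  fmass R F p I (u (cut_to R F I G b)) <= 2 * (t `^ p * #|G|%:R).
Proof.
move=> hG; apply: le_trans (tree_cut_le G) _; rewrite ler_pM2l// mulr_natr -sumr_const.
apply: ler_sum => i Gi; rewrite ge0_ler_powR ?nnegrE ?(modulus_ge0 hF) ?(ltW p0) ?hG//.
exact: le_trans (modulus_ge0 hF _) (hG _ Gi).
Qed.

Lemma tree_coord_le i : beta i <= 2 * tau.
Proof.
have [n] := ubnP (i : nat); elim: n i => // n IH i ni.
have [i0|i0] := eqVneq i ord0; first by rewrite -root//; have := sigma_tau i; have := tau0; lra.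
have := beta_le i i0; have : beta (par i) <= 2 * tau.
  apply: IH; rewrite tree_parent_val; apply: leq_ltn_trans (leq_div _ _) _.
  have : (0 < i)%N by rewrite lt0n. by move: ni; case: (i : nat).
have := sigma_tau i; have M1 : M%:R^-1 <= (2^-1 : R) by rewrite lef_pV2 ?posrE// ler_nat.
have : 0 < (M%:R^-1 : R) by rewrite invr_gt0.
move: (M%:R^-1) M1 => x; have := beta0 (par i); have := tau0; nra.
Qed.

(** Each coefficient costs its own entry plus at most 2 tau / M coming from its parent, and M such
    terms sum to 2 tau. This is why the branching number is taken at least m. *)
Lemma tree_small A : (#|A| <= M)%N -> fmass R F p I (u (cut_to R F I A b)) <= 6 * tau.
Proof.
move=> hA; suff : \sum_(i | A i) beta i <= 3 * tau by have := tree_cut_le A; lra.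
apply: (@le_trans _ _ (\sum_(i | A i) (sigma i + M%:R^-1 * (2 * tau)))).
  apply: ler_sum => i _; have [i0|i0] := eqVneq i ord0.
    by rewrite root// lerDl mulr_ge0 ?invr_ge0 ?(ltW M0)// mulr_ge0.
  apply: le_trans (beta_le i i0) _; rewrite lerD2l ler_wpM2l ?invr_ge0 ?(ltW M0)//.
  exact: tree_coord_le.
rewrite big_split /= sumr_const.
have h1 : \sum_(i | A i) sigma i <= tau.
  by rewrite /tau /fmass [leRHS](bigID A)/= lerDl sumr_ge0// => j _; exact: powR_ge0.
have h2 : (M%:R^-1 * (2 * tau)) *+ #|A| <= 2 * tau.
  rewrite -mulr_natr mulrC mulrA -[leRHS]mul1r ler_wpM2r ?mulr_ge0//.
  by rewrite ler_pdivrMr// mul1r ler_nat.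
lra.
Qed.

End Estimates.

Lemma tree_good : good_block R F p I 6 u.
Proof.
split=> [a b b'|b t G hG hnG|b t G t0 hG|b t G hG]; first exact: ubD.
- by apply: le_trans (tree_quasi_greedy b t G hG hnG) _; rewrite ler_wpM2r ?fmass_ge0//; lra.
- by apply: le_trans (tree_lower b t G t0 hG) _; rewrite ler_wpM2r ?fmass_ge0//; lra.
- apply: le_trans (tree_upper b t G hG) _; rewrite ler_wpM2r ?mulr_ge0 ?powR_ge0//; lra.
Qed.

Lemma tree_bad K : K <= \sum_(n < D.+1) (M%:R^-1 : R) ^+ tree_depth M n ->
  bad_block R F p I K (fun i : I => ~~ odd (tree_depth M i)) u.
Proof.
(* Here u b is the root vector, every other entry being cancelled by the parent. After the cut to
   even depths, nothing cancels and each node keeps an entry of modulus |b i|. *)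
move=> hK; pose b (i : I) := c ^+ tree_depth M i.
have bS i : i != ord0 -> b i = c * b (par i) /\
    odd (tree_depth M i) = ~~ odd (tree_depth M (par i)).
  case: i => [[|n] nD]// _; rewrite /b tree_parent_val [nat_of_ord _]/= tree_depthS exprS.
  by split.
have b0 : b ord0 = 1 by rewrite /b /tree_depth /= expr0.
have bE i : modulus (b i) `^ p = M%:R^-1 ^+ tree_depth M i.
  rewrite /b; elim: (tree_depth M i) => [|d IH].
    by rewrite !expr0 (modulus1 R F hF) powR1.
  by rewrite !exprS (modulusM hF) powRM ?(modulus_ge0 hF)// cp IH.
exists b.
  rewrite /fmass (bigD1 ord0)//= {1}/u eqxx b0 (modulus1 R F hF) powR1 big1 ?addr0//.
  move=> i i0; rewrite /u (negbTE i0) (bS i i0).1 subrr (modulus0 R F hF) powR0//.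
  by rewrite gt_eqF.
apply: le_trans hK _; apply: ler_sum => i _; rewrite -bE /u /cut_to.
have [->|i0] := eqVneq i ord0; first by rewrite /tree_depth.
have [e1 ->] := bS i i0; case: (odd _) => /=.
  by rewrite mulr0 subr0.
by rewrite sub0r (modulusN R F hF) -e1.
Qed.

End Tree.

Lemma tree_sum_unbounded (R : realType) M K : (2 <= M)%N ->
  exists D, K <= \sum_(n < D.+1) (M%:R^-1 : R) ^+ tree_depth M n.
Proof.
move=> M2.
suff h k : exists D, (k%:R : R) <= \sum_(n < D.+1) (M%:R^-1 : R) ^+ tree_depth M n.
  have [D hD] := h (Num.trunc `|K|).+1; exists D; apply: le_trans hD.
  by apply: le_trans (ler_norm K) _; apply: ltW; apply: truncnS_gt.
elim: k => [|k [D hD]].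
  by exists 0%N; apply: sumr_ge0 => i _; rewrite exprn_ge0.
(* The nodes up to M (D + 1) are the root and all children of the nodes up to D. Each node passes
   its weight on to its M children, so the sum is 1 more than the one for D. *)
exists (M * D.+1)%N; rewrite big_ord_recl /= expr0 -natr1 addrC lerD2l.
apply: le_trans hD _; rewrite -[leLHS]mul1r.
have M0 : (M%:R : R) != 0 by rewrite pnatr_eq0; lia.
rewrite -{1}(mulVf M0) -mulrA -(sum_divn R M D.+1 (fun n => M%:R^-1 ^+ tree_depth M n)); last by lia.
by rewrite mulr_sumr; apply: ler_sum => i _; rewrite /bump /= add1n tree_depthS exprS.
Qed.

Lemma block_exists_le1 (R : realType) (F : scalarField R) (p : R) :
  valued F -> 0 < p -> p <= 1 -> forall m K,
  exists (I : finType) (u : (I -> F) -> I -> F) (A : pred I),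
    [/\ good_block R F p I 6 u, small_block R F p I 6 m u & bad_block R F p I K A u].
Proof.
move=> hF p0 p1 m K; pose M := maxn m 2; have M2 : (2 <= M)%N by rewrite leq_maxr.
have [D hD] := tree_sum_unbounded R M K M2.
exists 'I_D.+1, (tree_op R F p M D), (fun i : 'I_D.+1 => ~~ odd (tree_depth M i)); split.
- exact: tree_good.
- by move=> b A hA; apply: tree_small => //; apply: leq_trans hA _; rewrite leq_maxl.
- exact: tree_bad.
Qed.

(** * Jensen's inequality for p > 1 *)

Section Jensen.
Variables (R : realType) (p : R).
Hypothesis p1 : 1 < p.
Let p0 : 0 < p. Proof. exact: lt_trans ltr01 p1. Qed.

(** Young's inequality for the product of z and 1. *)
Lemma powR_bernoulli (z : R) : 0 <= z -> p * z - (p - 1) <= z `^ p.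
Proof.
move=> z0; pose q := p / (p - 1); have pm : 0 < p - 1 by rewrite subr_gt0.
have q0 : 0 < q by rewrite divr_gt0.
have qp : p^-1 + q^-1 = 1.
  by rewrite /q invf_div -{1}[p^-1]mul1r -mulrDl addrC subrK divff ?gt_eqF.
have := conjugate_powR z0 ler01 p0 q0 qp; rewrite mulr1 powR1 mul1r.
rewrite /q invf_div -mulrDl ler_pdivlMr//; lra.
Qed.

Lemma powR_tangent (x y : R) : 0 <= x -> 0 < y ->
  y `^ p + p * y `^ (p - 1) * (x - y) <= x `^ p.
Proof.
move=> x0 y0; have y0' := ltW y0; have h := powR_bernoulli _ (divr_ge0 x0 (ltW y0)).
have yp : y `^ p = y * y `^ (p - 1) by rewrite mulr_powRB1 ?ltW.
have xp : x `^ p = y `^ p * (x / y) `^ p.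
  by rewrite -powRM ?divr_ge0// mulrC divfK ?gt_eqF.
rewrite xp; apply: le_trans (ler_wpM2l (powR_ge0 y p) h).
have -> : y `^ p * (p * (x / y) - (p - 1)) = p * y `^ (p - 1) * x - (p - 1) * y `^ p.
  rewrite mulrBr; congr (_ - _); last by rewrite mulrC.
  rewrite yp mulrCA -!mulrA; congr (_ * _); rewrite mulrCA; congr (_ * _).
  by rewrite mulrCA divff ?mulr1// gt_eqF.
rewrite yp; move: (y `^ (p - 1)) => u; lra.
Qed.

Lemma powR_jensen (I : finType) (l x : I -> R) :
  (forall i, 0 <= l i) -> (forall i, 0 <= x i) ->
  (\sum_i l i * x i) `^ p <= (\sum_i l i) `^ (p - 1) * \sum_i l i * x i `^ p.
Proof.
move=> l0 x0; set L := \sum_i l i; set S := \sum_i l i * x i.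
have S0 : 0 <= S by apply: sumr_ge0 => i _; rewrite mulr_ge0.
have L0 : 0 <= L by apply: sumr_ge0.
have rhs0 : 0 <= L `^ (p - 1) * \sum_i l i * x i `^ p.
  by rewrite mulr_ge0 ?powR_ge0// sumr_ge0// => i _; rewrite mulr_ge0 ?powR_ge0.
have [->|Sn] := eqVneq S 0; first by rewrite powR0 ?gt_eqF.
have Sp : 0 < S by rewrite lt_neqAle eq_sym Sn.
have Lp : 0 < L.
  rewrite lt_neqAle eq_sym L0 andbT; apply: contra Sn => /eqP Lz; apply/eqP.
  apply: big1 => i _; have : l i = 0.
    by apply: (psumr_eq0P (P := xpredT) (F := l)) => //.
  by move=> ->; rewrite mul0r.
pose y := S / L; have y0 : 0 < y by rewrite divr_gt0.
have key : L * y `^ p <= \sum_i l i * x i `^ p.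
  have -> : L * y `^ p = \sum_i l i * (y `^ p + p * y `^ (p - 1) * (x i - y)).
    under eq_bigr do rewrite mulrDr.
    rewrite big_split /= -mulr_suml -/L -[LHS]addr0; congr (_ + _).
    under eq_bigr do rewrite mulrCA.
    rewrite -mulr_sumr; under eq_bigr do rewrite mulrBr.
    by rewrite sumrB -mulr_suml -/L -/S /y [L * _]mulrC divfK ?gt_eqF// subrr mulr0.
  by apply: ler_sum => i _; rewrite ler_wpM2l// powR_tangent.
have -> : S `^ p = L `^ (p - 1) * (L * y `^ p).
  rewrite mulrA [L `^ _ * L]mulrC mulr_powRB1// -powRM ?ltW//.
  by rewrite /y mulrC divfK ?gt_eqF.
by rewrite ler_wpM2l ?powR_ge0.
Qed.

Lemma powR_sum_count (I : finType) (P : pred I) (x : I -> R) (m : R) :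
  (forall i, 0 <= x i) -> \sum_i (P i)%:R <= m ->
  (\sum_i (P i)%:R * x i) `^ p <= m `^ (p - 1) * \sum_i (P i)%:R * x i `^ p.
Proof.
move=> x0 Pm; apply: le_trans (powR_jensen I (fun i => (P i)%:R) x _ x0) _; first by [].
rewrite ler_wpM2r//; first by apply: sumr_ge0 => i _; rewrite mulr_ge0 ?powR_ge0.
apply: ge0_ler_powR => //; rewrite ?nnegrE ?sumr_ge0//; first by rewrite subr_ge0 ltW.
exact: le_trans (sumr_ge0 _ _) Pm.
Qed.

End Jensen.

(** * A sparse graph on the levels *)

Definition edge (L n i : nat) : bool := [exists e : 'I_L, (n + 2 ^ e == i)%N].

Section Edges.
Variables (R : realType) (p : R).
Hypothesis p1 : 1 < p.
Variables (L k : nat).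
Implicit Types (v : nat -> R) (n i : nat).
Let p0 : 0 < p. Proof. exact: lt_trans ltr01 p1. Qed.

Lemma edge_lt n i : edge L n i -> (n < i)%N.
Proof. by move=> /existsP[e /eqP <-]; rewrite -addn1 leq_add2l expn2_gt0. Qed.

Let bool_sum_le1 (K : nat) (P : pred nat) :
  (forall i j, (i < K)%N -> (j < K)%N -> P i -> P j -> i = j) ->
  \sum_(i < K) (P i)%:R <= 1 :> R.
Proof.
move=> h; rewrite -natr_sum lern1.
have -> : (\sum_(i < K) P i = #|[pred i : 'I_K | P i]|)%N.
  by rewrite -sum1_card [RHS]big_mkcond /=; apply: eq_bigr => i _; rewrite inE; case: (P i).
apply/card_le1_eqP => i j; rewrite !inE => Pi Pj; apply/val_inj.
exact: (h _ _ (ltn_ord j) (ltn_ord i) Pj Pi).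
Qed.

Let edge_le n i : (edge L n i)%:R <= \sum_(e < L) (n + 2 ^ e == i)%N%:R :> R.
Proof.
case: (boolP (edge L n i)) => [/existsP[e he]|_]; last exact: sumr_ge0.
by rewrite (bigD1 e)//= he lerDl sumr_ge0.
Qed.

Lemma edge_out n : \sum_(i < k) (edge L n i)%:R <= L%:R :> R.
Proof.
apply: (@le_trans _ _ (\sum_(i < k) \sum_(e < L) (n + 2 ^ e == i)%N%:R)).
  by apply: ler_sum => i _; exact: edge_le.
rewrite exchange_big /= -[X in _ <= X%:R]card_ord -sumr_const.
apply: ler_sum => e _; apply: (bool_sum_le1 k (fun i => n + 2 ^ e == i)%N).
by move=> i j _ _ /eqP <- /eqP <-.
Qed.

Lemma edge_in i : \sum_(n < k) (edge L n i)%:R <= L%:R :> R.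
Proof.
apply: (@le_trans _ _ (\sum_(n < k) \sum_(e < L) (n + 2 ^ e == i)%N%:R)).
  by apply: ler_sum => n _; exact: edge_le.
rewrite exchange_big /= -[X in _ <= X%:R]card_ord -sumr_const.
apply: ler_sum => e _; apply: (bool_sum_le1 k (fun n => n + 2 ^ e == i)%N).
by move=> m n _ _ /eqP h1 /eqP h2; apply/eqP; rewrite -(eqn_add2r (2 ^ e)) h1 h2.
Qed.

Definition edge_sum v i : R := \sum_(n < k) (edge L n i)%:R * v n.

(** Each edge sum is at most V, so its p-th power is at most V ^ (p - 1) times itself; summing over
    i counts every n at most L times. *)
Lemma edge_sum_l1 v : (forall n, 0 <= v n) ->
  \sum_(i < k) edge_sum v i `^ p <= L%:R * (\sum_(n < k) v n) `^ p.
Proof.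
move=> v0; set V := \sum_(n < k) v n; have V0 : 0 <= V by exact: sumr_ge0.
have es0 i : 0 <= edge_sum v i by apply: sumr_ge0 => n _; rewrite mulr_ge0.
have esV i : edge_sum v i <= V.
  by apply: ler_sum => n _; rewrite ler_piMl// lern1 leq_b1.
apply: (@le_trans _ _ (V `^ (p - 1) * \sum_(i < k) edge_sum v i)).
  rewrite mulr_sumr; apply: ler_sum => i _.
  rewrite -(mulr_powRB1 (es0 i) p0) mulrC ler_wpM2r//.
  by rewrite ge0_ler_powR ?nnegrE// subr_ge0 ltW.
rewrite -(mulr_powRB1 V0 p0) mulrA [leRHS]mulrC ler_wpM2l ?powR_ge0//.
rewrite /edge_sum exchange_big /= mulr_sumr; apply: ler_sum => n _.
by rewrite -mulr_suml ler_wpM2r// edge_out.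
Qed.

Lemma edge_sum_row v i : (forall n, 0 <= v n) ->
  edge_sum v i `^ p <= L%:R `^ (p - 1) * \sum_(n < k) v n `^ p.
Proof.
move=> v0; have h := powR_sum_count R p p1 _ (fun n : 'I_k => edge L n i) (fun n : 'I_k => v n) _ (fun n : 'I_k => v0 n) (edge_in i).
apply: le_trans h _.
rewrite ler_wpM2l ?powR_ge0//; apply: ler_sum => n _.
by rewrite ler_piMl ?powR_ge0// lern1 leq_b1.
Qed.

(* An edge n --> i crosses n0 if n < n0 <= i.  If n0 is nearer to n then n is
   determined by i, and otherwise i is determined by n. *)
Lemma edge_sum_crossing v n0 : (forall n, 0 <= v n) ->
  \sum_(i < k | (n0 <= i)%N) (\sum_(n < k | (n < n0)%N) (edge L n i)%:R * v n) `^ p <=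
  2 `^ p * (L%:R + L%:R `^ (p - 1)) * \sum_(n < k) v n `^ p.
Proof.
move=> v0.
pose P1 n i := [&& edge L n i, (n < n0)%N, (n0 <= i)%N & (n0.*2 <= (n + i).+1)%N].
pose P2 n i := [&& edge L n i, (n < n0)%N, (n0 <= i)%N & ((n + i).+1 < n0.*2)%N].
(* Of two edges with the same end, the longer is at least twice as long, so its midpoint is not
   above the start of the shorter one and hence is below n0, against the definition of [P1]. The
   case of [P2] is symmetric. *)
have pow2 (a b : nat) : (2 ^ a < 2 ^ b)%N -> (2 * 2 ^ a <= 2 ^ b)%N.
  by rewrite ltn_exp2l// -expnS leq_exp2l.
have uniq1 i : \sum_(n < k) (P1 n i)%:R <= 1 :> R.
  apply: (bool_sum_le1 k (fun n => P1 n i)) => n m _ _.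
  wlog nm : n m / (n <= m)%N.
    by move=> h; have [nm|/ltnW nm] := leqP n m => hn hm; [exact: h|exact/esym/h].
  move=> /and4P[/existsP[e /eqP he] nn ni hn] /and4P[/existsP[d /eqP hd] mn mi hm].
  apply/eqP; rewrite eqn_leq nm /= leqNgt; apply/negP => lt.
  have /pow2 : (2 ^ d < 2 ^ e)%N by lia.
  by lia.
have uniq2 n : \sum_(i < k) (P2 n i)%:R <= 1 :> R.
  apply: (bool_sum_le1 k (P2 n)) => i j _ _.
  wlog ij : i j / (i <= j)%N.
    by move=> h; have [ij|/ltnW ij] := leqP i j => hi hj; [exact: h|exact/esym/h].
  move=> /and4P[/existsP[e /eqP he] nn ni hn] /and4P[/existsP[d /eqP hd] mn mi hm].
  apply/eqP; rewrite eqn_leq ij /= leqNgt; apply/negP => lt.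
  have /pow2 : (2 ^ e < 2 ^ d)%N by lia.
  by lia.
have in2 i : \sum_(n < k) (P2 n i)%:R <= L%:R :> R.
  apply: le_trans (edge_in i); apply: ler_sum => n _; rewrite ler_nat.
  by rewrite /P2; case: (edge L n i); rewrite ?leq_b1.
have out1 n : \sum_(i < k) (P1 n i)%:R <= L%:R :> R.
  apply: le_trans (edge_out n); apply: ler_sum => i _; rewrite ler_nat.
  by rewrite /P1; case: (edge L n i); rewrite ?leq_b1.
have vp0 n : 0 <= v n `^ p by exact: powR_ge0.
have s1 : \sum_(i < k) (\sum_(n < k) (P1 n i)%:R * v n) `^ p <= L%:R * \sum_(n < k) v n `^ p.
  apply: (@le_trans _ _ (\sum_(i < k) \sum_(n < k) (P1 n i)%:R * v n `^ p)).
    apply: ler_sum => i _.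
    have h := powR_sum_count R p p1 _ (fun n : 'I_k => P1 n i) (fun n : 'I_k => v n) _ (fun n : 'I_k => v0 n) (uniq1 i).
    by apply: le_trans h _; rewrite powR1 mul1r.
  rewrite exchange_big /= mulr_sumr; apply: ler_sum => n _.
  by rewrite -mulr_suml ler_wpM2r// out1.
have s2 : \sum_(i < k) (\sum_(n < k) (P2 n i)%:R * v n) `^ p <=
    L%:R `^ (p - 1) * \sum_(n < k) v n `^ p.
  apply: (@le_trans _ _ (\sum_(i < k) L%:R `^ (p - 1) * \sum_(n < k) (P2 n i)%:R * v n `^ p)).
    apply: ler_sum => i _.
    exact: (powR_sum_count R p p1 _ (fun n : 'I_k => P2 n i) (fun n : 'I_k => v n) _ (fun n : 'I_k => v0 n) (in2 i)).
  rewrite -mulr_sumr ler_wpM2l ?powR_ge0// exchange_big /=; apply: ler_sum => n _.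
  by rewrite -mulr_suml ler_piMl// uniq2.
rewrite -mulrA mulrDl; apply: le_trans (ler_wpM2l (powR_ge0 2 p) (lerD s1 s2)).
rewrite -big_split /= mulr_sumr big_mkcond; apply: ler_sum => i _.
have t1 : 0 <= \sum_(n < k) (P1 n i)%:R * v n by apply: sumr_ge0 => n _; rewrite mulr_ge0.
have t2 : 0 <= \sum_(n < k) (P2 n i)%:R * v n by apply: sumr_ge0 => n _; rewrite mulr_ge0.
case: ifP => ni; last by rewrite mulr_ge0 ?powR_ge0// addr_ge0 ?powR_ge0.
apply: le_trans (powR_addle _ _ _ _ p0 t1 t2); rewrite -big_split big_mkcond /=.
rewrite ge0_ler_powR ?nnegrE ?(ltW p0)//; try by apply: sumr_ge0 => n _; rewrite ?addr_ge0 ?mulr_ge0//; case: ifP; rewrite ?mulr_ge0.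
apply: ler_sum => n _; rewrite -mulrDl /P1 /P2 ni; case: (ltnP n n0) => nn; last first.
  by rewrite !andbF addr0 mul0r.
rewrite ler_wpM2r//; case: (leqP n0.*2 (n + i).+1) => _; case: (edge L n i);
  by rewrite /= ?addr0 ?add0r.
Qed.

End Edges.

(** * Two copies of l_p^N for p > 1 *)

Lemma modulusV (R : realType) (F : scalarField R) (hF : valued F) (x : F) :
  modulus x^-1 = (modulus x)^-1.
Proof.
have [->|x0] := eqVneq x 0; first by rewrite invr0 (modulus0 R F hF) invr0.
have h : modulus x^-1 * modulus x = 1.
  by rewrite -(modulusM hF) mulVf// (modulus1 R F hF).
by rewrite -[RHS]mul1r -h mulfK//; apply: contra_eq_neq h => ->; rewrite mulr0 eq_sym oner_eq0.
Qed.

Lemma modulus_sum (R : realType) (F : scalarField R) (hF : valued F)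
    (I : finType) (P : pred I) (x : I -> F) :
  modulus (\sum_(i | P i) x i) <= \sum_(i | P i) modulus (x i).
Proof.
elim/big_rec2: _ => [|i y z _ h]; first by rewrite (modulus0 R F hF).
by apply: le_trans (modulusD hF _ _) _; rewrite lerD2l.
Qed.

Lemma modulusX (R : realType) (F : scalarField R) (hF : valued F) (x : F) n :
  modulus (x ^+ n) = modulus x ^+ n.
Proof.
elim: n => [|n IH]; first by rewrite !expr0 (modulus1 R F hF).
by rewrite !exprS (modulusM hF) IH.
Qed.

Lemma powR_exprn (R : realType) (x p : R) n : 0 <= x -> (x ^+ n) `^ p = (x `^ p) ^+ n.
Proof.
by move=> x0; elim: n => [|n IH]; rewrite ?expr0 ?powR1// !exprS powRM ?exprn_ge0// IH.
Qed.

Lemma powR_inv (R : realType) (x p : R) : 0 <= x -> x^-1 `^ p = (x `^ p)^-1.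
Proof. by move=> x0; rewrite -powR_inv1// powRAC powR_inv1// powR_ge0. Qed.

Lemma powR_le_root (R : realType) (x y p : R) : 0 < p -> 0 <= y -> x `^ p <= y `^ p -> x <= y.
Proof.
move=> p0 y0 h; rewrite leNgt; apply/negP => yx.
have x0 : 0 <= x by rewrite (le_trans y0) ?ltW.
by have := gt0_ltr_powR p0 _ _ yx; rewrite !nnegrE => /(_ y0 x0); rewrite ltNge h.
Qed.

(** For r > 1 the least possible C is r / (r - 1). *)
Lemma geometric_sum_le (R : realType) (r C : R) N : 0 <= r -> 0 <= C -> r <= C * (r - 1) ->
  \sum_(n < N) r ^+ n.+1 <= C * r ^+ N.
Proof.
move=> r0 C0 h; elim: N => [|N IH]; first by rewrite big_ord0 expr0 mulr1.
rewrite big_ord_recr /= exprS; have := exprn_ge0 N r0; nra.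
Qed.

Section TwoKinds.
Variables (R : realType) (F : scalarField R) (p : R).
Hypotheses (hF : valued F) (p1 : 1 < p).
Variables (J : finType) (lev : J -> nat) (M L k : nat).
Hypotheses (M2 : (2 <= M)%N) (L1 : (0 < L)%N).
Hypothesis lev_lt : forall j, (lev j < k)%N.
Hypothesis lev_card : forall n, (n < k)%N -> #|[pred j | lev j == n]| = (M ^ n.+1)%N.
Implicit Types (a : J -> F) (v : nat -> R) (n i : nat).

Let p0 : 0 < p. Proof. exact: lt_trans ltr01 p1. Qed.
Let pm0 : 0 < p - 1. Proof. by rewrite subr_gt0. Qed.
Let M0 : (0 : R) < M%:R. Proof. by rewrite ltr0n; lia. Qed.

Let S n : R := M%:R ^+ n.+1.
Let S0 n : 0 < S n. Proof. by rewrite exprn_gt0. Qed.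
Let r : R := M%:R `^ p^-1.
Let r0 : 0 < r. Proof. exact: powR_gt0. Qed.
Let rp : r `^ p = M%:R. Proof. by rewrite /r -powRrM mulVf ?gt_eqF// powRr1// ltW. Qed.
Let rS n : (r ^+ n.+1) `^ p = S n. Proof. by rewrite powR_exprn ?(ltW r0)// rp. Qed.
Let g : F := of_real F r.
Let gE : modulus g = r. Proof. by rewrite (modulus_of_real hF)// ltW. Qed.
Let g0 : g != 0.
Proof. by apply/eqP => e; move: gE; rewrite e (modulus0 R F hF) => h; move: r0; rewrite -h ltxx. Qed.
(** The largest scale at which the edge estimates with constants L and L ^ (p - 1) are both bounded
    by 1, while th * L ^ p = L ^ min(1, p - 1) still tends to infinity. *)
Let th : R := (L%:R `^ (Num.max (p - 1) 1))^-1.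
Let th0 : 0 <= th. Proof. by rewrite invr_ge0 powR_ge0. Qed.
Let LR1 : (1 : R) <= L%:R. Proof. by rewrite ler1n. Qed.
Let LR0 : (0 : R) < L%:R. Proof. exact: lt_le_trans ltr01 LR1. Qed.
Let thL : th * L%:R <= 1.
Proof.
rewrite mulrC ler_pdivrMr ?powR_gt0// mul1r -[leLHS]powRr1 ?(ltW LR0)//.
by apply: ler_powR => //; rewrite le_max lexx orbT.
Qed.
Let thLp : th * L%:R `^ (p - 1) <= 1.
Proof.
rewrite mulrC ler_pdivrMr ?powR_gt0// mul1r.
by apply: ler_powR => //; rewrite le_max lexx.
Qed.
Let kap : F := of_real F (th `^ p^-1).
Let kapE : modulus kap `^ p = th.
Proof. by rewrite (modulus_of_real hF) ?powR_ge0// -powRrM mulVf ?gt_eqF// powRr1. Qed.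

Let sqrtK (x : R) : 0 <= x -> (x `^ p^-1) `^ p = x.
Proof. by move=> x0; rewrite -powRrM mulVf ?gt_eqF// powRr1. Qed.

(** The modulus of g ^ n.+1 is the p-th root of the size of level n. With this normalization a
    vector that is constant on the level has an average of modulus equal to its l_p norm there, and
    [level_mix] spreads a number back over a level with the same l_p norm, up to kap. *)
Definition level_avg a n : F :=
  g ^+ n.+1 / (M ^ n.+1)%:R * \sum_(j | lev j == n) a j.
Definition level_mix a j : F :=
  kap / g ^+ (lev j).+1 * \sum_(n < k | edge L n (lev j)) level_avg a n.
Definition two_kinds_op (b : J + J -> F) (x : J + J) : F :=
  match x with
  | inl j => b (inl j)
  | inr j => b (inr j) + level_mix (b \o inl) j
  end.
Local Notation V := level_avg.
Local Notation W := level_mix.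
Local Notation u := two_kinds_op.

Let mass a : R := fmass R F p J a.
Let mu n a : R := \sum_(j | lev j == n) modulus (a j) `^ p.

Let modp_ge0 (x : F) : 0 <= modulus x `^ p. Proof. exact: powR_ge0. Qed.
Let mod_ge0 (x : F) : 0 <= modulus x. Proof. exact: modulus_ge0. Qed.

Let addp (x y : F) : modulus (x + y) `^ p <= 2 `^ p * (modulus x `^ p + modulus y `^ p).
Proof.
apply: le_trans (powR_addle _ _ _ _ p0 (mod_ge0 x) (mod_ge0 y)).
by rewrite ge0_ler_powR ?nnegrE ?addr_ge0 ?(ltW p0)//; exact: (modulusD hF).
Qed.

Let lev_sum (P : pred nat) (h : nat -> R) :
  \sum_(j | P (lev j)) h (lev j) = \sum_(i < k | P i) S i * h i.
Proof.
rewrite (partition_big (fun j => Ordinal (lev_lt j)) (fun i : 'I_k => P i))//=.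
apply: eq_bigr => i Pi; rewrite (eq_bigl (fun j => lev j == i)); last first.
  move=> j; rewrite -val_eqE /=; case: eqP => [->|]; by rewrite ?Pi ?andbF.
rewrite (eq_bigr (fun=> h i)); last by move=> j /eqP ->.
by rewrite sumr_const lev_card// -mulr_natl natrX.
Qed.

Let mu_sum a : \sum_(n < k) mu n a = mass a.
Proof.
rewrite /mass /fmass (partition_big (fun j => Ordinal (lev_lt j)) xpredT)//=.
Qed.

Let mu_ge0 n a : 0 <= mu n a. Proof. by apply: sumr_ge0. Qed.

Let mu_le n a : (n < k)%N -> mu n a <= mass a.
Proof.
move=> nk; rewrite -mu_sum (bigD1 (Ordinal nk))//= lerDl sumr_ge0//.
Qed.

Let V_le a n : modulus (V a n) <= r ^+ n.+1 / S n * \sum_(j | lev j == n) modulus (a j).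
Proof.
rewrite /V !(modulusM hF) (modulusV R F hF) (modulusX R F hF) gE (modulus_nat hF) natrX.
rewrite ler_wpM2l ?(modulus_sum R F hF)// mulr_ge0 ?exprn_ge0 ?invr_ge0 ?(ltW r0)//.
Qed.

Let Vp_le a n (A : pred J) (m : R) : (forall j, ~~ A j -> a j = 0) ->
  \sum_j (A j && (lev j == n))%:R <= m ->
  modulus (V a n) `^ p <= S n * (S n)^-1 `^ p * (m `^ (p - 1) * mu n a).
Proof.
move=> hA hm.
have e : \sum_(j | lev j == n) modulus (a j) = \sum_j (A j && (lev j == n))%:R * modulus (a j).
  rewrite big_mkcond; apply: eq_bigr => j _; case: (boolP (A j)) => [Aj|/hA ->] /=.
    by case: (lev j == n); rewrite ?mul1r ?mul0r.
  by rewrite (modulus0 R F hF) mul0r if_same.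
have e' : \sum_j (A j && (lev j == n))%:R * modulus (a j) `^ p <= mu n a.
  rewrite /mu [leRHS]big_mkcond; apply: ler_sum => j _.
  by case: (lev j == n); case: (A j); rewrite ?mul1r ?mul0r.
have Si : 0 <= (S n)^-1 by rewrite invr_ge0 ltW.
have h := V_le a n; rewrite e in h.
apply: le_trans (ge0_ler_powR (ltW p0) _ _ h) _; rewrite ?nnegrE//.
  by rewrite mulr_ge0 ?sumr_ge0// ?mulr_ge0 ?exprn_ge0 ?(ltW r0)// => j _; rewrite mulr_ge0.
rewrite !powRM ?mulr_ge0 ?exprn_ge0 ?(ltW r0)//; last first.
  by apply: sumr_ge0 => j _; rewrite mulr_ge0.
rewrite rS ler_wpM2l ?mulr_ge0 ?powR_ge0 ?(ltW (S0 n))//.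
apply: le_trans (powR_sum_count R p p1 J (fun j => A j && (lev j == n)) _ m (fun j => mod_ge0 (a j)) hm) _.
by rewrite ler_wpM2l ?powR_ge0.
Qed.

Let SnV n : S n * (S n)^-1 `^ p * S n `^ (p - 1) = 1.
Proof.
have s0 := ltW (S0 n).
rewrite mulrAC mulr_powRB1// -powRM ?invr_ge0// divff ?powR1//.
by rewrite gt_eqF.
Qed.

Let V_mu a n : (n < k)%N -> modulus (V a n) `^ p <= mu n a.
Proof.
move=> nk; have h : \sum_j (predT j && (lev j == n))%:R <= S n.
  rewrite -natr_sum /S -natrX ler_nat -(lev_card n nk) -sum1_card [leqRHS]big_mkcond /=.
  by apply: leq_sum => j _; rewrite inE; case: (lev j == n).
apply: le_trans (Vp_le a n predT (S n) _ h) _; first by [].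
by rewrite mulrA SnV mul1r.
Qed.

Let V_bounded a n t : (n < k)%N -> (forall j, modulus (a j) <= t) ->
  modulus (V a n) <= r ^+ n.+1 * t.
Proof.
move=> nk at'; apply: le_trans (V_le a n) _; rewrite -mulrA ler_wpM2l ?exprn_ge0 ?(ltW r0)//.
rewrite mulrC ler_pdivrMr//; apply: (@le_trans _ _ (\sum_(j | lev j == n) t)).
  by apply: ler_sum => j _.
by rewrite sumr_const lev_card// -mulr_natr natrX.
Qed.

Let W_le a v j : (forall n, (n < k)%N -> edge L n (lev j) -> modulus (V a n) <= v n) ->
  modulus (W a j) `^ p <= th * (S (lev j))^-1 * edge_sum R L k v (lev j) `^ p.
Proof.
move=> hv; rewrite /W !(modulusM hF) (modulusV R F hF) (modulusX R F hF) gE.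
have r1 : 0 <= (r ^+ (lev j).+1)^-1 by rewrite invr_ge0 exprn_ge0 ?(ltW r0).
rewrite !powRM ?mulr_ge0// kapE.
have -> : (r ^+ (lev j).+1)^-1 `^ p = (S (lev j))^-1.
  by rewrite powR_inv ?exprn_ge0 ?(ltW r0)// rS.
rewrite ler_wpM2l ?mulr_ge0 ?invr_ge0 ?(ltW (S0 _))//.
have le : modulus (\sum_(n < k | edge L n (lev j)) V a n) <=
    \sum_(n < k) (edge L n (lev j))%:R * modulus (V a n).
  apply: le_trans (modulus_sum R F hF _ _ _) _; rewrite big_mkcond; apply: ler_sum => n _.
  by case: (edge _ _ _); rewrite ?mul1r ?mul0r.
have le2 : \sum_(n < k) (edge L n (lev j))%:R * modulus (V a n) <= edge_sum R L k v (lev j).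
  apply: ler_sum => n _; case: (boolP (edge L n (lev j))) => h; last by rewrite !mul0r.
  by rewrite !mul1r hv.
rewrite ge0_ler_powR ?nnegrE ?(ltW p0)//; last exact: le_trans le le2.
exact: le_trans (mod_ge0 _) (le_trans le le2).
Qed.

(** An l_1 bound on the averages controls W in l_p, because th * L <= 1. *)
Let W_sum a v (P : pred nat) : (forall n, 0 <= v n) ->
  (forall n i, (n < k)%N -> P i -> edge L n i -> modulus (V a n) <= v n) ->
  \sum_(j | P (lev j)) modulus (W a j) `^ p <= (\sum_(n < k) v n) `^ p.
Proof.
move=> v0 hv.
apply: (@le_trans _ _ (\sum_(j | P (lev j)) th * (S (lev j))^-1 * edge_sum R L k v (lev j) `^ p)).
  by apply: ler_sum => j Pj; apply: W_le => n nk; exact: hv.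
rewrite (lev_sum P (fun i => th * (S i)^-1 * edge_sum R L k v i `^ p)).
apply: (@le_trans _ _ (th * \sum_(i < k) edge_sum R L k v i `^ p)).
  rewrite mulr_sumr big_mkcond; apply: ler_sum => i _; case: ifP => _; last by rewrite mulr_ge0 ?powR_ge0.
  by rewrite mulrA mulrCA divff ?mulr1// gt_eqF.
apply: (@le_trans _ _ (th * (L%:R * (\sum_(n < k) v n) `^ p))).
  by rewrite ler_wpM2l// edge_sum_l1.
by rewrite mulrA ler_piMl ?powR_ge0.
Qed.

(** Single entries of W a are small on large levels; here th * L ^ (p - 1) <= 1 is used. *)
Let W_row a j : modulus (W a j) `^ p <= (S (lev j))^-1 * mass a.
Proof.
have Si : 0 <= (S (lev j))^-1 by rewrite invr_ge0 ltW.
apply: le_trans (W_le a (fun n => modulus (V a n)) j (fun _ _ _ => lexx _)) _.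
rewrite mulrAC mulrC ler_wpM2l//.
apply: (@le_trans _ _ (th * (L%:R `^ (p - 1) * \sum_(n < k) modulus (V a n) `^ p))).
  by rewrite ler_wpM2l// edge_sum_row.
rewrite mulrA; apply: (@le_trans _ _ (\sum_(n < k) modulus (V a n) `^ p)).
  by rewrite ler_piMl// sumr_ge0.
by rewrite -mu_sum; apply: ler_sum => n _; exact: V_mu.
Qed.

Let WD a a' j : W (fun i : J => a i + a' i) j = W a j + W a' j.
Proof.
rewrite /W -mulrDr -big_split /=; congr (_ * _); apply: eq_bigr => n _.
by rewrite /V -mulrDr -big_split.
Qed.

Let WZ (c : F) a j : W (fun i : J => c * a i) j = c * W a j.
Proof.
rewrite /W [RHS]mulrCA; congr (_ * _); rewrite mulr_sumr; apply: eq_bigr => n _.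
by rewrite /V [RHS]mulrCA; congr (_ * _); rewrite mulr_sumr.
Qed.

Let W_cut (A : pred J) a j : W a j = W (cut_to R F J A a) j + W (cut_to R F J (predC A) a) j.
Proof.
rewrite -WD; congr (W _ j); apply/funext => i; rewrite /cut_to /=.
by case: (A i); rewrite ?addr0 ?add0r.
Qed.

Let cut_mass A a : mass (cut_to R F J A a) <= mass a.
Proof.
apply: ler_sum => j _; rewrite /cut_to; case: (A j) => //.
by rewrite (modulus0 R F hF) powR0 ?gt_eqF.
Qed.

(** The bound for geometric sums of ratio r >= 2 ^ (1 / p); it does not depend on M. *)
Let Cg : R := 2 `^ p^-1 / (2 `^ p^-1 - 1).
Let Cg0 : 0 <= Cg.
Proof.
rewrite divr_ge0 ?powR_ge0// subr_ge0 -[X in X <= _](powRr0 2).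
by apply: ler_powR; rewrite ?ler1n// invr_ge0 ltW.
Qed.
Let Cgr : r <= Cg * (r - 1).
Proof.
have a1 : 1 < 2 `^ p^-1 :> R.
  have e : (1 : R) = 1 `^ p^-1 by rewrite powR1.
  by rewrite [ltLHS]e gt0_ltr_powR ?invr_gt0 ?nnegrE ?ltr1n.
have a2 : 2 `^ p^-1 <= r.
  by rewrite ge0_ler_powR ?invr_ge0 ?(ltW p0) ?nnegrE ?ler_nat// ltW.
rewrite /Cg mulrAC ler_pdivlMr ?subr_gt0//; nra.
Qed.

Let cutoff (P : nat -> bool) : (forall m n, (m <= n)%N -> P n -> P m) ->
  exists n0, forall n, (n < k)%N -> P n = (n < n0)%N.
Proof.
move=> mono; elim: k => [|l [n0 IH]]; first by exists 0%N.
case: (boolP (P l)) => Pl.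
  by exists l.+1 => n nl; rewrite nl; apply: mono Pl.
exists (minn n0 l) => n; rewrite ltnS leq_eqVlt => /orP[/eqP ->|nl].
  by rewrite (negbTE Pl) leq_min ltnn andbF.
by rewrite IH// leq_min nl andbT.
Qed.

(** The sum is dominated by its last term, which the hypothesis bounds at the last level below
    n0. *)
Let low_geometric n0 t Y : 0 <= t -> 0 <= Y -> (forall n, (n < k)%N -> (n < n0)%N -> S n * t `^ p <= Y) ->
  \sum_(n < k | (n < n0)%N) r ^+ n.+1 * t <= Cg * Y `^ p^-1.
Proof.
move=> t0 Y0 h; pose N := minn n0 k.
have -> : \sum_(n < k | (n < n0)%N) r ^+ n.+1 * t = (\sum_(n < N) r ^+ n.+1) * t.
  rewrite mulr_suml (big_ord_widen_cond k xpredT (fun n => r ^+ n.+1 * t)) ?geq_minr//.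
  by apply: eq_bigl => n; rewrite /N leq_min ltn_ord andbT.
case EN : N => [|m]; first by rewrite big_ord0 mul0r mulr_ge0 ?powR_ge0.
have : (m < N)%N by rewrite EN.
rewrite leq_min => /andP[mn mk].
apply: (@le_trans _ _ (Cg * (r ^+ m.+1 * t))).
  by rewrite mulrA ler_wpM2r//; apply: geometric_sum_le => //; exact: ltW.
rewrite ler_wpM2l//; apply: (powR_le_root _ _ _ _ p0); rewrite ?powR_ge0//.
by rewrite sqrtK// powRM ?exprn_ge0 ?(ltW r0)// rS h.
Qed.

Let low_count n0 T Y : 0 <= T -> 0 <= Y -> (forall n, (n < k)%N -> (n < n0)%N -> S n * T <= Y) ->
  \sum_(j | (lev j < n0)%N) T <= 2 * Y.
Proof.
move=> T0 Y0 h; rewrite (lev_sum (fun i => (i < n0)%N) (fun=> T)); pose N := minn n0 k.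
have -> : \sum_(n < k | (n < n0)%N) S n * T = (\sum_(n < N) M%:R ^+ n.+1) * T.
  rewrite mulr_suml (big_ord_widen_cond k xpredT (fun n => M%:R ^+ n.+1 * T)) ?geq_minr//.
  by apply: eq_bigl => n; rewrite /N leq_min ltn_ord andbT.
case EN : N => [|m]; first by rewrite big_ord0 mul0r mulr_ge0.
have : (m < N)%N by rewrite EN.
rewrite leq_min => /andP[mn mk].
apply: (@le_trans _ _ (2 * (S m * T))).
  rewrite mulrA ler_wpM2r//; apply: geometric_sum_le => //.
  have : (2 : R) <= M%:R by rewrite ler_nat.
  lra.
by rewrite ler_wpM2l// h.
Qed.

Let P2 : R := 2 `^ p.
Let P21 : 1 <= P2.
Proof.
have e : (1 : R) = 2 `^ 0 by rewrite powRr0.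
by rewrite [leLHS]e; apply: ler_powR; rewrite ?ler1n// ltW.
Qed.

Let fB b j := b (inr j) + W (b \o inl) j.
Let fmassE b : fmass R F p _ (u b) =
  mass (b \o inl) + \sum_j modulus (b (inr j) + W (b \o inl) j) `^ p.
Proof. by rewrite /fmass big_sumType. Qed.

Let massA_le b : mass (b \o inl) <= fmass R F p _ (u b).
Proof. by rewrite fmassE lerDl sumr_ge0. Qed.

Let sumB_le b : \sum_j modulus (fB b j) `^ p <= fmass R F p _ (u b).
Proof. by rewrite fmassE lerDr sumr_ge0. Qed.

(* Above the levels of size at most 2 ^ p * tau / t ^ p, the entries of W a are
   smaller than t / 2. *)
Let high_coord b t n0 j : 0 <= t ->
  (forall n, (n < k)%N -> (n < n0)%N = (S n * t `^ p <= P2 * fmass R F p _ (u b))) ->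
  ~~ (lev j < n0)%N -> t <= modulus (b (inr j)) ->
  modulus (b (inr j)) `^ p <= P2 * modulus (fB b j) `^ p.
Proof.
move=> t0 hn0 hj tj; rewrite -powRM//.
apply: ge0_ler_powR; rewrite ?nnegrE ?mulr_ge0 ?(ltW p0)//.
suff : 2 * modulus (W (b \o inl) j) <= t.
  have : modulus (b (inr j)) <= modulus (fB b j) + modulus (W (b \o inl) j).
    rewrite -(modulusN R F hF (W _ j)); apply: le_trans (modulusD hF _ _).
    by rewrite /fB addrK.
  lra.
apply: (powR_le_root _ _ _ _ p0) => //; rewrite powRM//.
move: hj; rewrite hn0// -ltNge => hj.
have : modulus (W (b \o inl) j) `^ p <= (S (lev j))^-1 * fmass R F p _ (u b).
  by apply: le_trans (W_row _ _) _; rewrite ler_wpM2l ?invr_ge0 ?(ltW (S0 _)).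
rewrite mulrC ler_pdivlMr// -/P2 => h1.
have h2 : P2 * (modulus (W (b \o inl) j) `^ p * S (lev j)) <= P2 * fmass R F p _ (u b).
  by rewrite ler_wpM2l ?powR_ge0.
rewrite -(ler_pM2r (S0 (lev j))) -mulrA; apply: le_trans h2 _.
by rewrite [leRHS]mulrC; exact: ltW.
Qed.

Let level_cut b t : 0 < t -> exists n0, forall n, (n < k)%N ->
  (n < n0)%N = (S n * t `^ p <= P2 * fmass R F p _ (u b)).
Proof.
move=> t0.
case: (cutoff (fun n => S n * t `^ p <= P2 * fmass R F p _ (u b))) => [m n mn h|n0 h].
  apply: le_trans h; rewrite ler_wpM2r ?powR_ge0// ler_weXn2l//.
  by rewrite ler1n ltnW.
by exists n0 => n nk; rewrite h.
Qed.

(** On the second copy, levels below the cut n0 have too few coordinates to matter, by [low_count],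
    and above it [high_coord] compares b with the entries of u b. *)
Lemma two_kinds_lower (b : J + J -> F) (t : R) (G : pred (J + J)) : 0 <= t ->
  (forall x, G x -> t <= modulus (b x)) ->
  t `^ p * #|G|%:R <= (1 + P2 + 2 * P2) * fmass R F p _ (u b).
Proof.
move=> t0 hG; have tau0 := fmass_ge0 R F p _ (u b).
have [->|tn] := eqVneq t 0.
  by rewrite powR0 ?gt_eqF// mul0r mulr_ge0// ?addr_ge0 ?mulr_ge0 ?powR_ge0.
have [|n0 hn0] := level_cut b t; first by rewrite lt_neqAle eq_sym tn.
have -> : t `^ p * #|G|%:R = \sum_(x | G x) t `^ p by rewrite sumr_const mulr_natr.
rewrite big_mkcond big_sumType /= mulrDl mulrDl mul1r -addrA.
apply: lerD.
  apply: le_trans (massA_le b); apply: ler_sum => j _; case: ifP => Gj //.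
  by rewrite ge0_ler_powR ?nnegrE ?(ltW p0)// hG.
have lc : \sum_(j | (lev j < n0)%N) t `^ p <= 2 * (P2 * fmass R F p _ (u b)).
  apply: low_count; rewrite ?mulr_ge0 ?powR_ge0// => n nk.
  by rewrite hn0.
rewrite -mulrA; apply: le_trans (lerD (ler_wpM2l (powR_ge0 2 p) (sumB_le b)) lc).
rewrite mulr_sumr [X in _ + X]big_mkcond -big_split /=; apply: ler_sum => j _.
case: ifP => Gj; last first.
  by rewrite addr_ge0 ?mulr_ge0 ?powR_ge0//; case: ifP => _; rewrite ?powR_ge0.
case: ifP => lj; first by rewrite lerDr mulr_ge0 ?powR_ge0.
rewrite addr0; apply: le_trans (high_coord b t n0 j t0 hn0 _ (hG _ Gj)); last by rewrite lj.
by rewrite ge0_ler_powR ?nnegrE ?(ltW p0)// hG.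
Qed.


Let Cgp : R := Cg `^ p.

(** Averages from levels below n0 arrive through edges crossing n0. On the levels above, the nonzero
    entries of a are at least t, which makes the averages summable: with z = y ^ (1 / p), z ^ (p -
    1) times the average on level n is at most [mu n a]. *)
Let W_high a t n0 y : 0 < t -> 0 <= y -> mass a <= y ->
  (forall n, (n < k)%N -> ~~ (n < n0)%N -> y <= S n * t `^ p) ->
  (forall j, a j != 0 -> t <= modulus (a j)) ->
  \sum_(j | ~~ (lev j < n0)%N) modulus (W a j) `^ p <= P2 * (P2 * 2 + 1) * y.
Proof.
move=> t0 y0 ay hn0 ha.
pose v n := modulus (V a n); have v0 n : 0 <= v n by exact: mod_ge0.
pose v' n := (~~ (n < n0)%N && (n < k)%N)%:R * v n.
have v'0 n : 0 <= v' n by rewrite mulr_ge0.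
pose X i := \sum_(n < k | (n < n0)%N) (edge L n i)%:R * v n.
have X0 i : 0 <= X i by apply: sumr_ge0 => n _; rewrite mulr_ge0.
have E0 i : 0 <= edge_sum R L k v' i by apply: sumr_ge0 => n _; rewrite mulr_ge0.
have split_sum i : edge_sum R L k v i <= X i + edge_sum R L k v' i.
  rewrite /edge_sum (bigID (fun n : 'I_k => (n < n0)%N)) /= lerD2l.
  rewrite big_mkcond; apply: ler_sum => n _; rewrite /v' ltn_ord andbT.
  by case: ifP => nn; rewrite ?mul1r// ?mulr_ge0.
have vsum : \sum_(n < k) v n `^ p <= y.
  by apply: le_trans ay; rewrite -mu_sum; apply: ler_sum => n _; exact: V_mu.
have v'sum : (\sum_(n < k) v' n) `^ p <= y.
  pose z := y `^ p^-1; have z0 : 0 <= z by exact: powR_ge0.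
  have zp : z `^ p = y by exact: sqrtK.
  rewrite -zp; apply: ge0_ler_powR; rewrite ?nnegrE ?(ltW p0) ?sumr_ge0//.
  have [zz|zn] := eqVneq z 0.
    have y00 : y = 0 by rewrite -zp zz powR0// gt_eqF.
    rewrite zz big1// => n _; rewrite /v'; suff -> : v n = 0 by rewrite mulr0.
    have h : v n `^ p <= 0.
      by apply: le_trans (V_mu _ _ (ltn_ord n)) _; rewrite -y00; exact: le_trans (mu_le _ _ (ltn_ord n)) ay.
    by apply: (@powR_eq0_eq0 _ _ p); apply: le_anti; rewrite h powR_ge0.
  have zp0 : 0 < z by rewrite lt_neqAle eq_sym zn.
  rewrite -(ler_pM2l (powR_gt0 (p - 1) zp0)) [leRHS]mulrC mulr_powRB1// zp mulr_sumr.
  apply: le_trans ay; rewrite -mu_sum; apply: ler_sum => n _.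
  rewrite /v' ltn_ord andbT; case: (boolP (n < n0)%N) => nn; first by rewrite mul0r mulr0.
  rewrite mul1r; apply: le_trans (ler_wpM2l (powR_ge0 _ _) (V_le a n)) _.
  pose Z := r ^+ n.+1 * t; have Z0 : 0 < Z by rewrite mulr_gt0// exprn_gt0.
  have Zp : Z `^ p = S n * t `^ p by rewrite powRM ?exprn_ge0 ?(ltW r0) ?(ltW t0)// rS.
  have zZ : z <= Z by apply: (powR_le_root _ _ _ _ p0); rewrite ?(ltW Z0)// zp Zp hn0.
  have sum_le : t `^ (p - 1) * \sum_(j | lev j == n) modulus (a j) <= mu n a.
    rewrite mulr_sumr; apply: ler_sum => j _.
    have [->|aj] := eqVneq (a j) 0; first by rewrite (modulus0 R F hF) mulr0 powR_ge0.
    rewrite -(mulr_powRB1 (mod_ge0 (a j)) p0) mulrC ler_wpM2l//.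
    by rewrite ge0_ler_powR ?nnegrE ?(ltW pm0) ?(ltW t0)// ha.
  apply: le_trans (ler_wpM2r _ (ge0_ler_powR (ltW pm0) _ _ zZ)) _; rewrite ?nnegrE ?(ltW Z0)//.
    by rewrite mulr_ge0 ?sumr_ge0// mulr_ge0 ?exprn_ge0 ?invr_ge0 ?(ltW r0) ?(ltW (S0 n)).
  apply: le_trans sum_le; rewrite mulrA ler_wpM2r ?sumr_ge0//.
  rewrite /Z powRM ?exprn_ge0 ?(ltW r0) ?(ltW t0)//.
  rewrite mulrAC mulrA [_ `^ _ * r ^+ _]mulrC mulr_powRB1 ?exprn_ge0 ?(ltW r0)//.
  by rewrite rS divff ?mul1r// gt_eqF.
apply: (@le_trans _ _ (\sum_(j | ~~ (lev j < n0)%N)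
    th * (S (lev j))^-1 * (P2 * (X (lev j) `^ p + edge_sum R L k v' (lev j) `^ p)))).
  apply: ler_sum => j _; apply: le_trans (W_le a v j (fun _ _ _ => lexx _)) _.
  rewrite ler_wpM2l ?mulr_ge0 ?invr_ge0 ?(ltW (S0 _))//.
  apply: le_trans (powR_addle _ _ _ _ p0 (X0 _) (E0 _)).
  rewrite ge0_ler_powR ?nnegrE ?addr_ge0 ?(ltW p0)//.
  by apply: sumr_ge0 => n _; rewrite mulr_ge0.
rewrite (lev_sum (fun i => ~~ (i < n0)%N) (fun i => th * (S i)^-1 * (P2 * (X i `^ p + edge_sum R L k v' i `^ p)))).
apply: (@le_trans _ _ (P2 * (th * \sum_(i < k | (n0 <= i)%N) X i `^ p +
    th * \sum_(i < k) edge_sum R L k v' i `^ p))).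
  rewrite -mulrDr mulrCA [X in _ * (X + _)]big_mkcond -big_split /= [X in _ <= th * X]mulr_sumr mulr_sumr.
  rewrite big_mkcond; apply: ler_sum => i _; rewrite -leqNgt; case: ifP => _; last first.
    by rewrite add0r mulr_ge0// mulr_ge0 ?powR_ge0.
  by rewrite mulrA [S i * _]mulrCA divff ?mulr1 ?gt_eqF.
rewrite -mulrA ler_wpM2l ?powR_ge0// mulrDl mul1r lerD//; last first.
  apply: le_trans v'sum; apply: (@le_trans _ _ (th * (L%:R * (\sum_(n < k) v' n) `^ p))).
    by rewrite ler_wpM2l// edge_sum_l1.
  by rewrite mulrA ler_piMl ?powR_ge0.
have cr := edge_sum_crossing R p p1 L k v n0 v0.
apply: le_trans (ler_wpM2l th0 cr) _; rewrite mulrA.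
apply: ler_pM => //; first by rewrite !mulr_ge0 ?addr_ge0 ?powR_ge0// ltW.
  by apply: sumr_ge0 => n _; exact: powR_ge0.
rewrite mulrCA ler_wpM2l ?powR_ge0// mulrDr.
by rewrite -[leRHS]/(1 + 1) lerD.
Qed.

(** Edges lead to higher levels, so only averages from levels below n0 contribute, and these are
    dominated by a geometric sequence. *)
Let W_low a t n0 Y : 0 <= t -> 0 <= Y ->
  (forall n, (n < k)%N -> (n < n0)%N -> S n * t `^ p <= Y) ->
  (forall j, modulus (a j) <= t) ->
  \sum_(j | (lev j < n0)%N) modulus (W a j) `^ p <= Cgp * Y.
Proof.
move=> t0 Y0 h ha.
pose v n := (n < n0)%N%:R * (r ^+ n.+1 * t).
have v0 n : 0 <= v n by rewrite !mulr_ge0// exprn_ge0// ltW.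
apply: (@le_trans _ _ ((\sum_(n < k) v n) `^ p)).
  apply: (W_sum a v (fun i => (i < n0)%N) v0) => n i nk ni /edge_lt lt; rewrite /v (ltn_trans lt ni) mul1r.
  exact: V_bounded.
have -> : Cgp * Y = (Cg * Y `^ p^-1) `^ p by rewrite powRM ?powR_ge0// sqrtK.
apply: ge0_ler_powR; rewrite ?nnegrE; [exact: ltW|by apply: sumr_ge0|by rewrite mulr_ge0 ?powR_ge0|].
apply: le_trans (low_geometric n0 t Y t0 Y0 h); rewrite [leRHS]big_mkcond.
by apply: ler_sum => n _; rewrite /v; case: (n < n0)%N; rewrite ?mul1r ?mul0r.
Qed.

Let cut_inl (G : pred (J + J)) (b : J + J -> F) : cut_to R F (J + J)%type G b \o inl = cut_to R F J (G \o inl) (b \o inl).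
Proof. by []. Qed.

(** Above the cut n0 the part of b on G is estimated directly, its coefficients being at least t.
    Below n0 its entries are those of u b minus those of the complementary part, whose coefficients
    are at most t. *)
Lemma two_kinds_quasi_greedy (b : J + J -> F) (t : R) (G : pred (J + J)) :
  (forall x, G x -> t <= modulus (b x)) -> (forall x, ~~ G x -> modulus (b x) <= t) ->
  fmass R F p _ (u (cut_to R F (J + J)%type G b)) <=
  (1 + P2 * P2 + P2 * (P2 * (P2 * 2 + 1)) + P2 * (P2 * (2 * P2 + Cgp * P2))) * fmass R F p _ (u b).
Proof.
move=> hG hnG; set tau := fmass R F p _ (u b).
have tau0 : 0 <= tau by exact: fmass_ge0.
have P20 : 0 <= P2 by exact: powR_ge0.
have Cgp0 : 0 <= Cgp by exact: powR_ge0.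
have [t0|t0] := leP t 0.
  have -> : cut_to R F (J + J)%type G b = b.
    apply/funext => x; rewrite /cut_to; case: (boolP (G x)) => // /hnG h.
    by apply/esym/(modulus0_eq0 hF)/le_anti; rewrite mod_ge0 andbT (le_trans h).
  rewrite -/tau ler_peMl// -!addrA lerDl.
  by rewrite ?addr_ge0 ?mulr_ge0 ?addr_ge0 ?mulr_ge0.
have [n0 hn0] := level_cut b t t0; rewrite -/tau in hn0.
have t0' := ltW t0.
pose a := b \o inl; pose aG := cut_to R F J (G \o inl) a.
pose aC := cut_to R F J (predC (G \o inl)) a.
have aGt : mass aG <= tau by apply: le_trans (cut_mass _ _) _; exact: massA_le.
have hi : \sum_(j | ~~ (lev j < n0)%N) modulus (W aG j) `^ p <= P2 * (P2 * 2 + 1) * tau.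
  apply: (W_high aG t) => //.
    move=> n nk; rewrite hn0// -ltNge => /ltW; apply: le_trans.
    by rewrite ler_peMl.
  move=> j; rewrite /aG /cut_to; case: ifP => [Gj _|_]; last by rewrite eqxx.
  exact: hG.
have lo : \sum_(j | (lev j < n0)%N) modulus (W aC j) `^ p <= Cgp * (P2 * tau).
  apply: (W_low aC t) => //; first by rewrite mulr_ge0.
    by move=> n nk; rewrite hn0.
  move=> j; rewrite /aC /cut_to /=; case: ifP => [Gj|_]; last by rewrite (modulus0 R F hF).
  exact: hnG.
have lc : \sum_(j | (lev j < n0)%N) t `^ p <= 2 * (P2 * tau).
  apply: low_count; rewrite ?mulr_ge0 ?powR_ge0// => n nk.
  by rewrite hn0.
rewrite fmassE cut_inl -/a -/aG.
apply: (@le_trans _ _ (tau + (P2 * P2 * tau + P2 * (P2 * (P2 * 2 + 1) * tau) +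
   P2 * (P2 * (2 * (P2 * tau) + Cgp * (P2 * tau)))))); last by lra.
rewrite lerD//.
apply: le_trans (lerD (lerD (ler_wpM2l (mulr_ge0 P20 P20) (sumB_le b)) (ler_wpM2l P20 hi))
  (ler_wpM2l P20 (ler_wpM2l P20 (lerD lc lo)))).
rewrite [X in _ <= _ + _ * X + _]big_mkcond -[X in _ * (_ * X)]big_split /=.
rewrite [X in _ * (_ * X)]big_mkcond !mulr_sumr -!big_split /=.
apply: ler_sum => j _; rewrite {1}/cut_to.
have fb0 : 0 <= modulus (fB b j) `^ p by [].
have w0 : 0 <= modulus (W aG j) `^ p by [].
have T0 : 0 <= t `^ p by exact: powR_ge0.
case: (boolP (lev j < n0)%N) => lj; last first.
  rewrite /= !mulr0 addr0 -mulrA -mulrDr.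
  apply: le_trans (addp _ _) _; rewrite -/P2 ler_wpM2l// lerD2r.
  case: (boolP (G (inr j))) => Gj; last by rewrite (modulus0 R F hF) powR0 ?gt_eqF// mulr_ge0.
  exact: (high_coord b t n0 j t0' hn0 lj (hG _ Gj)).
rewrite /= mulr0 addr0 -mulrA -mulrDr.
have -> : (if G (inr j) then b (inr j) else 0) + W aG j =
    fB b j - ((if G (inr j) then 0 else b (inr j)) + W aC j).
  rewrite /fB (W_cut (G \o inl) a j) -/aG -/aC.
  case: (G (inr j)); first by rewrite add0r addrA addrK.
  by ring.
apply: le_trans (addp _ _) _; rewrite -/P2 ler_wpM2l// (modulusN R F hF).
rewrite lerD ?ler_peMl//; apply: le_trans (addp _ _) _; rewrite -/P2 ler_wpM2l// lerD2r.
case: (boolP (G (inr j))) => Gj; first by rewrite (modulus0 R F hF) powR0 ?gt_eqF.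
by rewrite ge0_ler_powR ?nnegrE ?(ltW p0)// hnG.
Qed.


Let predJ_sum (A : pred J) : \sum_(n < k) \sum_j (A j && (lev j == n))%:R = \sum_j (A j)%:R :> R.
Proof.
rewrite exchange_big /=; apply: eq_bigr => j _; rewrite (bigD1 (Ordinal (lev_lt j)))//= eqxx andbT.
rewrite big1 ?addr0// => n nj; case: eqP => [e|]; last by rewrite andbF.
by move: nj; rewrite -val_eqE /= e eqxx.
Qed.

Let card_sum (G : pred (J + J)) :
  #|G|%:R = \sum_j (G (inl j))%:R + \sum_j (G (inr j))%:R :> R.
Proof.
rewrite -sum1_card natr_sum big_mkcond big_sumType /=; congr (_ + _);
  by apply: eq_bigr => j _; rewrite unfold_in; case: (G _).
Qed.

Let SnR n : S n `^ p^-1 = r ^+ n.+1.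
Proof. by rewrite -rS -powRrM divff ?gt_eqF// powRr1// exprn_ge0// ltW. Qed.

(** Levels of size at most m give a geometric sum. On larger ones the weight r ^ n.+1 / S n = S n ^
    (1 / p - 1) is at most m ^ (1 / p - 1), and the counts [gn] sum to m. *)
Let W_upper (A : pred J) a t : 0 <= t -> (forall j, ~~ A j -> a j = 0) ->
  (forall j, modulus (a j) <= t) ->
  \sum_j modulus (W a j) `^ p <= (Cg + 1) `^ p * (t `^ p * \sum_j (A j)%:R).
Proof.
move=> t0 hA ha; set m := \sum_j (A j)%:R; have m0 : 0 <= m by apply: sumr_ge0.
pose gn n : R := \sum_j (A j && (lev j == n))%:R.
have gn0 n : 0 <= gn n by apply: sumr_ge0.
pose v n := r ^+ n.+1 / S n * (t * gn n).
have rS0 n : 0 <= r ^+ n.+1 / S n by rewrite divr_ge0 ?exprn_ge0 ?(ltW r0) ?(ltW (S0 n)).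
have v0 n : 0 <= v n by rewrite mulr_ge0// mulr_ge0.
have Vv n : modulus (V a n) <= v n.
  apply: le_trans (V_le a n) _; rewrite ler_wpM2l// mulr_sumr big_mkcond.
  apply: ler_sum => j _; case: (boolP (A j)) => [Aj|/hA ->] /=.
    by case: (lev j == n); rewrite ?mulr1 ?mulr0.
  by rewrite (modulus0 R F hF) mulr0 if_same.
have gS n : (n < k)%N -> gn n <= S n.
  move=> nk; rewrite /gn -natr_sum /S -natrX ler_nat -(lev_card n nk) -sum1_card [leqRHS]big_mkcond /=.
  by apply: leq_sum => j _; rewrite inE; case: (A j); case: (lev j == n).
suff vs : \sum_(n < k) v n <= (Cg + 1) * (m `^ p^-1 * t).
  apply: (@le_trans _ _ ((\sum_(n < k) v n) `^ p)).
    by apply: (W_sum a v predT) => // n i _ _ _; exact: Vv.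
  have Cg1 : 0 <= Cg + 1 by rewrite addr_ge0.
  have mt0 : 0 <= m `^ p^-1 * t by rewrite mulr_ge0 ?powR_ge0.
  have -> : (Cg + 1) `^ p * (t `^ p * m) = ((Cg + 1) * (m `^ p^-1 * t)) `^ p.
    by rewrite powRM//; congr (_ * _); rewrite powRM ?powR_ge0// sqrtK// mulrC.
  apply: ge0_ler_powR; rewrite ?nnegrE; [exact: ltW|by apply: sumr_ge0| |exact: vs].
  exact: mulr_ge0.
have [m00|mn0] := eqVneq m 0.
  rewrite m00 powR0 ?invr_eq0 ?gt_eqF// mul0r mulr0 big1// => n _.
  suff e : gn n = 0 by rewrite /v e !mulr0.
  apply: le_anti; rewrite gn0 andbT -m00 /m -predJ_sum (bigD1 n)//= lerDl.
  by apply: sumr_ge0 => l _; exact: gn0.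
have mp : 0 < m by rewrite lt_neqAle eq_sym mn0.
have [n0 hn0] : exists n0, forall n, (n < k)%N -> (S n <= m) = (n < n0)%N.
  apply: (cutoff (fun n => S n <= m)) => l n ln; apply: le_trans.
  by rewrite ler_weXn2l// ler1n ltnW.
rewrite (bigID (fun n : 'I_k => (n < n0)%N)) /= mulrDl mul1r lerD//.
  have -> : m `^ p^-1 * t = (m * t `^ p) `^ p^-1.
    by rewrite powRM ?powR_ge0// -powRrM divff ?gt_eqF// powRr1.
  apply: le_trans (low_geometric n0 t (m * t `^ p) t0 _ _); last 2 first.
  - by rewrite mulr_ge0 ?powR_ge0.
  - by move=> n nk nn; rewrite ler_wpM2r ?powR_ge0// hn0.
  apply: ler_sum => n nn; rewrite /v -mulrA ler_wpM2l ?exprn_ge0 ?(ltW r0)//.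
  by rewrite mulrC ler_pdivrMr// ler_wpM2l// gS.
pose e := 1 - p^-1; have e0 : 0 <= e.
  by rewrite subr_ge0 invf_le1// ltW.
have me : m `^ e * m `^ p^-1 = m.
  by rewrite -powRD ?subrK ?powRr1// mn0 implybT.
have mep : 0 < m `^ e by exact: powR_gt0.
rewrite -(ler_pM2l mep) mulrA me mulrC mulr_suml.
apply: (@le_trans _ _ (\sum_(n < k) t * gn n)); last by rewrite -mulr_sumr predJ_sum mulrC.
rewrite big_mkcond; apply: ler_sum => n _; case: ifP => nn; last by rewrite mulr_ge0.
rewrite /v mulrAC ler_piMl ?mulr_ge0//.
rewrite mulrAC ler_pdivrMr// mul1r -SnR.
have SE : S n `^ p^-1 * S n `^ e = S n.
  by rewrite mulrC -powRD ?subrK ?powRr1 ?(ltW (S0 n))// gt_eqF ?implybT.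
rewrite -[leRHS]SE ler_wpM2l ?powR_ge0// ge0_ler_powR ?nnegrE ?(ltW (S0 n))//.
by move: nn; rewrite -hn0// -ltNge => /ltW.
Qed.

Let u_cut0 (G : pred (J + J)) b : (forall x, ~~ G x) -> fmass R F p _ (u (cut_to R F (J + J)%type G b)) = 0.
Proof.
move=> nG; rewrite (_ : cut_to _ _ _ _ _ = fun=> 0); last first.
  by apply/funext => x; rewrite /cut_to (negbTE (nG x)).
have z : modulus (0 : F) `^ p = 0 by rewrite (modulus0 R F hF) powR0// gt_eqF.
rewrite fmassE /mass /fmass big1 ?add0r; last by move=> j _; exact: z.
have W0 j : W (fun=> 0) j = 0.
  by rewrite -[RHS](mul0r (W (fun=> 0) j)) -WZ; congr (W _ j); apply/funext => i; rewrite mul0r.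
apply: big1 => j _; rewrite -[RHS]z; congr (modulus _ `^ p).
by rewrite add0r; exact: W0.
Qed.

Lemma two_kinds_upper (b : J + J -> F) (t : R) (G : pred (J + J)) :
  (forall x, G x -> modulus (b x) <= t) ->
  fmass R F p _ (u (cut_to R F (J + J)%type G b)) <=
  (1 + P2 * (1 + (Cg + 1) `^ p)) * (t `^ p * #|G|%:R).
Proof.
move=> hG; have P20 : 0 <= P2 by exact: powR_ge0.
have K0 : 0 <= (Cg + 1) `^ p by exact: powR_ge0.
have T0 : 0 <= t `^ p by exact: powR_ge0.
have [x Gx|nG] := pickP G; last first.
  rewrite u_cut0; last by move=> x; rewrite nG.
  by rewrite mulr_ge0 ?addr_ge0 ?mulr_ge0 ?addr_ge0.
have t0 : 0 <= t by apply: le_trans (mod_ge0 _) (hG _ Gx).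
have ct y : modulus (cut_to R F (J + J)%type G b y) <= t.
  by rewrite /cut_to; case: ifP => [/hG|]//; rewrite (modulus0 R F hF).
have cp y : modulus (cut_to R F (J + J)%type G b y) `^ p <= t `^ p * (G y)%:R.
  rewrite /cut_to; case: ifP => [Gy|_]; last by rewrite (modulus0 R F hF) powR0 ?gt_eqF// mulr0.
  by rewrite mulr1 ge0_ler_powR ?nnegrE ?(ltW p0)// hG.
rewrite fmassE card_sum.
set mA := \sum_j (G (inl j))%:R; set mB := \sum_j (G (inr j))%:R.
have mA0 : 0 <= mA by apply: sumr_ge0.
have mB0 : 0 <= mB by apply: sumr_ge0.
have hA : mass (cut_to R F (J + J)%type G b \o inl) <= t `^ p * mA.
  by rewrite mulr_sumr; apply: ler_sum => j _; exact: cp.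
have hW := W_upper (G \o inl) (cut_to R F (J + J)%type G b \o inl) t t0 _ (fun j => ct (inl j)).
have hB : \sum_j modulus (cut_to R F (J + J)%type G b (inr j) +
    W (cut_to R F (J + J)%type G b \o inl) j) `^ p <=
    P2 * (t `^ p * mB + (Cg + 1) `^ p * (t `^ p * mA)).
  apply: (@le_trans _ _ (P2 * (t `^ p * mB +
      \sum_j modulus (W (cut_to R F (J + J)%type G b \o inl) j) `^ p))); last first.
    by rewrite ler_wpM2l// lerD2l; apply: hW => j /= Gj; rewrite /cut_to (negbTE Gj).
  rewrite [t `^ p * mB]mulr_sumr -big_split mulr_sumr; apply: ler_sum => j _.
  by apply: le_trans (addp _ _) _; rewrite -/P2 ler_wpM2l// lerD2r cp.
apply: le_trans (lerD hA hB) _.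
have h1 : 0 <= t `^ p * mA by rewrite mulr_ge0.
have h2 : 0 <= t `^ p * mB by rewrite mulr_ge0.
have h3 : 0 <= P2 * (t `^ p * mA) by rewrite mulr_ge0.
have h4 : 0 <= P2 * (Cg + 1) `^ p * (t `^ p * mB) by rewrite mulr_ge0// mulr_ge0.
rewrite [t `^ p * (mA + mB)]mulrDr; move: h1 h2 h3 h4; move: (t `^ p * mA) (t `^ p * mB) ((Cg + 1) `^ p) => x1 x2 y.
lra.
Qed.

Let q : R := (2 `^ (p - 1))^-1 `^ p^-1.
Let q1 : q < 1.
Proof.
have e : (1 : R) = 1 `^ p^-1 by rewrite powR1.
rewrite [ltRHS]e; apply: gt0_ltr_powR; rewrite ?invr_gt0 ?nnegrE ?invr_ge0 ?powR_ge0//.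
rewrite invf_lt1 ?powR_gt0//.
have e2 : (1 : R) = 1 `^ (p - 1) by rewrite powR1.
by rewrite [ltLHS]e2; apply: gt0_ltr_powR; rewrite ?nnegrE ?ltr1n.
Qed.

(** At most M of the M ^ n.+1 entries of level n are kept, so the average on it loses the factor M ^
    (- n (p - 1) / p) <= q ^ n, and the averages are summable. On the second copy, [W_row] shows
    that W a contributes at most tau / M to each of the at most M kept entries. *)
Lemma two_kinds_small (b : J + J -> F) (A : pred (J + J)) : (#|A| <= M)%N ->
  fmass R F p _ (u (cut_to R F (J + J)%type A b)) <=
  (1 + P2 * (P2 * 2 + (1 - q)^-1 `^ p)) * fmass R F p _ (u b).
Proof.
move=> hA; set tau := fmass R F p _ (u b).
have tau0 : 0 <= tau by exact: fmass_ge0.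
have P20 : 0 <= P2 by exact: powR_ge0.
pose a := b \o inl; pose AA : pred J := A \o inl; pose aA := cut_to R F J AA a.
have at1 : mass a <= tau by exact: massA_le.
have aAt : mass aA <= tau by apply: le_trans (cut_mass _ _) _.
have hM : #|A|%:R <= M%:R :> R by rewrite ler_nat.
have [cA cB] : \sum_j (AA j)%:R <= M%:R :> R /\ \sum_j (A (inr j))%:R <= M%:R :> R.
  move: hM; rewrite card_sum => hM; split; apply: le_trans hM; rewrite ?lerDl ?lerDr;
  by apply: sumr_ge0.
pose w : R := M%:R `^ (p - 1); have w0 : 0 < w by exact: powR_gt0.
pose y := tau `^ p^-1; have y0 : 0 <= y by exact: powR_ge0.
have Vq n : (n < k)%N -> modulus (V aA n) <= q ^+ n * y.
  move=> nk; apply: (powR_le_root _ _ _ _ p0); first by rewrite mulr_ge0// exprn_ge0// powR_ge0.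
  rewrite powRM ?exprn_ge0 ?powR_ge0// powR_exprn ?powR_ge0// /q /y !sqrtK ?invr_ge0 ?powR_ge0//.
  have c1 : \sum_j (AA j && (lev j == n))%:R <= M%:R :> R.
    by apply: le_trans cA; apply: ler_sum => j _; rewrite ler_nat; case: (AA j); rewrite ?leq_b1.
  apply: le_trans (Vp_le aA n AA M%:R _ c1) _.
    by move=> j; rewrite /aA /cut_to => /negbTE ->.
  have sw : S n * (S n)^-1 `^ p = (w ^+ n.+1)^-1.
    have wS : w ^+ n.+1 = S n `^ (p - 1) by rewrite /w -powR_exprn.
    have wn : w ^+ n.+1 != 0 by rewrite gt_eqF ?exprn_gt0.
    by apply: (mulIf wn); rewrite mulVf// wS SnV.
  rewrite sw -/w exprS invfM mulrA.
  rewrite [w^-1 * _]mulrC -[_ * w^-1 * w]mulrA mulVf ?mulr1 ?gt_eqF//.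
  apply: ler_pM; rewrite ?invr_ge0 ?exprn_ge0 ?(ltW w0) ?mu_ge0//; last first.
    exact: le_trans (mu_le _ _ nk) aAt.
  rewrite exprVn lef_pV2 ?posrE ?exprn_gt0 ?powR_gt0//.
  apply: lerXn2r; rewrite ?nnegrE ?powR_ge0// ge0_ler_powR ?nnegrE ?(ltW pm0)//.
  by rewrite ler_nat.
have q0 : 0 <= q by exact: powR_ge0.
have hW : \sum_j modulus (W aA j) `^ p <= (1 - q)^-1 `^ p * tau.
  apply: (@le_trans _ _ ((\sum_(n < k) q ^+ n * y) `^ p)).
    apply: (W_sum aA (fun n => q ^+ n * y) predT) => [n|n i nk _ _]; last exact: Vq.
    by rewrite mulr_ge0// exprn_ge0.
  have q10 : 0 < 1 - q by rewrite subr_gt0.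
  have iq0 : 0 <= (1 - q)^-1 by rewrite invr_ge0 ltW.
  have -> : (1 - q)^-1 `^ p * tau = ((1 - q)^-1 * y) `^ p by rewrite powRM// /y sqrtK.
  apply: ge0_ler_powR; rewrite ?nnegrE; [exact: ltW| |exact: mulr_ge0|].
    by apply: sumr_ge0 => n _; rewrite mulr_ge0// exprn_ge0.
  rewrite -mulr_suml ler_wpM2r// -[leRHS]mul1r ler_pdivlMr// mulrC.
  have := subrX1 q k; rewrite (eq_bigr (fun i : 'I_k => q ^+ i)) // => h.
  have := exprn_ge0 k q0; lra.
rewrite fmassE; set c := cut_to _ _ _ A b.
have -> : c \o inl = aA by [].
apply: (@le_trans _ _ (tau + P2 * (P2 * (tau + tau) + (1 - q)^-1 `^ p * tau))); last first.
  by lra.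
rewrite lerD//.
apply: (@le_trans _ _ (P2 * (P2 * (\sum_j modulus (fB b j) `^ p + \sum_j (A (inr j))%:R * (M%:R^-1 * tau)) +
   \sum_j modulus (W aA j) `^ p))); last first.
  rewrite ler_wpM2l// lerD// ler_wpM2l// lerD ?sumB_le//.
  rewrite -mulr_suml mulrA ler_piMl// ler_pdivrMr ?mul1r//.
rewrite -big_split /= [P2 * \sum_(i | _) _]mulr_sumr -big_split /= mulr_sumr.
apply: ler_sum => j _; apply: le_trans (addp _ _) _; rewrite -/P2 ler_wpM2l// lerD2r.
rewrite /c /cut_to; case: (boolP (A (inr j))) => Aj; last first.
  by rewrite (modulus0 R F hF) powR0 ?gt_eqF// mul0r addr0 mulr_ge0.
rewrite mul1r; have -> : b (inr j) = fB b j - W a j by rewrite /fB addrK.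
apply: le_trans (addp _ _) _; rewrite -/P2 ler_wpM2l// lerD2l (modulusN R F hF).
apply: le_trans (W_row _ _) _; apply: ler_pM; rewrite ?invr_ge0 ?(ltW (S0 _)) ?fmass_ge0//.
by rewrite lef_pV2 ?posrE// /S exprS ler_peMr ?(ltW M0)// exprn_ege1// ler1n ltnW.
Qed.

Lemma two_kinds_linear (c : F) b b' :
  u (fun x => c * b x + b' x) = fun x => c * u b x + u b' x.
Proof.
apply/funext => -[j|j] //=.
have -> : W ((fun x => c * b x + b' x) \o inl) j = c * W (b \o inl) j + W (b' \o inl) j.
  by rewrite -WZ -WD.
ring.
Qed.

(** The vector a has mass 1 / k on every level and equal averages, and the second copy is chosen to
    cancel W a. When it is cut away, W a reappears; on the upper half of the levels all L edges
    arrive and their contributions add up without cancellation. *)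
Lemma two_kinds_bad : k = (2 * 2 ^ L)%N ->
  bad_block R F p _ (th * L%:R `^ p / 2) (fun x : J + J => if x is inl _ then true else false) u.
Proof.
move=> kE; have k0 : (0 : R) < k%:R by rewrite ltr0n kE muln_gt0 expn2_gt0.
pose h : F := of_real F (k%:R^-1 `^ p^-1).
have hp : modulus h `^ p = k%:R^-1.
  by rewrite (modulus_of_real hF) ?powR_ge0// sqrtK// invr_ge0 ltW.
pose a j := h / g ^+ (lev j).+1.
have ap j : modulus (a j) `^ p = k%:R^-1 * (S (lev j))^-1.
  rewrite /a (modulusM hF) (modulusV R F hF) (modulusX R F hF) gE powRM ?invr_ge0 ?exprn_ge0 ?(ltW r0)//.
  by rewrite hp powR_inv ?exprn_ge0 ?(ltW r0)// rS.
have Va n : (n < k)%N -> V a n = h.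
  move=> nk; rewrite /V (eq_bigr (fun=> h / g ^+ n.+1)); last by move=> j /eqP <-.
  rewrite sumr_const lev_card// -[_ *+ _]mulr_natr.
  have gn : g ^+ n.+1 != 0 by rewrite expf_neq0.
  have Mn : (M ^ n.+1)%:R != 0 :> F by rewrite pnatr_eq0 -lt0n expn_gt0 ltnW.
  by field; rewrite gn.
exists (fun x => match x with inl j => a j | inr j => - W a j end).
  rewrite fmassE [X in _ + X]big1 ?addr0; last first.
    by move=> j _; rewrite addNr (modulus0 R F hF) powR0 ?gt_eqF.
  rewrite /mass /fmass (eq_bigr (fun j => k%:R^-1 * (S (lev j))^-1)); last by move=> j _; exact: ap.
  rewrite (lev_sum predT (fun i => k%:R^-1 * (S i)^-1)).
  rewrite (eq_bigr (fun=> k%:R^-1)); last by move=> i _; rewrite mulrCA divff ?mulr1// gt_eqF.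
  by rewrite sumr_const card_ord -[k%:R^-1 *+ k]mulr_natl divff// gt_eqF.
rewrite fmassE; set c := cut_to _ _ _ _ _; have -> : c \o inl = a by [].
have W0 j : modulus (c (inr j) + W a j) `^ p =
    th * (S (lev j))^-1 * (k%:R^-1 * (\sum_(n < k) (edge L n (lev j))%:R) `^ p).
  rewrite /c /cut_to add0r /W (eq_bigr (fun=> h)); last by move=> n _; exact: Va.
  rewrite sumr_const !(modulusM hF) (modulusV R F hF) (modulusX R F hF) gE -[h *+ _]mulr_natr (modulusM hF) (modulus_nat hF).
  rewrite !powRM ?mulr_ge0 ?invr_ge0 ?exprn_ge0 ?(ltW r0)// kapE hp powR_inv ?exprn_ge0 ?(ltW r0)// rS.
  congr (_ * (_ * _ `^ _)); rewrite -natr_sum -sum1_card big_mkcond /=; congr _%:R.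
apply: (@le_trans _ _ (\sum_j modulus (c (inr j) + W a j) `^ p)); last first.
  by rewrite lerDr fmass_ge0.
rewrite (eq_bigr _ (fun j _ => W0 j)).
rewrite (lev_sum predT (fun i => th * (S i)^-1 * (k%:R^-1 * (\sum_(n < k) (edge L n i)%:R) `^ p))).
have edge_many i : (2 ^ L <= i < k)%N -> L%:R <= \sum_(n < k) (edge L n i)%:R :> R.
  move=> /andP[Li ik].
  have lt (e : 'I_L) : (i - 2 ^ e < k)%N by apply: leq_ltn_trans (leq_subr _ _) ik.
  have le (e : 'I_L) : (2 ^ e <= i)%N by apply: leq_trans Li; rewrite leq_exp2l// ltnW.
  pose f (e : 'I_L) : 'I_k := Ordinal (lt e).
  have finj : injective f.
    move=> e e' /(congr1 val) /= h1; apply/val_inj/eqP.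
    rewrite -(eqn_exp2l _ _ (isT : (1 < 2)%N)) -(eqn_add2l (i - 2 ^ e)) {2}h1.
    by rewrite !subnK.
  rewrite -[X in X%:R <= _]card_ord -(card_imset predT finj) -sum1_card natr_sum big_mkcond /=.
  apply: ler_sum => n _; case: ifP => // /imsetP[e _ ->]; rewrite ler_nat lt0b.
  by apply/existsP; exists e; rewrite /= subnK.
apply: (@le_trans _ _ (\sum_(i < k | (2 ^ L <= i)%N) th * (k%:R^-1 * L%:R `^ p))).
  rewrite -(big_geq_mkord (2 ^ L) k xpredT (fun=> th * (k%:R^-1 * L%:R `^ p))).
  rewrite sumr_const_nat -[_ *+ (k - _)]mulr_natr.
  have -> : (k - 2 ^ L)%:R = 2^-1 * k%:R :> R.
    rewrite (_ : (k - 2 ^ L)%N = (2 ^ L)%N); last by rewrite kE mul2n -addnn addnK.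
    by rewrite kE natrM mulrA mulVf ?mul1r.
  rewrite le_eqVlt; apply/orP; left; apply/eqP.
  have kn : (k%:R : R) != 0 by rewrite gt_eqF.
  by field.
rewrite big_mkcond; apply: ler_sum => i _ /=.
have t0 : 0 <= (\sum_(n < k) (edge L n i)%:R : R) by apply: sumr_ge0.
have -> : S i * (th * (S i)^-1 * (k%:R^-1 * (\sum_(n < k) (edge L n i)%:R) `^ p)) =
  th * (k%:R^-1 * (\sum_(n < k) (edge L n i)%:R) `^ p).
  by rewrite mulrA [S i * _]mulrCA divff ?mulr1// gt_eqF.
case: ifP => Li; last by rewrite !mulr_ge0 ?invr_ge0 ?powR_ge0// ltW.
rewrite ler_wpM2l// ler_wpM2l ?invr_ge0 ?(ltW k0)// ge0_ler_powR ?nnegrE ?(ltW p0) ?(ltW LR0)//.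
by rewrite edge_many// Li ltn_ord.
Qed.

End TwoKinds.

(** * Existence of blocks with a uniform constant *)

Section BlockExists.
Variables (R : realType) (F : scalarField R) (p : R).
Hypotheses (hF : valued F) (p0 : 0 < p).

Lemma good_block_mono (I : finType) (C C' : R) (u : (I -> F) -> I -> F) : C <= C' ->
  good_block R F p I C u -> good_block R F p I C' u.
Proof.
move=> CC [h1 h2 h3 h4]; split=> // [b t G hG hnG|b t G t0 hG|b t G hG].
- by apply: le_trans (h2 b t G hG hnG) _; rewrite ler_wpM2r ?fmass_ge0.
- by apply: le_trans (h3 b t G t0 hG) _; rewrite ler_wpM2r ?fmass_ge0.
- by apply: le_trans (h4 b t G hG) _; rewrite ler_wpM2r ?mulr_ge0 ?powR_ge0.
Qed.

Lemma small_block_mono (I : finType) (C C' : R) m (u : (I -> F) -> I -> F) : C <= C' ->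
  small_block R F p I C m u -> small_block R F p I C' m u.
Proof.
move=> CC h b A hA.
by apply: le_trans (h b A hA) _; rewrite ler_wpM2r ?fmass_ge0.
Qed.

Lemma block_exists_gt1 : 1 < p -> exists C : R, forall m K,
  exists (I : finType) (u : (I -> F) -> I -> F) (A : pred I),
    [/\ good_block R F p I C u, small_block R F p I C m u & bad_block R F p I K A u].
Proof.
move=> p1; pose P2 : R := 2 `^ p; pose Cg : R := 2 `^ p^-1 / (2 `^ p^-1 - 1).
pose q : R := (2 `^ (p - 1))^-1 `^ p^-1.
pose c1 : R := 1 + P2 + 2 * P2.
pose c2 := 1 + P2 * P2 + P2 * (P2 * (P2 * 2 + 1)) + P2 * (P2 * (2 * P2 + Cg `^ p * P2)).
pose c3 := 1 + P2 * (1 + (Cg + 1) `^ p).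
pose c4 := 1 + P2 * (P2 * 2 + (1 - q)^-1 `^ p).
have [P20 Cp0 Cp1 q0] : [/\ 0 <= P2, 0 <= Cg `^ p, 0 <= (Cg + 1) `^ p & 0 <= (1 - q)^-1 `^ p].
  by split; exact: powR_ge0.
have c10 : 0 <= c1 by rewrite !addr_ge0 ?mulr_ge0.
have c20 : 0 <= c2 by rewrite !(addr_ge0, mulr_ge0).
have c30 : 0 <= c3 by rewrite !(addr_ge0, mulr_ge0).
have c40 : 0 <= c4 by rewrite !(addr_ge0, mulr_ge0).
exists (c1 + c2 + c3 + c4) => m K.
pose M := maxn m 2; have M2 : (2 <= M)%N by rewrite leq_maxr.
(* This is min(1, p - 1), and L is taken so large that L ^ e >= 2 |K|. The constants c1, ..., c4 do
   not involve L. *)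
pose e := p - Num.max (p - 1) 1; have e0 : 0 < e.
  by rewrite subr_gt0 gt_max; apply/andP; split; lra.
pose x : R := (2 * `|K|) `^ e^-1; pose L := (Num.trunc x).+1.
have L1 : (0 < L)%N by [].
have LR : (0 : R) < L%:R by rewrite ltr0n.
have hL : K <= (L%:R `^ Num.max (p - 1) 1)^-1 * L%:R `^ p / 2.
  have -> : (L%:R `^ Num.max (p - 1) 1)^-1 * L%:R `^ p = L%:R `^ e :> R.
    by rewrite -powRN mulrC -powRD// gt_eqF ?implybT.
  rewrite ler_pdivlMr// mulrC; apply: (@le_trans _ _ (2 * `|K|)).
    by rewrite ler_pM2l// ler_norm.
  have -> : 2 * `|K| = x `^ e.
    by rewrite /x -powRrM mulVf ?gt_eqF// powRr1// mulr_ge0.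
  rewrite ge0_ler_powR ?nnegrE ?powR_ge0 ?(ltW e0) ?(ltW LR)//.
  by apply: ltW; apply: truncnS_gt.
pose k := (2 * 2 ^ L)%N.
pose J : finType := {n : 'I_k & 'I_(M ^ n.+1)}.
pose lev (j : J) : nat := tag j.
have lev_lt j : (lev j < k)%N by exact: ltn_ord.
have lev_card n : (n < k)%N -> #|[pred j : J | lev j == n]| = (M ^ n.+1)%N.
  move=> nk; rewrite -sum1_card.
  have := sig_big_dep (fun i : 'I_k => i == Ordinal nk)
    (fun (i : 'I_k) (j : 'I_(M ^ i.+1)) => true) (fun i j => 1%N) (op := addn) (idx := 0%N).
  rewrite big_pred1_eq /= sum1_card card_ord => ->.
  by apply: eq_bigl => j; rewrite inE /lev -val_eqE andbT.
exists (J + J)%type, (two_kinds_op R F p J lev M L k),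
  (fun x : J + J => if x is inl _ then true else false); split.
- split.
  + exact: two_kinds_linear.
  + move=> b t G hG hnG; apply: le_trans (two_kinds_quasi_greedy R F p hF p1 J lev M L k M2 L1 lev_lt lev_card b t G hG hnG) _.
    by rewrite ler_wpM2r ?fmass_ge0//; rewrite -/P2 -/Cg -/c2; lra.
  + move=> b t G t0 hG; apply: le_trans (two_kinds_lower R F p hF p1 J lev M L k M2 L1 lev_lt lev_card b t G t0 hG) _.
    by rewrite ler_wpM2r ?fmass_ge0//; rewrite -/P2 -/c1; lra.
  + move=> b t G hG; apply: le_trans (two_kinds_upper R F p hF p1 J lev M L k M2 L1 lev_lt lev_card b t G hG) _.
    by rewrite ler_wpM2r ?mulr_ge0 ?powR_ge0//; rewrite -/P2 -/Cg -/c3; lra.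
- move=> b A hA; apply: le_trans (two_kinds_small R F p hF p1 J lev M L k M2 L1 lev_lt lev_card b A _) _.
    by apply: leq_trans hA _; rewrite leq_maxl.
  by rewrite ler_wpM2r ?fmass_ge0//; rewrite -/P2 -/q -/c4; lra.
- case: (two_kinds_bad R F p hF p1 J lev M L k M2 L1 lev_lt lev_card (erefl _)) => b h1 h2.
  by exists b => //; exact: le_trans hL h2.
Qed.

Lemma block_exists : exists2 C : R, 1 <= C & forall m K,
  exists (I : finType) (u : (I -> F) -> I -> F) (A : pred I),
    [/\ good_block R F p I C u, small_block R F p I C m u & bad_block R F p I K A u].
Proof.
have [p1|p1] := leP p 1.
  by exists 6; [lra|move=> m K; exact: block_exists_le1].
have [C hC] := block_exists_gt1 p1; exists (Num.max C 1); first by rewrite le_max lexx orbT.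
move=> m K; have [I [u [A [h1 h2 h3]]]] := hC m K; exists I, u, A; split => //.
  by apply: good_block_mono h1; rewrite le_max lexx.
by apply: small_block_mono h2; rewrite le_max lexx.
Qed.

(** * Padding and relabelling *)

Section Pad.
Variables (I J : finType) (C : R) (u : (I -> F) -> I -> F).
Hypothesis C1 : 1 <= C.

(** Unchanged unit vectors are added to bring the dimension to a power of 2. *)
Definition pad_op (b : I + J -> F) (x : I + J) : F :=
  match x with inl i => u (b \o inl) i | inr j => b (inr j) end.

Let fmassE b : fmass R F p _ (pad_op b) = fmass R F p I (u (b \o inl)) + fmass R F p J (b \o inr).
Proof. by rewrite /fmass big_sumType. Qed.

Let modz : modulus (0 : F) `^ p = 0.
Proof. by rewrite (modulus0 R F hF) powR0// gt_eqF. Qed.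

Let cut_le G (b : J -> F) : fmass R F p J (cut_to R F J G b) <= C * fmass R F p J b.
Proof.
apply: (@le_trans _ _ (fmass R F p J b)); last by rewrite ler_peMl ?fmass_ge0.
by apply: ler_sum => j _; rewrite /cut_to; case: ifP => // _; rewrite modz powR_ge0.
Qed.

Let cardE (G : pred (I + J)) : #|G| = (#|(G \o inl : pred I)| + #|(G \o inr : pred J)|)%N.
Proof.
rewrite -!sum1_card big_mkcond big_sumType /= [X in (_ = X + _)%N]big_mkcond
  [X in (_ = _ + X)%N]big_mkcond.
by congr (_ + _)%N.
Qed.

Lemma pad_good : good_block R F p I C u -> good_block R F p _ C pad_op.
Proof.
move=> [h1 h2 h3 h4]; split=> [a b b'|b t G hG hnG|b t G t0 hG|b t G hG].
- apply/funext => -[i|j] //=.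
  by rewrite (_ : _ \o inl = fun i => a * (b \o inl) i + (b' \o inl) i)// h1.
- rewrite !fmassE mulrDr lerD//; last exact: (cut_le (G \o inr) (b \o inr)).
  by apply: (h2 (b \o inl) t (G \o inl)) => i; [exact: hG|exact: hnG].
- rewrite fmassE cardE natrD !mulrDr lerD//.
    by apply: h3 => // i; exact: hG.
  apply: (@le_trans _ _ (fmass R F p J (b \o inr))); last by rewrite ler_peMl ?fmass_ge0.
  rewrite mulr_natr -sumr_const big_mkcond; apply: ler_sum => j _.
  case: ifP => [Gj|_]; last exact: powR_ge0.
  by rewrite ge0_ler_powR ?nnegrE ?(modulus_ge0 hF) ?(ltW p0)// hG.
- rewrite fmassE cardE natrD !mulrDr lerD//.
    by apply: (h4 (b \o inl) t (G \o inl)) => i; exact: hG.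
  apply: (@le_trans _ _ (t `^ p * #|(G \o inr : pred J)|%:R)); last first.
    by rewrite ler_peMl ?mulr_ge0 ?powR_ge0.
  rewrite mulr_natr -sumr_const [leRHS]big_mkcond; apply: ler_sum => j _.
  rewrite /cut_to /= unfold_in /=; case: ifP => [Gj|_]; last by rewrite modz.
  rewrite ge0_ler_powR ?nnegrE ?(modulus_ge0 hF) ?(ltW p0) ?hG//.
  exact: le_trans (modulus_ge0 hF _) (hG _ Gj).
Qed.

Lemma pad_small m : small_block R F p I C m u -> small_block R F p _ C m pad_op.
Proof.
move=> h b A hA; rewrite !fmassE mulrDr lerD//; last exact: (cut_le (A \o inr) (b \o inr)).
apply: (h (b \o inl) (A \o inl)); apply: leq_trans hA; rewrite cardE.
exact: leq_addr.
Qed.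

Lemma pad_bad K A : bad_block R F p I K A u ->
  bad_block R F p _ K (fun x => if x is inl i then A i else false) pad_op.
Proof.
move=> [b hb hK]; exists (fun x => if x is inl i then b i else 0).
  rewrite fmassE [X in _ + X]big1 ?addr0// => j _; exact: modz.
by rewrite fmassE; apply: le_trans hK _; rewrite lerDl fmass_ge0.
Qed.

End Pad.

Section Relabel.
Variables (I J : finType) (h : I -> J) (h' : J -> I).
Hypotheses (hK : cancel h h') (hK' : cancel h' h).
Variables (C : R) (u : (J -> F) -> J -> F).

Definition relabel_op (b : I -> F) (i : I) : F := u (b \o h') (h i).

Let fmassE (f : J -> F) : fmass R F p I (f \o h) = fmass R F p J f.
Proof. by rewrite /fmass [RHS](reindex h)//; exists h' => i _; [exact: hK|exact: hK']. Qed.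

Let fmass_op b : fmass R F p I (relabel_op b) = fmass R F p J (u (b \o h')).
Proof. exact: fmassE. Qed.

Let cardE (G : pred I) : #|(G \o h' : pred J)| = #|G|.
Proof.
rewrite -!sum1_card (reindex h); last by exists h' => i _; [exact: hK|exact: hK'].
by apply: eq_bigl => i; rewrite !unfold_in /= hK.
Qed.

Lemma relabel_good : good_block R F p J C u -> good_block R F p I C relabel_op.
Proof.
move=> [h1 h2 h3 h4]; split=> [a b b'|b t G hG hnG|b t G t0 hG|b t G hG].
- apply/funext => i; rewrite /relabel_op.
  by rewrite (_ : _ \o h' = fun i => a * (b \o h') i + (b' \o h') i)// h1.
- by rewrite !fmass_op; apply: (h2 (b \o h') t (G \o h')) => i; [exact: hG|exact: hnG].
- by rewrite fmass_op -cardE; apply: h3 => // i; exact: hG.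
- by rewrite fmass_op -cardE; apply: (h4 (b \o h') t (G \o h')) => i; exact: hG.
Qed.

Lemma relabel_small m : small_block R F p J C m u -> small_block R F p I C m relabel_op.
Proof.
move=> hs b A hA; rewrite !fmass_op; apply: (hs (b \o h') (A \o h')).
by rewrite cardE.
Qed.

Lemma relabel_bad K (A : pred J) (A' : pred I) : (forall i, A' i = A (h i)) ->
  bad_block R F p J K A u -> bad_block R F p I K A' relabel_op.
Proof.
move=> AA [b hb hKb]; exists (b \o h).
  by rewrite fmass_op (_ : _ \o h' = b)//; apply/funext => j /=; rewrite hK'.
rewrite fmass_op (_ : _ \o h' = cut_to R F J A b)//; apply/funext => j.
by rewrite /cut_to /= AA hK'.
Qed.

End Relabel.

(** Once A is an initial segment of its block, the projection on it is a difference of two partial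
    sum operators, so that conditionality shows already in the natural order. *)
Lemma initial_relabelling (I : finType) (A : pred I) E : #|I| = E -> (0 < E)%N ->
  exists (h : 'I_E -> I) (h' : I -> 'I_E) d,
    [/\ cancel h h', cancel h' h & forall i : 'I_E, (i < d)%N = A (h i)].
Proof.
move=> IE E0; pose s := enum A ++ enum (predC A).
have ss : size s = E by rewrite size_cat -!cardE cardC.
have ms x : x \in s by rewrite mem_cat !mem_enum !unfold_in /= orbN.
have us : uniq s.
  rewrite cat_uniq !enum_uniq andbT /=; apply/hasPn => x.
  by rewrite !mem_enum !unfold_in.
have [x0] : exists x0 : I, true.
  by move: E0; rewrite -IE => /card_gt0P[x _]; exists x.
move=> _; have lt x : (index x s < E)%N by rewrite -ss index_mem.
exists (fun i => nth x0 s i), (fun x => Ordinal (lt x)), #|A|; split.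
- by move=> i; apply/val_inj; rewrite /= index_uniq// ss.
- by move=> x; rewrite /= nth_index.
- move=> i; rewrite nth_cat -cardE; case: ifP => iA.
    have : nth x0 (enum A) i \in enum A by apply: mem_nth; rewrite -cardE.
    by rewrite mem_enum.
  have : nth x0 (enum (predC A)) (i - #|A|) \in enum (predC A).
    have Ai : (#|A| <= i)%N by rewrite leqNgt iA.
    by apply: mem_nth; rewrite -cardE -(ltn_add2l #|A|) subnKC// cardC IE ltn_ord.
  by rewrite mem_enum unfold_in /= => /negbTE.
Qed.

(** * Kernels *)

(** Kernels indexed by nat have one type for blocks of all sizes. *)
Definition kernel_op E (k : nat -> nat -> F) (b : 'I_E -> F) : 'I_E -> F :=
  fun i => \sum_(j < E) k i j * b j.

Lemma kernel_exists E (C : R) (u : ('I_E -> F) -> 'I_E -> F) :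
  good_block R F p _ C u -> exists k, kernel_op E k = u.
Proof.
move=> gu; have lin := block_linear _ _ _ _ _ _ gu.
exists (fun m n => match insub m, insub n with
  | Some i, Some j => u (fun l => (l == j)%:R) i | _, _ => 0 end).
apply/funext => b; apply/funext => i; rewrite /kernel_op.
have u0 : u (fun=> 0) = fun=> 0.
  apply/funext => l; have := congr1 (fun f => f l) (lin (-1) (fun=> 0) (fun=> 0)).
  by rewrite (_ : (fun _ => _) = fun=> 0) ?mulN1r ?addNr//; apply/funext => ?; rewrite mulr0 addr0.
have step (s : seq 'I_E) : u (fun l => \sum_(j <- s) b j * (l == j)%:R) i =
    \sum_(j <- s) u (fun l => (l == j)%:R) i * b j.
  elim: s => [|j s IH].
    by rewrite big_nil (_ : (fun _ => _) = fun=> 0) ?u0//; apply/funext => l; rewrite big_nil.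
  rewrite big_cons -IH [u (fun l => (l == j)%:R) i * b j]mulrC.
  rewrite -[RHS](congr1 (fun f => f i) (lin (b j) (fun l => (l == j)%:R) _)).
  by congr (u _ i); apply/funext => l; rewrite big_cons.
under eq_bigr do rewrite !valK.
rewrite -step; congr (u _ i); apply/funext => l.
rewrite (bigD1 l)//= eqxx mulr1 big1 ?addr0// => j /negbTE jl.
by rewrite eq_sym jl mulr0.
Qed.

(** The operator is injective by [block_lower] for single coordinates. *)
Lemma kernel_inverse E (C : R) k : good_block R F p _ C (kernel_op E k) ->
  exists k' : nat -> nat -> F, (forall i l, (i < E)%N -> (l < E)%N -> \sum_(j < E) k' i j * k j l = (i == l)%:R) /\
    (forall i l, (i < E)%N -> (l < E)%N -> \sum_(j < E) k i j * k' j l = (i == l)%:R).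
Proof.
move=> gk; pose A : 'M[F]_E := \matrix_(i, j) k i j.
have uA : A \in unitmx.
  rewrite -unitmx_tr -row_free_unit; apply/inj_row_free => v vA.
  pose b (j : 'I_E) := v 0 j.
  have b0 : kernel_op E k b = fun=> 0.
    apply/funext => i; have := congr1 (fun w : 'rV[F]_E => w 0 i) vA.
    rewrite !mxE => h; rewrite -[RHS]h; apply: eq_bigr => j _.
    by rewrite !mxE /b mulrC.
  apply/rowP => j; rewrite [RHS]mxE.
  have := block_lower _ _ _ _ _ _ gk b (modulus (b j)) (pred1 j) (modulus_ge0 hF _).
  rewrite b0 card1 mulr1 /fmass big1 ?mulr0; last first.
    by move=> i _; rewrite (modulus0 R F hF) powR0// gt_eqF.
  move=> h; apply: (modulus0_eq0 hF); apply: (@powR_eq0_eq0 _ _ p).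
  by apply: le_anti; rewrite powR_ge0 andbT; apply: h => i /eqP ->.
exists (fun m n => match insub m, insub n with
  | Some i, Some j => invmx A i j | _, _ => 0 end); split=> i l iE lE.
  have := congr1 (fun B : 'M[F]_E => B (Ordinal iE) (Ordinal lE)) (mulVmx uA).
  rewrite !mxE -val_eqE /= => <-; apply: eq_bigr => j _.
  by rewrite valK insubT mxE.
have := congr1 (fun B : 'M[F]_E => B (Ordinal iE) (Ordinal lE)) (mulmxV uA).
rewrite !mxE -val_eqE /= => <-; apply: eq_bigr => j _.
by rewrite valK insubT mxE.
Qed.

Lemma dyadic_block_exists : exists2 C : R, 1 <= C & forall l m K,
  exists l' k d, [/\ (l < l')%N, good_block R F p _ C (kernel_op (2 ^ l') k),
    small_block R F p _ C m (kernel_op (2 ^ l') k) &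
    bad_block R F p _ K (fun i : 'I_(2 ^ l') => (i < d)%N) (kernel_op (2 ^ l') k)].
Proof.
have [C C1 hC] := block_exists; exists C => // l m K.
have [I [u [A [gu su bu]]]] := hC m K.
pose l' := (l + #|I|).+1; pose E := (2 ^ l')%N.
have IE : (#|I| <= E)%N by rewrite ltnW// (leq_ltn_trans _ (ltn_expl l' _))// /l'; lia.
pose J := 'I_(E - #|I|).
have cJ : #|(I + J)%type : finType| = E by rewrite card_sum card_ord subnKC.
have [h [h' [d [hK hK' hd]]]] := initial_relabelling (I + J)%type
  (fun x => if x is inl i then A i else false) E cJ (expn2_gt0 l').
have gp := relabel_good 'I_E _ h h' hK hK' C _ (pad_good I J C u C1 gu).
have [k hk] := kernel_exists E C _ gp.
exists l', k, d; rewrite hk; split => //; first by rewrite /l'; lia.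
- by apply: relabel_small => //; exact: pad_small.
- have pb := pad_bad I J u K A bu.
  by apply: relabel_bad hd pb.
Qed.

End BlockExists.

(** * Existence of greedy orderings *)

Lemma greedy_ordering_exists (R : realType) (F : scalarField R) (hF : valued F) (c : nat -> F) :
  (forall e : R, 0 < e -> exists M, forall n, (M <= n)%N -> modulus (c n) < e) ->
  is_greedy_ordering c (greedy_ordering c).
Proof.
move=> c0; suff ex : exists rho, is_greedy_ordering c rho.
  exact: (@xgetPex _ (id : nat -> nat) [set rho | is_greedy_ordering c rho]).
pose before m n := modulus (c n) < modulus (c m) \/
  modulus (c m) = modulus (c n) /\ (m < n)%N.
(* [nx l] is the first index outside l where the modulus is largest. The maximum v exists because c
   tends to 0; it is 0 if c vanishes outside l. *)
have /choice[nx hnx] : forall l : seq nat, exists n, n \notin l /\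
    forall m, m \notin l -> m <> n -> before n m.
  move=> l; suff [v [ex ub]] : exists v, (exists n, (n \notin l) && (modulus (c n) == v)) /\
      forall m, m \notin l -> modulus (c m) <= v.
    case: (ex_minnP ex) => n /andP[nl /eqP nv] nmin; exists n; split => // m ml mn.
    rewrite /before nv; have := ub m ml; rewrite le_eqVlt => /orP[/eqP e|]; last by left.
    right; split => //; have := nmin m; rewrite ml e eqxx => /(_ isT).
    by rewrite leq_eqVlt => /orP[/eqP nm|//]; case: mn.
  case: (pselect (exists m, m \notin l /\ 0 < modulus (c m))) => [[m [ml m0]]|no].
    have [M hM] := c0 _ m0.
    have mM : (m < M)%N by rewrite ltnNge; apply/negP => /hM; rewrite ltxx.
    have [i il imax] := arg_maxP (fun i : 'I_M => modulus (c i))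
      (P := fun i : 'I_M => (i : nat) \notin l) (i0 := Ordinal mM) ml.
    exists (modulus (c i)); split; first by exists (nat_of_ord i); rewrite il eqxx.
    move=> n nl; have [nM|Mn] := ltnP n M; first exact: (imax (Ordinal nM) nl).
    by apply: ltW; apply: lt_le_trans (hM _ Mn) _; exact: (imax (Ordinal mM) ml).
  have z m : m \notin l -> modulus (c m) = 0.
    move=> ml; apply: le_anti; rewrite (modulus_ge0 hF) andbT leNgt; apply/negP => h.
    by apply: no; exists m.
  exists 0; split; last by move=> m /z ->.
  pose n := (\max_(i <- l) i).+1; have nl : n \notin l.
    apply/negP => nl; have : (n <= \max_(i <- l) i)%N.
      by rewrite (big_rem _ nl) /= leq_maxl.
    by rewrite ltnn.
  by exists n; rewrite nl z// eqxx.
pose fix pre k := if k is k'.+1 then nx (pre k') :: pre k' else [::].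
pose rho k := nx (pre k).
have preP m k : m \in pre k <-> exists2 j, (j < k)%N & m = rho j.
  elim: k => [|k IH] /=; first by split=> // -[].
  rewrite inE; split=> [/orP[/eqP->|mk]|[j]].
  - by exists k.
  - by have [j jk ->] := IH.1 mk; exists j => //; exact: ltnW.
  - rewrite ltnS leq_eqVlt => /orP[/eqP-> ->|jk mj]; first by rewrite eqxx.
    by apply/orP; right; apply: IH.2; exists j.
have neq j k : (j < k)%N -> rho k <> rho j.
  move=> jk e; have [/negP h _] := hnx (pre k); apply: h; apply/preP; by exists j.
have inj : injective rho.
  move=> j k e; have [jk|kj|//] := ltngtP j k.
    by case: (neq _ _ jk).
  by case: (neq _ _ kj).
have ord j k : (j < k)%N -> before (rho j) (rho k).
  move=> jk; apply: (hnx (pre j)).2; last exact: neq.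
  apply/negP => /preP[i ij /inj ki]; move: ij; rewrite -ki ltnNge.
  by rewrite ltnW.
exists rho; split => // n /= cn.
(* If n were never chosen, every rho k would come before it, and infinitely many indices would lie
   in the finite set where the modulus is at least that of c n. *)
case: (pselect (exists k, rho k = n)) => [[k <-]|no]; first by exists k.
have n0 : 0 < modulus (c n).
  rewrite lt_neqAle eq_sym (modulus_ge0 hF) andbT; apply: contra cn => /eqP.
  by move/(modulus0_eq0 hF) => ->.
have [M hM] := c0 _ n0.
have rM k : (rho k < M)%N.
  rewrite ltnNge; apply/negP => /hM; rewrite ltNge => /negP; apply.
  have : before (rho k) n.
    apply: (hnx (pre k)).2; last by move=> e; apply: no; exists k.
    by apply/negP => /preP[j _ e]; apply: no; exists j.
  by case=> [/ltW//|[-> _]].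
have us : uniq (map rho (iota 0 M.+1)) by rewrite map_inj_uniq ?iota_uniq.
have : {subset map rho (iota 0 M.+1) <= iota 0 M}.
  by move=> m /mapP[k _ ->]; rewrite mem_iota /=.
by move=> /(uniq_leq_size us); rewrite size_map !size_iota ltnn.
Qed.

(** * Block diagonal operators and their bases *)

Section BlockOperator.
Variables (R : realType) (F : scalarField R) (p : R).
Hypotheses (hF : valued F) (p0 : 0 < p).
Implicit Types (b f g : sequences F).

Definition block_op (K : nat -> nat -> nat -> F) b : sequences F := fun n =>
  \sum_(j < 2 ^ blk n) K (blk n) (n - base (blk n))%N j * b (base (blk n) + j)%N.

Definition cut_seq (G : pred nat) b : sequences F := fun n => if G n then b n else 0.

Definition block_part k b : 'I_(2 ^ k) -> F := fun j => b (base k + j)%N.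

Lemma block_op_part K b k : block_part k (block_op K b) = kernel_op R F _ (K k) (block_part k b).
Proof.
by apply/funext => i; rewrite /block_part /block_op blk_base// addKn.
Qed.

Lemma block_part_ext b b' : (forall k, block_part k b = block_part k b') -> b = b'.
Proof.
move=> h; apply/funext => n; have := blk_bounds n => /andP[h1 h2].
have lt : (n - base (blk n) < 2 ^ blk n)%N by rewrite -(ltn_add2l (base (blk n))) subnKC.
have := congr1 (fun v => v (Ordinal lt)) (h (blk n)).
by rewrite /block_part /= subnKC.
Qed.

Lemma block_part_cut G b k : block_part k (cut_seq G b) =
  cut_to R F _ (fun j : 'I_(2 ^ k) => G (base k + j)%N) (block_part k b).
Proof. by []. Qed.

Lemma block_op_linear K (a : F) f g : block_op K (a *: f + g) = a *: block_op K f + block_op K g.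
Proof.
apply/funext => n; rewrite seqDE seqZE /block_op mulr_sumr -big_split /=.
by apply: eq_bigr => j _; rewrite seqDE seqZE mulrDr mulrCA.
Qed.

Lemma block_op0 K : block_op K 0 = 0.
Proof.
by apply/funext => n; rewrite /block_op big1// => j _; rewrite seq0E mulr0.
Qed.

Lemma block_opD K f g : block_op K (f + g) = block_op K f + block_op K g.
Proof. by have := block_op_linear K 1 f g; rewrite !scale1r. Qed.

Lemma block_opZ K (a : F) f : block_op K (a *: f) = a *: block_op K f.
Proof. by have := block_op_linear K a f 0; rewrite block_op0 !addr0. Qed.

Lemma block_op_inverse (K K' : nat -> nat -> nat -> F) : (forall k i l, (i < 2 ^ k)%N -> (l < 2 ^ k)%N ->
    \sum_(j < 2 ^ k) K k i j * K' k j l = (i == l)%:R) ->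
  forall b, block_op K (block_op K' b) = b.
Proof.
move=> inv b; apply: block_part_ext => k; rewrite !block_op_part; apply/funext => i.
rewrite /kernel_op; under eq_bigr do rewrite mulr_sumr.
rewrite exchange_big /= (bigD1 i)//= [X in _ + X]big1.
  rewrite addr0; under eq_bigr do rewrite mulrA.
  by rewrite -mulr_suml inv// eqxx mul1r.
move=> l li; under eq_bigr do rewrite mulrA.
by rewrite -mulr_suml inv// val_eqE eq_sym (negbTE li) mul0r.
Qed.

Lemma block_sum_pmass f k : block_sum R (pmass R F p f) k = fmass R F p _ (block_part k f).
Proof. by []. Qed.

Lemma sum_unit_vec (s : seq nat) (a : nat -> F) : uniq s ->
  \sum_(n <- s) a n *: unit_vec R F n = cut_seq (mem s) a.
Proof.
elim: s => [|n s IH] /=; first by move=> _; rewrite big_nil; apply/funext.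
move=> /andP[ns us]; rewrite big_cons IH//; apply/funext => m.
rewrite seqDE seqZE /unit_vec /cut_seq /= inE; case: eqP => [->|] /=.
  by rewrite (negbTE ns) mulr1 addr0.
by rewrite mulr0 add0r.
Qed.

Lemma block_op_sum K (s : seq nat) (a : nat -> F) : uniq s ->
  \sum_(n <- s) a n *: block_op K (unit_vec R F n) = block_op K (cut_seq (mem s) a).
Proof.
move=> us; rewrite -sum_unit_vec//; elim: s {us} => [|n s IH].
  by rewrite !big_nil block_op0.
by rewrite !big_cons IH block_opD block_opZ.
Qed.

Lemma cut_seqC G b : b = cut_seq G b + cut_seq (predC G) b.
Proof.
apply/funext => n; rewrite seqDE /cut_seq /=; case: (G n); by rewrite ?addr0 ?add0r.
Qed.

Lemma block_op_cutB K G b : block_op K b - block_op K (cut_seq G b) = block_op K (cut_seq (predC G) b).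
Proof. by rewrite {1}(cut_seqC G b) block_opD addrC addKr. Qed.

Section Good.
Variables (K K' : nat -> nat -> nat -> F) (C : R).
Hypothesis C1 : 1 <= C.
Hypothesis goodK : forall k, good_block R F p _ C (kernel_op R F (2 ^ k) (K k)).
Hypothesis invl : forall k i l, (i < 2 ^ k)%N -> (l < 2 ^ k)%N ->
  \sum_(j < 2 ^ k) K' k i j * K k j l = (i == l)%:R.
Hypothesis invr : forall k i l, (i < 2 ^ k)%N -> (l < 2 ^ k)%N ->
  \sum_(j < 2 ^ k) K k i j * K' k j l = (i == l)%:R.
Local Notation U := (block_op K).
Local Notation Ui := (block_op K').
Local Notation X := (@tsirelson_p R F p).
Local Notation q := (@tsirelson_p_qnorm R F p).
Local Notation pm := (pmass R F p).
Local Notation mu k f := (block_sum R (pm f) k).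

Definition basis_vec (n : nat) : sequences F := U (unit_vec R F n).
Definition coord_fun (n : nat) (f : sequences F) : F := Ui f n.

Let C0 : 0 <= C. Proof. by apply: le_trans C1. Qed.
Let UK b : Ui (U b) = b. Proof. exact: block_op_inverse. Qed.
Let UiK b : U (Ui b) = b. Proof. exact: block_op_inverse. Qed.

Lemma mu_quasi_greedy b t (G : pred nat) k : (forall n, G n -> t <= modulus (b n)) ->
  (forall n, ~~ G n -> modulus (b n) <= t) -> mu k (U (cut_seq G b)) <= C * mu k (U b).
Proof.
move=> hG hnG; rewrite !block_sum_pmass !block_op_part block_part_cut.
by apply: (block_quasi_greedy _ _ _ _ _ _ (goodK k) _ t) => j; [exact: hG|exact: hnG].
Qed.

Lemma card_ord_sum (k : nat) (G : pred nat) :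
  #|[pred j : 'I_(2 ^ k) | G (base k + j)%N]|%:R = block_sum R (fun n => (G n)%:R) k.
Proof.
rewrite -sum1_card natr_sum big_mkcond; apply: eq_bigr => j _.
by rewrite inE; case: (G _).
Qed.

Lemma mu_lower b t (G : pred nat) k : 0 <= t -> (forall n, G n -> t <= modulus (b n)) ->
  t `^ p * block_sum R (fun n => (G n)%:R) k <= C * mu k (U b).
Proof.
move=> t0 hG; rewrite block_sum_pmass block_op_part -card_ord_sum.
by apply: (block_lower _ _ _ _ _ _ (goodK k) _ t) => // j; exact: hG.
Qed.

Lemma mu_upper b t (G : pred nat) k : (forall n, G n -> modulus (b n) <= t) ->
  mu k (U (cut_seq G b)) <= C * (t `^ p * block_sum R (fun n => (G n)%:R) k).
Proof.
move=> hG; rewrite block_sum_pmass block_op_part block_part_cut -card_ord_sum.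
by apply: (block_upper _ _ _ _ _ _ (goodK k) _ t) => j; exact: hG.
Qed.

Lemma norm_le_blocks (w : nat -> R) c : (forall n, 0 <= w n) ->
  (forall l, \sum_(k < l) block_sum R w k <= c) -> norm_le R w c.
Proof.
move=> w0 h; apply: norm_le_sum => // B; apply: le_trans (h B).
rewrite -sum_blocks -(subnKC (leq_base B)) big_split_ord /= lerDl sumr_ge0//.
Qed.

(** Here the norm is bounded by the plain sum of the block masses; the matching lower bound comes
    from [norm_le_democratic]. *)
Lemma norm_le_upper b t (s : seq nat) : uniq s -> (forall n, n \in s -> modulus (b n) <= t) ->
  norm_le R (pm (U (cut_seq (mem s) b))) (C * (t `^ p * (size s)%:R)).
Proof.
move=> us hs; apply: norm_le_blocks => [n|l]; first exact: pmass_ge0.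
apply: (@le_trans _ _ (\sum_(k < l) C * (t `^ p * block_sum R (fun n => (n \in s)%:R) k))).
  by apply: ler_sum => k _; exact: mu_upper.
rewrite -!mulr_sumr ler_wpM2l// ler_wpM2l ?powR_ge0//.
rewrite -(sum_blocks R (fun n => (n \in s)%:R)) -natr_sum ler_nat.
rewrite -sum1_size -(big_mkord xpredT (fun n => nat_of_bool (n \in s))).
rewrite -[leqLHS](big_mkcond (fun n => n \in s) (fun=> 1%N)) -big_filter.
rewrite !sum1_size; apply: uniq_leq_size; first by rewrite filter_uniq ?iota_uniq.
by move=> n; rewrite mem_filter => /andP[].
Qed.

Lemma coord_bound f n c : norm_le R (pm f) c -> modulus (Ui f n) `^ p <= C * (2 * c).
Proof.
move=> hc; have h := mu_lower (Ui f) (modulus (Ui f n)) (pred1 n) (blk n) (modulus_ge0 hF _).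
have {}h : modulus (Ui f n) `^ p * block_sum R (fun m => (pred1 n m)%:R) (blk n) <= C * mu (blk n) f.
  by rewrite -{2}(UiK f); apply: h => m /eqP ->.
apply: (@le_trans _ _ (C * mu (blk n) f)); last first.
  by rewrite ler_wpM2l//; apply: block_sum_le => // m; exact: pmass_ge0.
apply: le_trans h; rewrite ler_peMr ?powR_ge0//.
have /andP[h1 h2] := blk_bounds n.
have lt : (n - base (blk n) < 2 ^ blk n)%N by rewrite -(ltn_add2l (base (blk n))) subnKC.
by rewrite /block_sum (bigD1 (Ordinal lt))//= subnKC// eqxx lerDl sumr_ge0.
Qed.

Lemma basis_vec_c00 n : c00 (basis_vec n).
Proof.
apply/c00P; exists (base (blk n).+1) => m; rewrite leq_base_blk => nm.
rewrite /basis_vec /block_op big1// => j _; rewrite /unit_vec; case: eqP => [e|]; last by rewrite mulr0.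
by move: nm; rewrite -e blk_base// ltnn.
Qed.

Lemma tsirelson_p_basis_vec n : X (basis_vec n).
Proof. by apply: c00_tsirelson_p => //; exact: basis_vec_c00. Qed.

Lemma basis_vec_norm n : norm_le R (pm (basis_vec n)) C.
Proof.
have := @norm_le_upper (fun=> 1) 1 [:: n] isT (fun _ _ => _).
rewrite powR1 mul1r mulr1 -block_op_sum// big_seq1 scale1r; apply.
by move=> _; rewrite (modulus1 R F hF).
Qed.

(** As U preserves every block, a partial sum that stops at the end of a block is a restriction of
    f. Density and the decay of coefficients are therefore tested at block ends, where
    conditionality is invisible. *)
Lemma sub_truncation f l : f - U (cut_seq (fun n => n < base l)%N (Ui f)) =
  cut_seq (fun n => base l <= n)%N f.
Proof.
rewrite -{1}(UiK f) block_op_cutB; apply: block_part_ext => k.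
rewrite block_op_part !block_part_cut; have [lk|kl] := leqP l k.
  have -> : cut_to R F _ (fun j : 'I_(2 ^ k) => predC (fun n => n < base l)%N (base k + j)%N)
      (block_part k (Ui f)) = block_part k (Ui f).
    by apply/funext => j; rewrite /cut_to /= -leqNgt leq_base_blk blk_base// lk.
  rewrite -block_op_part UiK; apply/funext => j.
  by rewrite /cut_to leq_base_blk blk_base// lk.
have -> : cut_to R F _ (fun j : 'I_(2 ^ k) => predC (fun n => n < base l)%N (base k + j)%N)
      (block_part k (Ui f)) = fun=> 0.
  by apply/funext => j; rewrite /cut_to /= -leqNgt leq_base_blk blk_base// leqNgt kl.
apply/funext => j; rewrite /kernel_op big1; last by move=> i _; rewrite mulr0.
by rewrite /cut_to leq_base_blk blk_base// leqNgt kl.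
Qed.

Lemma pmass_cut G f n : pm (cut_seq G f) n = (G n)%:R * pm f n.
Proof.
rewrite {1}/pmass /cut_seq; case: (G n); rewrite ?mul1r//.
by rewrite (modulus0 R F hF) powR0 ?gt_eqF// mul0r.
Qed.

Lemma basis_vec_dense : X `<=` closed_span X q basis_vec.
Proof.
move=> f Xf; split=> // e e0.
have e20 : 0 < e / 2 by rewrite divr_gt0.
have [|M hM] := (tsirelson_pP R F p hF p0 f).1 Xf ((e / 2) `^ p); first exact: powR_gt0.
exists (\sum_(n < base M) Ui f n *: basis_vec n); first by exists (base M), (Ui f).
have -> : \sum_(n < base M) Ui f n *: basis_vec n = U (cut_seq (fun n => n < base M)%N (Ui f)).
  rewrite -(big_mkord xpredT (fun n => Ui f n *: basis_vec n)) block_op_sum ?iota_uniq//.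
  congr (U (cut_seq _ _)); apply/funext => n; rewrite /= mem_index_iota.
  by [].
rewrite sub_truncation; apply: (@le_lt_trans _ _ (e / 2)); last by lra.
rewrite -[leRHS](powRK R p p0); last exact: ltW.
apply: qnorm_le => //; apply: norm_le_mono hM => n; rewrite pmass_cut.
rewrite ler_wpM2r ?pmass_ge0// ler_nat; case: (leqP (base M) n) => // h.
by rewrite (leq_trans (leq_base M) h).
Qed.

Lemma basis_vec_is_basis : is_basis X q basis_vec coord_fun.
Proof.
split.
- exact: tsirelson_p_basis_vec.
- by exists (C `^ p^-1) => n; apply: qnorm_le => //; exact: basis_vec_norm.
- exact: basis_vec_dense.
- split=> [n a f g _ _|].
    by rewrite /coord_fun block_op_linear.
  exists ((C * 2) `^ p^-1) => n f Xf; have [c hc] := tsirelson_p_bounded R F p hF p0 f Xf.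
  apply: (powR_le_root _ _ _ _ p0); first by rewrite mulr_ge0 ?powR_ge0.
  rewrite powRM ?powR_ge0// powRVK//; last by rewrite mulr_ge0.
  by rewrite -mulrA; apply: coord_bound; exact: qnorm_ub hc.
- by move=> m n; rewrite /coord_fun UK.
Qed.

Lemma coord_vanish f : X f ->
  forall e : R, 0 < e -> exists M, forall n, (M <= n)%N -> modulus (coord_fun n f) < e.
Proof.
move=> Xf e e0; have e20 : 0 < e / 2 by rewrite divr_gt0.
have Cp : 0 < C by apply: lt_le_trans C1.
have [|M hM] := (tsirelson_pP R F p hF p0 f).1 Xf ((e / 2) `^ p / (C * 2)).
  by rewrite divr_gt0 ?powR_gt0 ?mulr_gt0.
exists (base M) => n Mn; apply: (@le_lt_trans _ _ (e / 2)); last by lra.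
apply: (powR_le_root _ _ _ _ p0); first exact: ltW.
have tail : norm_le R (pm (cut_seq (fun n => base M <= n)%N f)) ((e / 2) `^ p / (C * 2)).
  apply: norm_le_mono hM => m; rewrite pmass_cut.
  rewrite ler_wpM2r ?pmass_ge0// ler_nat; case: (leqP (base M) m) => // h.
  by rewrite (leq_trans (leq_base M) h).
have := coord_bound _ n _ tail; rewrite mulrA [C * 2 * _]mulrC divfK ?gt_eqF ?mulr_gt0//.
rewrite -sub_truncation (_ : Ui _ n = Ui f n)//.
have -> : f - U (cut_seq (fun n => n < base M)%N (Ui f)) = U (cut_seq (predC (fun n => n < base M)%N) (Ui f)).
  by rewrite -{1}(UiK f) block_op_cutB.
by rewrite UK /cut_seq /= -leqNgt Mn.
Qed.

(** With G the greedy set, A a competitor and h the remainder after A, the remainder after G is the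
    part of h outside G \ A, a threshold set for h, plus the part of f on A \ G. The latter has
    coefficients at most t on |A \ G| = |G \ A| indices, and t ^ p |G \ A| is controlled by h, whose
    coefficients on G \ A are at least t. *)
Lemma basis_vec_almost_greedy : almost_greedy X q basis_vec coord_fun.
Proof.
pose P2 : R := 2 `^ p; have P20 : 0 <= P2 by exact: powR_ge0.
pose H : R := P2 * (1 + C); have H0 : 0 <= H by rewrite mulr_ge0// addr_ge0.
(* 8 H is for the part of h. In the other term, C is the upper estimate, 4 the democracy of the unit
   vectors and 8 C the comparison of block masses. *)
pose D : R := P2 * (8 * H + C * (4 * (8 * C))).
have D0 : 0 <= D by rewrite !(mulr_ge0, addr_ge0).
pose E : R := Num.max 1 (D `^ p^-1).
exists E; first by rewrite le_max lexx.
move=> f m Xf m0; set b := Ui f.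
have E0 : 0 < E by rewrite lt_max ltr01.
have grho := greedy_ordering_exists R F hF _ (coord_vanish f Xf).
rewrite /greedy_sum; set rho := greedy_ordering _ in grho *.
have [inj cover ord] := grho.
pose G := [seq rho j | j <- iota 0 m].
have uG : uniq G by rewrite map_inj_uniq ?iota_uniq.
have sG : size G = m by rewrite size_map size_iota.
have -> : \sum_(j < m) coord_fun (rho j) f *: basis_vec (rho j) = U (cut_seq (mem G) b).
  rewrite -(big_mkord xpredT (fun j => coord_fun (rho j) f *: basis_vec (rho j))).
  rewrite -(block_op_sum K G b uG) /G big_map; rewrite /index_iota subn0.
  by [].
pose t := modulus (b (rho m.-1)); have t0 : 0 <= t by exact: modulus_ge0.
have Gt n : n \in G -> t <= modulus (b n).
  move=> /mapP[j]; rewrite mem_iota add0n => /= jm ->.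
  have : (j <= m.-1)%N by rewrite -ltnS prednK.
  rewrite leq_eqVlt => /orP[/eqP ->//|/ord[/ltW//|[e _]]].
  by rewrite /t -/b in e *; rewrite /coord_fun -/b in e; rewrite e.
have nGt n : n \notin G -> modulus (b n) <= t.
  move=> nG; have [->|bn] := eqVneq (b n) 0; first by rewrite (modulus0 R F hF).
  have [k _ kn] := cover n bn; subst n.
  have mk : (m <= k)%N.
    by rewrite leqNgt; apply: contra nG => km; apply/mapP; exists k; rewrite ?mem_iota.
  have : (m.-1 < k)%N by rewrite prednK.
  by move=> /ord[/ltW//|[e _]]; rewrite /t /b; rewrite /coord_fun in e; rewrite e.
suff key A : #|` A| = m -> q (f - U (cut_seq (mem G) b)) <=
    E * q (f - \sum_(n <- A) coord_fun n f *: basis_vec n).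
  rewrite mulrC -ler_pdivrMr//; apply: lb_le_inf.
    (* The infimum is only meaningful over a nonempty set of errors; the greedy set itself provides
       one. *)
    pose A := seq_fset tt G; exists (q (f - \sum_(n <- A) coord_fun n f *: basis_vec n)), A.
    by split=> //; rewrite size_seq_fset undup_id.
  move=> _ [A [cA ->]]; rewrite ler_pdivrMr// mulrC; exact: key.
move=> cA; pose As : seq nat := enum_fset A.
have uA : uniq As by exact: fset_uniq.
have -> : \sum_(n <- A) coord_fun n f *: basis_vec n = U (cut_seq (mem As) b).
  by rewrite -(block_op_sum K As b uA).
rewrite -{1 2}(UiK f) -/b !block_op_cutB.
set h := U (cut_seq (predC (mem As)) b); set b' := cut_seq (predC (mem As)) b.
have [c hc] : exists c, norm_le R (pm h) c.
  have [c hc] := tsirelson_p_bounded R F p hF p0 f Xf.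
  have hA : norm_le R (pm (U (cut_seq (mem As) b))) (C * ((\sum_(n <- As) modulus (b n)) `^ p * (size As)%:R)).
    apply: norm_le_upper => // n nA; rewrite (big_rem n nA) /= lerDl.
    by apply: sumr_ge0 => *; exact: modulus_ge0.
  have := norm_le_pmassD R F p hF p0 f (- U (cut_seq (mem As) b)) _ _ hc.
  rewrite pmassN// => /(_ _ hA) => hh; eexists; rewrite /h -block_op_cutB UiK; exact: hh.
have hq := qnorm_ub R F p hF p0 h c hc; set Q := q h `^ p in hq.
have Q0 : 0 <= Q by exact: powR_ge0.
pose GA : pred nat := fun n => (n \in G) && (n \notin As).
have GAt n : GA n -> t <= modulus (b' n).
  by move=> /andP[nG nA]; rewrite /b' /cut_seq /= nA; exact: Gt.
have nGAt n : ~~ GA n -> modulus (b' n) <= t.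
  rewrite /GA negb_and negbK /b' /cut_seq /=; case: (boolP (n \in As)) => nA; rewrite ?(modulus0 R F hF)//.
  by rewrite orbF => /nGt.
have -> : U (cut_seq (predC (mem G)) b) = U (cut_seq (predC GA) b') +
    U (cut_seq (mem [seq n <- As | n \notin G]) b).
  rewrite -block_opD; congr U; apply/funext => n.
  rewrite seqDE /cut_seq /b' /cut_seq /GA /= mem_filter.
  by case: (n \in G); case: (n \in As); rewrite /= ?addr0 ?add0r.
have h1 : norm_le R (pm (U (cut_seq (predC GA) b'))) (8 * (H * Q)).
  apply: norm_le_dominated hq => // k; rewrite -block_op_cutB -/h.
  apply: (@le_trans _ _ (P2 * (mu k h + mu k (U (cut_seq GA b'))))).
    rewrite /block_sum -big_split mulr_sumr; apply: ler_sum => j _.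
    by rewrite -(pmassN R F p hF (U (cut_seq GA b'))); exact: pmassD.
  rewrite /H -mulrA ler_wpM2l// mulrDl mul1r lerD2l.
  exact: (mu_quasi_greedy b' t).
have card_le : (size [seq n <- As | n \notin G] = size [seq n <- G | n \notin As])%N.
  have e1 := count_predC (fun n => n \in G) As.
  have e2 := count_predC (fun n => n \in As) G.
  have e3 : (count (fun n => n \in G) As = count (fun n => n \in As) G)%N.
    rewrite -!size_filter; apply: perm_size; apply: uniq_perm; rewrite ?filter_uniq//.
    by move=> n; rewrite !mem_filter andbC.
  have sA : size As = m by rewrite -cA.
  rewrite !size_filter; rewrite e3 sA in e1; rewrite sG in e2.
  apply: (@addnI (count (fun n => n \in As) G)).
  exact: (etrans e1 (esym e2)).
set S2 := [seq n <- G | n \notin As] in card_le.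
(* The indicator of G \ A times t ^ p has block masses at most C times those of h. *)
have dem : t `^ p * (size S2)%:R <= 4 * (8 * (C * Q)).
  apply: norm_le_democratic; [by rewrite filter_uniq|exact: powR_ge0|].
  apply: (@norm_le_lattice _ (fun n => C * pm h n)) => [n|n|k|].
  - by rewrite mulr_ge0// pmass_ge0.
  - by rewrite mulr_ge0// powR_ge0.
  - have e : block_sum R (fun n => (n \in S2)%:R * t `^ p) k = t `^ p * block_sum R (fun n => (GA n)%:R) k.
      rewrite /block_sum mulr_sumr; apply: eq_bigr => j _; rewrite mulrC mem_filter andbC.
      by [].
    rewrite e /block_sum -mulr_sumr; exact: mu_lower.
  - exact: norm_leZ.
have h2 : norm_le R (pm (U (cut_seq (mem [seq n <- As | n \notin G]) b))) (C * (4 * (8 * (C * Q)))).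
  have hu := norm_le_upper b t [seq n <- As | n \notin G] (filter_uniq _ uA) _.
  have /hu {}hu : forall n, n \in [seq n <- As | n \notin G] -> modulus (b n) <= t.
    by move=> n; rewrite mem_filter => /andP[/nGt].
  move=> phi nphi B; apply: le_trans (hu phi nphi B) _.
  by rewrite ler_wpM2l// card_le.
have := qnorm_le R F p hF p0 _ _ (norm_le_pmassD R F p hF p0 _ _ _ _ h1 h2).
move=> hfin; apply: le_trans hfin _.
have -> : 2 `^ p * (8 * (H * Q) + C * (4 * (8 * (C * Q)))) = D * Q by rewrite /D -/P2; ring.
rewrite powRM// /Q (powRK R p p0) ?qnorm_ge0// ler_wpM2r ?qnorm_ge0//.
by rewrite le_max lexx orbT.
Qed.

(** * Conditionality *)

Lemma basis_vec_sum N (a : nat -> F) :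
  \sum_(n < N) a n *: basis_vec n = U (cut_seq (fun n => n < N)%N a).
Proof.
rewrite -(big_mkord xpredT (fun n => a n *: basis_vec n)) block_op_sum ?iota_uniq//.
by congr (U (cut_seq _ _)); apply/funext => n; rewrite /= mem_index_iota.
Qed.

Lemma mu_le_norm f c k : norm_le R (pm f) c -> mu k f <= 2 * c.
Proof. by move=> hc; apply: block_sum_le => // n; exact: pmass_ge0. Qed.

(** The vector f carries in block [kk r] a bad vector scaled to mass at most 2 ^ (- r), so it lies
    in the space. The projection on the initial segment of this block has mass at least 1, so the
    series in its natural order is not Cauchy. *)
Lemma not_unconditional (kk d : nat -> nat) :
  {homo kk : m n / (m < n)%N} ->
  (forall r, bad_block R F p _ (2 ^+ r) (fun i : 'I_(2 ^ kk r) => (i < d r)%N)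
     (kernel_op R F (2 ^ kk r) (K (kk r)))) ->
  ~ unconditional X q basis_vec coord_fun.
Proof.
move=> kinc bad uncond.
have kinj : injective kk.
  by move=> m n e; have [/kinc|/kinc|//] := ltngtP m n; rewrite e ltnn.
have kge r : (r <= kk r)%N.
  by elim: r => // r IH; apply: leq_ltn_trans IH (kinc _ _ _).
have /choice[bb hbb] : forall r, exists b : nat -> F,
    fmass R F p _ (kernel_op R F (2 ^ kk r) (K (kk r)) (fun i => b i)) <= 1 /\
    2 ^+ r <= fmass R F p _ (kernel_op R F (2 ^ kk r) (K (kk r))
      (cut_to R F _ (fun i : 'I_(2 ^ kk r) => (i < d r)%N) (fun i => b i))).
  move=> r; have [b h1 h2] := bad r.
  exists (fun n => if insub n is Some i then b i else 0).
  have -> : (fun i : 'I_(2 ^ kk r) => if insub (val i) is Some j then b j else 0) = b.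
    by apply/funext => i; rewrite valK.
  by split.
pose c r : F := of_real F ((2 ^- r) `^ p^-1).
have cp r : modulus (c r) `^ p = 2 ^- r.
  by rewrite (modulus_of_real hF) ?powR_ge0// powRVK// invr_ge0 exprn_ge0.
(* The search for r with kk r = k may stop at k, as r <= kk r. *)
pose pk k := [pick r : 'I_k.+1 | kk r == k].
pose b : sequences F := fun n =>
  if pk (blk n) is Some r then c r * bb r (n - base (blk n))%N else 0.
have pkk r : exists2 i : 'I_(kk r).+1, pk (kk r) = Some i & nat_of_ord i = r.
  rewrite /pk; case: pickP => [i /eqP /kinj ir|no]; first by exists i.
  by have := no (Ordinal (kge r : (r < (kk r).+1)%N)); rewrite eqxx.
have bpart r : block_part (kk r) b = fun i => c r * bb r i.
  apply/funext => i; rewrite /block_part /b blk_base// addKn.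
  by have [j -> jr] := pkk r; rewrite jr.
have bpart0 k : (forall r, kk r != k) -> block_part k b = fun=> 0.
  move=> no; apply/funext => i; rewrite /block_part /b blk_base// /pk.
  by case: pickP => // r; rewrite (negbTE (no r)).
pose f := U b.
have kZ k (a : F) (v : 'I_(2 ^ k) -> F) : fmass R F p _ (kernel_op R F (2 ^ k) (K k) (fun i => a * v i)) =
    modulus a `^ p * fmass R F p _ (kernel_op R F (2 ^ k) (K k) v).
  rewrite /fmass mulr_sumr; apply: eq_bigr => i _.
  rewrite -powRM ?(modulus_ge0 hF)// -(modulusM hF); congr (modulus _ `^ p).
  by rewrite /kernel_op mulr_sumr; apply: eq_bigr => j _; rewrite mulrCA.
have muf k : mu k f <= \sum_(r < k.+1) (kk r == k)%:R * 2 ^- r.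
  rewrite block_sum_pmass block_op_part.
  case: (pselect (exists r, kk r = k)) => [[r <-]|no].
    rewrite bpart kZ cp; apply: (@le_trans _ _ (2 ^- r)).
      by rewrite ler_piMr ?invr_ge0 ?exprn_ge0// (hbb r).1.
    rewrite (bigD1 (Ordinal (kge r : (r < (kk r).+1)%N)))//= eqxx mul1r lerDl sumr_ge0//.
  have nk r : kk r != k by apply/eqP => e; apply: no; exists r.
  rewrite (bpart0 k nk).
  rewrite /fmass big1; last first.
    move=> i _; rewrite /kernel_op big1; last by move=> j _; rewrite mulr0.
    by rewrite (modulus0 R F hF) powR0 ?gt_eqF.
  by apply: sumr_ge0 => r _; rewrite mulr_ge0// invr_ge0 exprn_ge0.
have Xf : X f.
  apply/(tsirelson_pP R F p hF p0) => e e0.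
  have [r0 hr0] : exists r0, 2 * 2 ^- r0 <= e.
    pose r0 := (Num.trunc (2 / e)).+1; exists r0.
    rewrite ler_pdivrMr ?exprn_gt0// mulrC -ler_pdivrMr//.
    apply: (@le_trans _ _ r0%:R); first by rewrite /r0; apply: ltW; apply: truncnS_gt.
    by rewrite -natrX ler_nat ltnW// ltn_expl.
  exists (base (kk r0)); apply: norm_le_blocks => [n|l].
    by rewrite mulr_ge0// pmass_ge0.
  apply: le_trans hr0.
  have geo N : \sum_(r < N) (r0 <= r)%N%:R * 2 ^- r <= (r0 <= N)%N%:R * (2 * 2 ^- r0 - 2 * 2 ^- N) :> R.
    elim: N => [|N IH].
      by rewrite big_ord0 leqn0; case: eqP => [->|_]; rewrite ?mul0r// subrr mulr0.
    rewrite big_ord_recr /=; apply: le_trans (lerD IH (lexx _)) _.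
    have eN : 2 * 2 ^- N.+1 = 2 ^- N :> R by rewrite exprS invfM mulrA divff ?mul1r.
    rewrite eN; have [rN|Nr] := leqP r0 N.
      by rewrite (leq_trans rN (leqnSn N)) !mul1r; lra.
    have [->|rN] := eqVneq r0 N.+1; first by rewrite leqnn !mul0r mul1r eN; lra.
    by rewrite leqNgt ltn_neqAle eq_sym rN Nr !mul0r; lra.
  apply: (@le_trans _ _ (\sum_(k < l) \sum_(r < l) (kk r == k)%:R * ((r0 <= r)%N%:R * 2 ^- r))).
    apply: ler_sum => k _; rewrite block_sum_tail.
    case: (leqP (kk r0) k) => rk; last first.
      by rewrite mul0r sumr_ge0// => r _; rewrite !mulr_ge0// invr_ge0 exprn_ge0.
    rewrite mul1r; apply: le_trans (muf k) _.
    have kl : (k.+1 <= l)%N by exact: ltn_ord.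
    rewrite -(big_mkord xpredT (fun r => (kk r == k)%:R * ((r0 <= r)%N%:R * 2 ^- r))).
    rewrite (big_cat_nat (n := k.+1)) //= big_mkord -[leLHS]addr0 lerD//; last first.
      by apply: sumr_ge0 => r _; rewrite !mulr_ge0// invr_ge0 exprn_ge0.
    apply: ler_sum => r _; case: eqP => [rk'|]; last by rewrite !mul0r.
    suff -> : (r0 <= r)%N by rewrite !mul1r.
    rewrite leqNgt; apply/negP => /kinc; rewrite rk' ltnNge.
    by rewrite rk.
  rewrite exchange_big /=; apply: (@le_trans _ _ (\sum_(r < l) (r0 <= r)%N%:R * 2 ^- r)).
    apply: ler_sum => r _; rewrite -mulr_suml ler_piMl ?mulr_ge0 ?invr_ge0 ?exprn_ge0//.
    have [lt|ge] := ltnP (kk r) l.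
      rewrite (bigD1 (Ordinal lt))//= eqxx big1 ?addr0// => i ni; case: eqP => // e'.
      by move: ni; rewrite -val_eqE /= e' eqxx.
    rewrite big1// => i _; case: eqP => // e'.
    by have := ltn_ord i; rewrite -e' ltnNge ge.
  have a0 : 0 <= 2 ^- r0 :> R by rewrite invr_ge0 exprn_ge0.
  have b0 : 0 <= 2 ^- l :> R by rewrite invr_ge0 exprn_ge0.
  by apply: le_trans (geo l) _; case: (r0 <= l)%N; rewrite ?mul1r ?mul0r; lra.
have bf : Ui f = b by exact: UK.
have := uncond f id Xf (inv_bij (fun _ => erefl)).
set u : nat -> R := (fun n => _) => hu.
have uE n : u n = q (U (cut_seq (predC (fun m => m < n)%N) b)).
  rewrite /u; congr (q _); rewrite -block_op_cutB -basis_vec_sum; congr (_ - _).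
  by apply: eq_bigr => i _; rewrite /coord_fun bf.
pose P2 : R := 2 `^ p; have P20 : 0 < P2 by exact: powR_gt0.
(* Two remainders of norm below e differ by a vector whose mass on any block is at most 1/2. *)
pose e : R := (1 / (P2 * 8)) `^ p^-1; have e0 : 0 < e by rewrite powR_gt0// divr_gt0// mulr_gt0.
move/cvgrPdist_lt : hu => /(_ _ e0)[M _ hM].
have {}hM n : (M <= n)%N -> u n < e.
  by move=> /hM /=; rewrite sub0r normrN ger0_norm// uE; exact: qnorm_ge0.
pose r := M; pose k := kk r; pose n1 := base k; pose n2 := (n1 + d r)%N.
have n1M : (M <= n1)%N by apply: leq_trans (kge M) (leq_base _).
have h1 := hM n1 n1M; have h2 := hM n2 (leq_trans n1M (leq_addr _ _)).
rewrite /= !uE in h1 h2.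
set f1 := U _ in h1; set f2 := U _ in h2.
(* Some finite bound is required by [qnorm_ub]; its size is irrelevant. *)
have bound N : norm_le R (pm (U (cut_seq (predC (fun m => m < N)%N) b)))
    (2 `^ p * ((q f) `^ p + C * ((\sum_(m < N) modulus (b m)) `^ p * N%:R))).
  rewrite -block_op_cutB.
  have [cc hcc] := tsirelson_p_bounded R F p hF p0 f Xf.
  apply: norm_le_pmassD => //; first exact: qnorm_ub hcc.
  rewrite pmassN//.
  have := norm_le_upper b (\sum_(m < N) modulus (b m)) (iota 0 N) (iota_uniq _ _) _.
  rewrite size_iota (_ : cut_seq (mem (iota 0 N)) b = cut_seq (fun m => m < N)%N b).
    apply=> m; rewrite mem_iota add0n => /= mg.
    by rewrite (bigD1 (Ordinal mg))//= lerDl sumr_ge0// => i _; exact: (modulus_ge0 hF).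
  by apply/funext => m; rewrite /cut_seq /= mem_iota.
have q1 := qnorm_ub R F p hF p0 _ _ (bound n1); have q2 := qnorm_ub R F p hF p0 _ _ (bound n2).
rewrite -/f1 in q1; rewrite -/f2 in q2.
have small g : q g < e -> q g `^ p <= 1 / (P2 * 8).
  move=> ge; have -> : 1 / (P2 * 8) = e `^ p.
    by rewrite /e powRVK// divr_ge0// mulr_ge0// ltW.
  apply: ge0_ler_powR; rewrite ?nnegrE; [exact: ltW|exact: qnorm_ge0|exact: ltW|exact: ltW].
have qd := norm_le_pmassD R F p hF p0 f1 (- f2) _ _ q1.
rewrite pmassN// in qd; have {qd} := qd _ q2.
have -> : f1 - f2 = U (cut_seq (fun m => (n1 <= m < n2)%N) b).
  rewrite -scaleN1r /f1 /f2 -block_opZ -block_opD; congr U; apply/funext => m.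
  rewrite seqDE seqZE /cut_seq /= -!leqNgt ltnNge.
  have n12 : (n1 <= n2)%N by exact: leq_addr.
  case: (leqP n2 m) => nm; first by rewrite (leq_trans n12 nm) /= mulN1r addrN.
  by rewrite mulr0 addr0 andbT.
move=> /(mu_le_norm _ _ k); rewrite block_sum_pmass block_op_part block_part_cut bpart.
have -> : cut_to R F _ (fun j : 'I_(2 ^ k) => (n1 <= base k + j < n2)%N) (fun i => c r * bb r i) =
    fun i => c r * cut_to R F _ (fun i : 'I_(2 ^ k) => (i < d r)%N) (fun i => bb r i) i.
  apply/funext => i; rewrite /cut_to /n2 /n1 leq_addr ltn_add2l /=.
  by case: ifP; rewrite ?mulr0.
rewrite kZ cp => h3.
have h4 : 1 <= 2 ^- r * fmass R F p 'I_(2 ^ k) (kernel_op R F (2 ^ k) (K k)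
     (cut_to R F 'I_(2 ^ k) (fun i : 'I_(2 ^ k) => (i < d r)%N) (fun i => bb r i))).
  by rewrite mulrC ler_pdivlMr ?exprn_gt0// mul1r (hbb r).2.
have s1 := small _ h1; have s2 := small _ h2.
have : 2 * (2 `^ p * (q f1 `^ p + q f2 `^ p)) <= 2 * (P2 * (1 / (P2 * 8) + 1 / (P2 * 8))).
  apply: ler_wpM2l; first exact: ler0n.
  apply: ler_wpM2l; first exact: ltW.
  exact: (lerD s1 s2).
have -> : 2 * (P2 * (1 / (P2 * 8) + 1 / (P2 * 8))) = 2^-1.
  by field; rewrite gt_eqF.
move=> h5; have := le_trans h4 (le_trans h3 h5).
by rewrite leNgt => /negP[]; rewrite invf_lt1// ltr1n.
Qed.

End Good.
End BlockOperator.

(** * A criterion for non-equivalence *)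

Section NotEquivalent.
Variables (R : realType) (F : scalarField R) (p : R).
Hypotheses (hF : valued F) (p0 : 0 < p).
Local Notation X := (@tsirelson_p R F p).
Local Notation q := (@tsirelson_p_qnorm R F p).
Local Notation pm := (pmass R F p).
Local Notation mu k f := (block_sum R (pm f) k).
Local Notation U := (block_op R F).
Local Notation bvec := (basis_vec R F).

(** All coefficients are bounded by the largest, which [block_lower] controls. The bound depends on
    the size of the block and on C, but not on how conditional the block is; it serves for the
    blocks that precede a given one. *)
Lemma good_block_cut (I : finType) (C : R) (u : (I -> F) -> I -> F) : 0 <= C ->
  good_block R F p I C u -> forall b A,
  fmass R F p I (u (cut_to R F I A b)) <= C * (C * #|I|%:R) * fmass R F p I (u b).
Proof.
move=> C0 gu b A; have [i0 _|noI] := pickP (mem I); last first.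
  rewrite /fmass big1; last by move=> i; have := noI i.
  by rewrite mulr_ge0 ?fmass_ge0// !mulr_ge0.
have [i _ imax] := arg_maxP (fun i => modulus (b i)) (isT : xpredT i0).
have h1 := block_upper _ _ _ _ _ _ gu b (modulus (b i)) A (fun j _ => imax j isT).
have h2 := block_lower _ _ _ _ _ _ gu b (modulus (b i)) (pred1 i) (modulus_ge0 hF _).
have {}h2 : modulus (b i) `^ p <= C * fmass R F p I (u b).
  by move: h2; rewrite card1 mulr1; apply => j /eqP ->.
apply: le_trans h1 _; rewrite -mulrA ler_wpM2l//.
apply: (@le_trans _ _ (modulus (b i) `^ p * #|I|%:R)).
  by rewrite ler_wpM2l ?powR_ge0// ler_nat max_card.
by rewrite [leRHS]mulrAC ler_wpM2r.
Qed.

Lemma qnorm0 : q 0 = 0.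
Proof.
have : q 0 <= 0 `^ p^-1.
  apply: qnorm_le => // phi _ B; rewrite big1// => i _.
  by rewrite pmass0// mulr0.
rewrite powR0 ?invr_eq0 ?gt_eqF// => h.
by apply: le_anti; rewrite h qnorm_ge0.
Qed.

Lemma block_op_c00 K b : c00 b -> c00 (U K b).
Proof.
move=> /c00P[B hB]; apply/c00P; exists (base B) => n; rewrite leq_base_blk => Bn.
rewrite /block_op big1// => j _; rewrite hB ?mulr0//.
apply: leq_trans (leq_addr _ _); apply: leq_trans Bn (leq_base _).
Qed.

Lemma cut_lt_c00 N b : c00 (cut_seq R F (fun n => n < N)%N b).
Proof. by apply/c00P; exists N => n Nn; rewrite /cut_seq ltnNge Nn. Qed.

Variables K1 K2 : nat -> nat -> nat -> F.

(** T transports the projection on the first L1 vectors to a projection on at most 2 ^ k.+1 vectors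
    of the second basis. The latter multiplies block masses by at most H, hence the p-th power of
    the norm by at most 8 H. *)
Lemma not_equivalent :
  (forall N : nat, exists k d H, [/\ 0 < H,
     bad_block R F p _ (N%:R * H) (fun i : 'I_(2 ^ k) => (i < d)%N) (kernel_op R F (2 ^ k) (K1 k)) &
     forall k', small_block R F p _ H (2 ^ k.+1) (kernel_op R F (2 ^ k') (K2 k'))]) ->
  forall (a : nat -> F) (pi : nat -> nat), (forall n, a n != 0) -> bijective pi ->
  ~ equivalent X q (perturbation a (bvec K1)) (permutation pi (bvec K2)).
Proof.
move=> hyp a pi a0 [pi' piK pi'K] [T [Ce [Tlin _ Ce0 Tq Tx]]].
set x' := perturbation a (bvec K1) in Tlin Tq Tx.
set y' := permutation pi (bvec K2) in Tx.
have spanX g : lin_span x' g -> c00 g -> closed_span X q x' g.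
  move=> sg cg; split=> [|e e0]; first exact: c00_tsirelson_p.
  by exists g => //; rewrite subrr qnorm0.
have x'sum N (c : nat -> F) : \sum_(n < N) c n *: x' n =
    U K1 (cut_seq R F (fun n => n < N)%N (fun n => c n * a n)).
  rewrite -basis_vec_sum; apply: eq_bigr => n _.
  by rewrite /x' /perturbation scalerA.
have x'c N (c : nat -> F) : closed_span X q x' (\sum_(n < N) c n *: x' n).
  apply: spanX; first by exists N, c.
  by rewrite x'sum; apply: block_op_c00; exact: cut_lt_c00.
have x'1 N : closed_span X q x' (x' N).
  have := x'c N.+1 (fun n => (n == N)%:R); rewrite big_ord_recr /= eqxx scale1r big1 ?add0r//.
  by move=> i _; rewrite ltn_eqF ?scale0r.
have T0 : T 0 = 0.
  have z : closed_span X q x' 0 by have := x'c 0%N (fun=> 0); rewrite big_ord0.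
  have := Tlin (-1) 0 0 z z; rewrite scaler0 addr0 scaleN1r addNr.
  by [].
have Tsum N (c : nat -> F) : T (\sum_(n < N) c n *: x' n) = \sum_(n < N) c n *: y' n.
  elim: N => [|N IH]; first by rewrite !big_ord0.
  by rewrite !big_ord_recr /= [X in T X]addrC (Tlin _ _ _ (x'1 N) (x'c N c)) Tx IH [RHS]addrC.
(* 16 is 2 from [block_sum_le] times 8 from the comparison of masses, and each passage through T
   costs one factor Ce ^ p. *)
pose B : R := 16 * (Ce `^ p * Ce `^ p).
have [k [d0 [H [H0 bad small]]]] := hyp (Num.trunc B).+1.
have hB : B < (Num.trunc B).+1%:R by apply: truncnS_gt.
set N := (Num.trunc B).+1 in bad hB.
pose d := minn d0 (2 ^ k).
have [bb hb1 hb2] := bad.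
pose gam : sequences F := fun n => if blk n == k then
  if insub (n - base k)%N is Some i then bb i else 0 else 0.
have gpart : block_part R F k gam = bb.
  by apply/funext => i; rewrite /block_part /gam blk_base// eqxx addKn valK.
have gpart0 l : l != k -> block_part R F l gam = fun=> 0.
  by move=> lk; apply/funext => i; rewrite /block_part /gam blk_base// (negbTE lk).
(* As [gam] vanishes before block k, the initial segment of length L1 cuts it just as the first d
   indices of the block do. *)
pose L0 := base k.+1; pose L1 := (base k + d)%N.
have L10 : (L1 <= L0)%N by rewrite /L0 baseS leq_add2l geq_minr.
have L1k : (L1 <= 2 ^ k.+1)%N.
  by apply: leq_trans L10 _; rewrite /L0 /base leq_pred.
pose f := U K1 gam; pose Sf := U K1 (cut_seq R F (fun n => n < L1)%N gam).
have fE : f = \sum_(n < L0) (gam n / a n) *: x' n.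
  rewrite (x'sum L0 (fun n => gam n / a n)) /f; congr (U K1 _); apply/funext => n; rewrite /cut_seq divfK//.
  case: ltnP => // h; rewrite /gam; case: eqP => // e.
  by move: h; rewrite /L0 leq_base_blk e ltnn.
have SfE : Sf = \sum_(n < L1) (gam n / a n) *: x' n.
  rewrite (x'sum L1 (fun n => gam n / a n)) /Sf; congr (U K1 _); apply/funext => n; rewrite /cut_seq divfK//.
have modz : modulus (0 : F) `^ p = 0 by rewrite (modulus0 R F hF) powR0// gt_eqF.
have nf : norm_le R (pm f) 1.
  apply: norm_le_blocks => [n|l]; first exact: pmass_ge0.
  apply: (@le_trans _ _ (\sum_(i < l) (i == k :> nat)%:R)).
    apply: ler_sum => i _; rewrite block_sum_pmass block_op_part.
    have [->|ik] := eqVneq (i : nat) k; first by rewrite gpart.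
    rewrite gpart0// /fmass big1// => j _; rewrite /kernel_op big1 ?modz// => m _.
    by rewrite mulr0.
  have [kl|lk] := ltnP k l.
    rewrite (bigD1 (Ordinal kl))//= eqxx big1 ?addr0// => i ik; case: eqP => // e.
    by move: ik; rewrite -val_eqE /= e eqxx.
  by rewrite big1// => i _; case: eqP => // e; have := ltn_ord i; rewrite e ltnNge lk.
have cSf : c00 Sf by apply: block_op_c00; exact: cut_lt_c00.
have hSf : N%:R * H <= 2 * q Sf `^ p.
  have [c hc] := tsirelson_p_bounded R F p hF p0 Sf (c00_tsirelson_p R F p hF p0 _ cSf).
  apply: le_trans (mu_le_norm R F p _ _ k (qnorm_ub R F p hF p0 _ _ hc)).
  rewrite block_sum_pmass block_op_part block_part_cut gpart.
  apply: le_trans hb2 _; rewrite le_eqVlt; apply/orP; left; apply/eqP.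
  congr (fmass _ _ _ _ (kernel_op _ _ _ _ _)); apply/funext => i; rewrite /cut_to.
  by rewrite /L1 ltn_add2l /d leq_min ltn_ord andbT.
pose del : nat -> F := fun m => gam (pi' m) / a (pi' m).
pose s0 := map pi (iota 0 L0); pose s1 := map pi (iota 0 L1).
have pi_inj : injective pi by exact: can_inj piK.
have us0 : uniq s0 by rewrite map_inj_uniq ?iota_uniq.
have us1 : uniq s1 by rewrite map_inj_uniq ?iota_uniq.
have TE M : T (\sum_(n < M) (gam n / a n) *: x' n) =
    U K2 (cut_seq R F (mem (map pi (iota 0 M))) del).
  rewrite (Tsum M (fun n => gam n / a n)) -(big_mkord xpredT (fun n => (gam n / a n) *: y' n)) /index_iota subn0.
  rewrite -block_op_sum ?map_inj_uniq ?iota_uniq// big_map; apply: eq_bigr => n _.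
  by rewrite /del piK.
pose g := U K2 (cut_seq R F (mem s0) del); pose Sg := U K2 (cut_seq R F (mem s1) del).
have cf := x'c L0 (fun n => gam n / a n); have cf' := x'c L1 (fun n => gam n / a n).
have [_ qg] := Tq _ cf; rewrite TE -fE -/s0 -/g in qg.
have [qSf _] := Tq _ cf'; rewrite TE -SfE -/s1 -/Sg in qSf.
have qf1 : q f <= 1.
  have := qnorm_le R F p hF p0 f 1 nf.
  by rewrite powR1.
have qgC : q g <= Ce.
  by apply: le_trans qg _; rewrite ler_piMr// ltW.
have cg : c00 g.
  apply: block_op_c00; apply/c00P; exists (\max_(i <- s0) i).+1 => n hn; rewrite /cut_seq /=.
  case: ifP => // ns; move: hn; rewrite ltnNge; move=> /negP[].
  by rewrite (big_rem _ ns) /= leq_maxl.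
have [c hc] := tsirelson_p_bounded R F p hF p0 g (c00_tsirelson_p R F p hF p0 _ cg).
have qgn := qnorm_ub R F p hF p0 _ _ hc.
have mub l : mu l Sg <= H * mu l g.
  rewrite !block_sum_pmass /Sg /g !block_op_part.
  have -> : cut_seq R F (mem s1) del = cut_seq R F (mem s1) (cut_seq R F (mem s0) del).
    apply/funext => n; rewrite /cut_seq /=; case: ifP => // ns1.
    suff -> : n \in s0 by [].
    move: ns1 => /mapP[m]; rewrite mem_iota => /andP[_ ml] ->.
    by rewrite map_f// mem_iota /= (leq_trans ml).
  rewrite block_part_cut; apply: small.
  apply: leq_trans L1k; rewrite -[L1](size_iota 0) -(size_map pi) -/s1 cardE.
  rewrite -(size_map (fun j : 'I_(2 ^ l) => (base l + j)%N)).
  apply: uniq_leq_size.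
    by rewrite map_inj_uniq ?enum_uniq// => i j /addnI /val_inj.
  by move=> n /mapP[j]; rewrite mem_enum => jA ->.
have nSg := norm_le_dominated R F p g Sg H _ (ltW H0) mub qgn.
have qSg : q Sg `^ p <= 8 * (H * q g `^ p).
  have := qnorm_le R F p hF p0 _ _ nSg => h.
  apply: le_trans (ge0_ler_powR (ltW p0) _ _ h) _; rewrite ?nnegrE ?qnorm_ge0 ?powR_ge0//.
  by rewrite powRVK// !mulr_ge0 ?powR_ge0// ltW.
have e1 : q g `^ p <= Ce `^ p.
  by apply: ge0_ler_powR; rewrite ?nnegrE; [exact: ltW|exact: qnorm_ge0|exact: ltW|].
have e2 : q Sf `^ p <= Ce `^ p * q Sg `^ p.
  rewrite -powRM ?qnorm_ge0 ?(ltW Ce0)//.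
  apply: ge0_ler_powR; rewrite ?nnegrE; [exact: ltW|exact: qnorm_ge0| |exact: qSf].
  by rewrite mulr_ge0 ?qnorm_ge0// ltW.
have CeP : 0 <= Ce `^ p by exact: powR_ge0.
have e3 : Ce `^ p * q Sg `^ p <= Ce `^ p * (8 * (H * Ce `^ p)).
  apply: ler_wpM2l => //; apply: le_trans qSg _; apply: ler_wpM2l => //.
  by apply: ler_wpM2l => //; exact: ltW.
have e4 : N%:R * H <= B * H.
  apply: le_trans hSf _; apply: (@le_trans _ _ (2 * (Ce `^ p * (8 * (H * Ce `^ p))))).
    by apply: ler_wpM2l => //; exact: le_trans e2 e3.
  by rewrite le_eqVlt; apply/orP; left; apply/eqP; rewrite /B; ring.
by move: e4; rewrite (ler_pM2r H0) leNgt hB.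
Qed.

End NotEquivalent.

(** * Uncountably many sets with infinite differences *)

Lemma uncountable_bool_sequences : ~ countable [set: nat -> bool].
Proof.
move=> /countable_injP[f finj].
pose D n := `[< exists2 al, f al = n & al n = false >].
case D1 : (D (f D)).
  move/asboolP: (D1) => [al fal alD].
  have e : al = D by apply: finj; rewrite ?inE.
  by move: alD; rewrite e D1.
have : D (f D) by apply/asboolP; exists D.
by rewrite D1.
Qed.

(* If al n <> be n, then for every i exactly one of the two codes contains
   pickle (n, al n, i), so the differences of the two sets are infinite. *)
Definition code_set (al : nat -> bool) : pred nat := fun r =>
  if (choice.unpickle r : option (nat * bool * nat)) is Some x then x.1.2 == al x.1.1 else false.

Lemma code_set_pickle al (n : nat) (b : bool) (i : nat) : code_set al (choice.pickle (n, b, i)) = (b == al n).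
Proof. by rewrite /code_set choice.pickleK. Qed.

Lemma pickle_unbounded (n : nat) (b : bool) N : exists i : nat, (N <= choice.pickle (n, b, i))%N.
Proof.
apply: contrapT => no.
have us : uniq [seq choice.pickle (n, b, i) | i <- iota 0 N.+1].
  by rewrite map_inj_uniq ?iota_uniq// => i j /(pcan_inj choice.pickleK) [].
have : {subset [seq choice.pickle (n, b, i) | i <- iota 0 N.+1] <= iota 0 N}.
  move=> m /mapP[i _ ->]; rewrite mem_iota /= add0n ltnNge; apply/negP => h.
  by apply: no; exists i.
by move=> /(uniq_leq_size us); rewrite size_map !size_iota ltnn.
Qed.

Lemma code_set_infinite al N : exists2 r, (N <= r)%N & code_set al r.
Proof.
have [i hi] := pickle_unbounded 0 (al 0%N) N.
by exists (choice.pickle (0%N, al 0%N, i)) => //; rewrite code_set_pickle.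
Qed.

Lemma code_set_differ al be N : al <> be ->
  exists2 r, (N <= r)%N & code_set al r && ~~ code_set be r.
Proof.
move=> ab; have [n hn] : exists n, al n <> be n.
  apply: contrapT => no; apply: ab; apply/funext => n.
  by apply: contrapT => h; apply: no; exists n.
have [i hi] := pickle_unbounded n (al n) N.
exists (choice.pickle (n, al n, i)) => //; rewrite !code_set_pickle eqxx /=.
exact/eqP.
Qed.

(** * The family of bases *)

Section Family.
Variables (R : realType) (F : scalarField R) (p : R).
Hypotheses (hF : valued F) (p0 : 0 < p).

Definition id_kernel (i j : nat) : F := (i == j)%:R.

Lemma id_kernelE E b : kernel_op R F E id_kernel b = b.
Proof.
apply/funext => i; rewrite /kernel_op (bigD1 i)//= /id_kernel eqxx mul1r.
rewrite big1 ?addr0// => j /negbTE ji.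
by rewrite eq_sym val_eqE ji mul0r.
Qed.

Lemma id_cut_le E A b : fmass R F p _ (cut_to R F 'I_E A b) <= fmass R F p _ b.
Proof.
apply: ler_sum => i _; rewrite /cut_to; case: (A i) => //.
by rewrite (modulus0 R F hF) powR0 ?gt_eqF// powR_ge0.
Qed.

Lemma id_kernel_good E C : 1 <= C -> good_block R F p _ C (kernel_op R F E id_kernel).
Proof.
move=> C1; have C0 : 0 <= C by apply: le_trans C1.
split=> [a b b'|b t G hG hnG|b t G t0 hG|b t G hG]; rewrite ?id_kernelE//.
- by apply: le_trans (id_cut_le _ _ _) _; rewrite ler_peMl ?fmass_ge0.
- apply: (@le_trans _ _ (fmass R F p _ b)); last by rewrite ler_peMl ?fmass_ge0.
  rewrite mulr_natr -sumr_const big_mkcond; apply: ler_sum => j _.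
  case: ifP => [Gj|_]; last exact: powR_ge0.
  by apply: ge0_ler_powR; rewrite ?nnegrE ?(modulus_ge0 hF) ?(ltW p0)//; exact: hG.
- apply: (@le_trans _ _ (t `^ p * #|G|%:R)); last by rewrite ler_peMl ?mulr_ge0 ?powR_ge0.
  rewrite mulr_natr -sumr_const [leRHS]big_mkcond; apply: ler_sum => j _.
  rewrite /cut_to unfold_in; case: ifP => [Gj|_]; last by rewrite (modulus0 R F hF) powR0 ?gt_eqF.
  apply: ge0_ler_powR; rewrite ?nnegrE ?(modulus_ge0 hF) ?(ltW p0)//; last exact: hG.
  exact: le_trans (modulus_ge0 hF _) (hG _ Gj).
Qed.

Lemma family_exists : exists (x : (nat -> bool) -> nat -> sequences F)
    (xs : (nat -> bool) -> nat -> sequences F -> F),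
  (forall al, [/\ is_basis (@tsirelson_p R F p) (@tsirelson_p_qnorm R F p) (x al) (xs al),
     almost_greedy (@tsirelson_p R F p) (@tsirelson_p_qnorm R F p) (x al) (xs al) &
     ~ unconditional (@tsirelson_p R F p) (@tsirelson_p_qnorm R F p) (x al) (xs al)]) /\
  forall al be, al <> be -> forall (a : nat -> F) (pi : nat -> nat),
    (forall n, a n != 0) -> bijective pi ->
    ~ equivalent (@tsirelson_p R F p) (@tsirelson_p_qnorm R F p)
        (perturbation a (x al)) (permutation pi (x be)).
Proof.
have [C C1 hC] := dyadic_block_exists R F p hF p0.
have C0 : 0 <= C by apply: le_trans C1.
(* By [good_block_cut], [Hb l] bounds every projection in a block of number at most l. In [Kb], the
   term r Hb l exceeds this by the factor r, for non-equivalence, and 2 ^ r is what conditionality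
   requires. *)
pose Hb l : R := C * (C * (2 ^ l)%:R).
pose Kb l r : R := r%:R * Hb l + 2 ^+ r.
have Hb_ge l : C <= Hb l.
  rewrite /Hb ler_peMr//; apply: le_trans C1 _; rewrite ler_peMr// ler1n.
  exact: expn2_gt0.
have Hb0 l : 0 < Hb l by apply: lt_le_trans (Hb_ge l); apply: lt_le_trans C1.
have /choice[nb hnb] : forall lr : nat * nat, exists y : nat * (nat -> nat -> F) * nat,
    [/\ (lr.1 < y.1.1)%N, good_block R F p _ C (kernel_op R F (2 ^ y.1.1) y.1.2),
    small_block R F p _ C (2 ^ lr.1.+1) (kernel_op R F (2 ^ y.1.1) y.1.2) &
    bad_block R F p _ (Kb lr.1 lr.2) (fun i : 'I_(2 ^ y.1.1) => (i < y.2)%N) (kernel_op R F (2 ^ y.1.1) y.1.2)].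
  move=> [l r]; have [l' [k [d h]]] := hC l (2 ^ l.+1)%N (Kb l r).
  by exists (l', k, d).
(* The r-th modified block has number jj r.+1. It is chosen knowing jj r, so that its projections on
   at most 2 ^ (jj r).+1 coordinates are bounded by C while the bad one exceeds what the blocks up
   to jj r allow. *)
pose jj := fix jj r : nat := if r is r'.+1 then (nb (jj r', r')).1.1 else 0%N.
pose kr r := (nb (jj r, r)).1.2; pose dr r := (nb (jj r, r)).2.
have jS r : (jj r < jj r.+1)%N by have [] := hnb (jj r, r).
have jinc : {homo jj : m n / (m < n)%N}.
  move=> m n; elim: n => // n IH; rewrite ltnS leq_eqVlt => /orP[/eqP->|/IH h]; first exact: jS.
  exact: ltn_trans h (jS n).
have jle : {homo jj : m n / (m <= n)%N}.
  by move=> m n; rewrite leq_eqVlt => /orP[/eqP->//|/jinc/ltnW].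
have jinj : injective jj.
  by move=> m n e; have [/jinc|/jinc|//] := ltngtP m n; rewrite e ltnn.
have jge r : (r <= jj r)%N.
  by elim: r => // r IH; apply: leq_ltn_trans IH (jS r).
pose Kal al k : nat -> nat -> F :=
  if [pick r : 'I_k.+1 | (jj r.+1 == k) && code_set al r] is Some r then kr r else id_kernel.
have KalP al k : (exists r, [/\ jj r.+1 = k, code_set al r & Kal al k = kr r]) \/
    Kal al k = id_kernel.
  rewrite /Kal; case: pickP => [r /andP[/eqP jr ar]|_]; last by right.
  by left; exists r.
have KalE al r : code_set al r -> Kal al (jj r.+1) = kr r.
  move=> ar; rewrite /Kal; case: pickP => [s /andP[/eqP /jinj [->]]//|no].
  have lt : (r < (jj r.+1).+1)%N by rewrite ltnS ltnW// jge.
  by have := no (Ordinal lt); rewrite /= eqxx ar.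
have goodr r : good_block R F p _ C (kernel_op R F (2 ^ jj r.+1) (kr r)).
  by have [] := hnb (jj r, r).
have goodK al k : good_block R F p _ C (kernel_op R F (2 ^ k) (Kal al k)).
  have [[r [<- _ ->]]|->] := KalP al k; first exact: goodr.
  exact: id_kernel_good.
have /choice[Ki hKi] : forall alk : (nat -> bool) * nat, exists k' : nat -> nat -> F,
    (forall i l, (i < 2 ^ alk.2)%N -> (l < 2 ^ alk.2)%N ->
      \sum_(j < 2 ^ alk.2) k' i j * Kal alk.1 alk.2 j l = (i == l)%:R) /\
    (forall i l, (i < 2 ^ alk.2)%N -> (l < 2 ^ alk.2)%N ->
      \sum_(j < 2 ^ alk.2) Kal alk.1 alk.2 i j * k' j l = (i == l)%:R).
  by move=> [al k]; exact: kernel_inverse (goodK al k).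
pose Ki' al k := Ki (al, k).
have invl al k := (hKi (al, k)).1.
have invr al k := (hKi (al, k)).2.
exists (fun al => basis_vec R F (Kal al)), (fun al => coord_fun R F (Ki' al)).
have badr r K : K <= Kb (jj r) r ->
    bad_block R F p _ K (fun i : 'I_(2 ^ jj r.+1) => (i < dr r)%N) (kernel_op R F (2 ^ jj r.+1) (kr r)).
  have [_ _ _ [b h1 h2]] := hnb (jj r, r).
  by move=> hK; exists b => //; exact: le_trans hK h2.
split=> [al|al be ab a pi a0 bpi].
  split.
  - exact: (basis_vec_is_basis R F p hF p0 (Kal al) (Ki' al) C C1 (goodK al) (invl al) (invr al)).
  - exact: (basis_vec_almost_greedy R F p hF p0 (Kal al) (Ki' al) C C1 (goodK al) (invl al) (invr al)).
  have /choice[sel hsel] : forall N, exists r, (N <= r)%N /\ code_set al r.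
    by move=> N; have [r h1 h2] := code_set_infinite al N; exists r.
  pose en := fix en n := if n is n'.+1 then sel (en n').+1 else sel 0%N.
  have enS n : (en n < en n.+1)%N by have [] := hsel (en n).+1.
  have ena n : code_set al (en n) by case: n => [|n]; [have [] := hsel 0%N|have [] := hsel (en n).+1].
  have enge n : (n <= en n)%N.
    by elim: n => // n IH; apply: leq_ltn_trans IH (enS n).
  have eninc : {homo en : m n / (m < n)%N}.
    move=> m n; elim: n => // n IH; rewrite ltnS leq_eqVlt => /orP[/eqP->|/IH h]; first exact: enS.
    exact: ltn_trans h (enS n).
  refine (not_unconditional R F p hF p0 (Kal al) (Ki' al) C C1 (goodK al) (invl al)
    (fun n => jj (en n).+1) (fun n => dr (en n)) _ _).
    by move=> m n mn; apply: jinc; rewrite ltnS; exact: eninc.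
  move=> n; rewrite KalE//; apply: badr.
  apply: (@le_trans _ _ (2 ^+ en n)); first by rewrite ler_weXn2l// ler1n.
  by rewrite /Kb lerDr mulr_ge0// ltW.
refine (not_equivalent R F p hF p0 (Kal al) (Kal be) _ a pi a0 bpi) => N.
have [r Nr /andP[ar br]] := code_set_differ al be N ab.
exists (jj r.+1), (dr r), (Hb (jj r)); split=> //.
  rewrite KalE//; apply: badr; rewrite /Kb.
  apply: (@le_trans _ _ (r%:R * Hb (jj r))); first by rewrite ler_wpM2r ?ler_nat// ltW.
  by rewrite lerDl exprn_ge0.
move=> k; have [[s [<- bs ->]]|->] := KalP be k; last first.
  move=> b A _; rewrite !id_kernelE; apply: le_trans (id_cut_le _ _ _) _.
  by rewrite ler_peMl ?fmass_ge0//; exact: le_trans C1 (Hb_ge _).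
(* Earlier modified blocks are bounded through their size, and later ones through their small
   projections, as jj r.+1 <= jj s. The case s = r is excluded by the choice of r. *)
have [sr|rs|sr] := ltngtP s r.
- move=> b A _; apply: le_trans (good_block_cut R F p hF _ C _ C0 (goodr s) b A) _.
  rewrite card_ord ler_wpM2r ?fmass_ge0// /Hb ler_wpM2l// ler_wpM2l// ler_nat.
  by rewrite leq_exp2l//; exact: jle.
- have [_ _ sm _] := hnb (jj s, s).
  move=> b A hA; apply: le_trans (sm b A _) _.
    by apply: leq_trans hA _; rewrite leq_exp2l// ltnS; exact: jle.
  by rewrite ler_wpM2r ?fmass_ge0.
- by move: br; rewrite -sr bs.
Qed.

End Family.

Theorem corollary5p5 (R : realType) (F : scalarField R)
    (hF : F = real_scalars R \/ F = complex_scalars R)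
    (p : R) (hp : 0 < p) :
  let X : set (sequences F) := tsirelson_p p in
  let q : sequences F -> R := tsirelson_p_qnorm p in
  exists (J : Type) (x : J -> nat -> sequences F)
         (xs : J -> nat -> sequences F -> F),
    [/\ ~ countable [set: J],
        forall j, [/\ is_basis X q (x j) (xs j),
                      almost_greedy X q (x j) (xs j) &
                      ~ unconditional X q (x j) (xs j)] &
        forall i j, i <> j ->
          forall (a : nat -> F) (pi : nat -> nat),
            perturbation_scalars a -> bijective pi ->
            ~ equivalent X q (perturbation a (x i)) (permutation pi (x j))].
Proof.
move=> X q; have vF : valued F.
  by case: hF => ->; [exact: valued_real|exact: valued_complex].
have [x [xs [h1 h2]]] := family_exists R F p vF hp.
exists (nat -> bool), x, xs; split => //; first exact: uncountable_bool_sequences.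
move=> i j ij a pi [a0 _] bpi; apply: h2 => // n; apply/eqP => an.
have : inf (range (fun n => modulus (a n))) <= modulus (a n).
  apply: ge_inf; last by exists n.
  by exists 0 => _ [m _ <-]; exact: (modulus_ge0 vF).
by rewrite an (modulus0 R F vF) leNgt a0.
Qed.
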